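(* Let $A$ be a unital semisimple commutative Banach algebra and $B$ a unital commutative Banach algebra. Suppose that $S$ is a map from $A$ onto $B$ which satisfies that there exists a non-zero complex number $\alpha$ such that the equality $$\mathrm{r}(Sf\,Sg-\alpha)=\mathrm{r}(fg-\alpha)$$ holds for every pair $f$ and $g$ in $A$. Then $B$ is semisimple and there exist an $\eta\in B$ with $\eta^2=1$, a homeomorphism $\phi$ from $\mathrm{Ch}(\mathrm{cl}\,B)$ onto $\mathrm{Ch}(\mathrm{cl}\,A)$ and a clopen subset $K$ of $\mathrm{Ch}(\mathrm{cl}\,B)$ such that the equality $$Sf(y)=\eta(y)\times\begin{cases} f(\phi(y)), & y\in K,\\ \frac{\alpha}{|\alpha|}\overline{f(\phi(y))}, & y\in\mathrm{Ch}(\mathrm{cl}\,B)\setminus K\end{cases}$$ holds for every $f\in A$. Furthermore, if $S1=1$, then $\eta=1$. Furthermore, if $S1=1$, and in addition either $\alpha\in\mathbb{C}\setminus\mathbb{R}$ or there exists a $\lambda\in\mathbb{C}\setminus\mathbb{R}$ such that $S\lambda=\lambda$, then $K=\mathrm{Ch}(\mathrm{cl}\,B)$ and the equality $$Sf(y)=f(\phi(y)),\quad y\in\mathrm{Ch}(\mathrm{cl}\,B)$$ holds for every $f\in A$.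
   Context: Banach algebras are over $\mathbb{C}$. $\mathrm{r}(\cdot)$ is the spectral radius; $M_A$ is the maximal ideal space of $A$. $\mathrm{cl}\,A$ is the closure, in the supremum norm, of the Gelfand transform $\hat A$ of $A$ in $C(M_A)$, the algebra of all complex-valued continuous functions on $M_A$; it is a uniform algebra on $M_A$, i.e. a uniformly closed subalgebra of $C(M_A)$ containing the constants and separating the points of $M_A$. If $A$ is semisimple, elements of $A$ are identified with their Gelfand transforms, so that $A\subset\mathrm{cl}\,A\subset C(M_A)$. $\mathrm{Ch}(\mathrm{cl}\,A)\subset M_A$ is the Choquet boundary of $\mathrm{cl}\,A$. The same notation is used for $B$. Complex numbers are identified with the corresponding multiples of the unit. $S$ is not assumed to be linear or multiplicative.
   Formalization: The clause ''if S1=1, then η=1'' is proved only when α is not a negative real number; for negative α it is false (A=B=ℂ, α=−1, S complex conjugation has S1=1 but forces η=−1). *)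

(* Defs.v *)
From HB Require Import structures.
From mathcomp Require Import all_boot all_order all_algebra.
From mathcomp Require Import ring_quotient.
From mathcomp Require Export complex.
From mathcomp Require Import all_classical all_reals.
From mathcomp Require Import topology normedtype.

Set Implicit Arguments.
Unset Strict Implicit.
Unset Printing Implicit Defensive.

Import Order.TTheory GRing.Theory Num.Theory.
Import numFieldNormedType.Exports.

Local Open Scope classical_set_scope.
Local Open Scope ring_scope.

(* As for every numFieldType K, the topology and the norm live on K^o; the
   values of the norm of a space over R[i] are nonnegative elements of R[i]. *)

HB.mixin Record CompleteNormedModule_isComBanachAlgebra (K : numFieldType) A
    of CompleteNormedModule K A := {
  banach_mul : A -> A -> A;
  banach_one : A;
  banach_mulA : associative banach_mul;
  banach_mulC : commutative banach_mul;
  banach_mul1 : left_id banach_one banach_mul;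
  banach_mulDl : left_distributive banach_mul +%R;
  banach_one_neq0 : banach_one != 0;
  banach_scaleAl : forall (a : K) (x y : A),
    a *: banach_mul x y = banach_mul (a *: x) y;
  banach_normM : forall x y : A, `|banach_mul x y| <= `|x| * `|y|
}.

(* Unital commutative Banach algebras (with 1 != 0). The unit is not required
   to have norm 1. The product is a field of the mixin, rather than inherited
   from GRing.ComAlgebra, because Hierarchy Builder lacks the joins of the ring
   structures with the normed ones; the ring structures are derived below. *)
#[short(type="comBanachAlgType")]
HB.structure Definition ComBanachAlgebra (K : numFieldType) :=
  { A of CompleteNormedModule K A
       & CompleteNormedModule_isComBanachAlgebra K A }.

HB.instance Definition _ (K : numFieldType) (A : comBanachAlgType K) :=
  GRing.Zmodule_isComNzRing.Build (ComBanachAlgebra.sort A)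
    (@banach_mulA K A) (@banach_mulC K A) (@banach_mul1 K A)
    (@banach_mulDl K A) (@banach_one_neq0 K A).
HB.instance Definition _ (K : numFieldType) (A : comBanachAlgType K) :=
  GRing.Lmodule_isLalgebra.Build K (ComBanachAlgebra.sort A) (@banach_scaleAl K A).
HB.instance Definition _ (K : numFieldType) (A : comBanachAlgType K) :=
  GRing.Lalgebra_isComAlgebra.Build K (ComBanachAlgebra.sort A).

Section BanachAlgebra.
Variables (R : realType) (A : comBanachAlgType R[i]).
Local Notation C := (R[i]^o).

Definition spectrum (x : A) : set R[i] :=
  [set l | ~ exists y : A, (x - l%:A) * y = 1].

Definition spectral_radius (x : A) : R :=
  sup [set complex.Re `|l| | l in spectrum x].

(* idealr_closed includes properness. *)
Definition maximal_ideal (I : {pred A}) : Prop :=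
  idealr_closed I /\
  forall J : {pred A}, idealr_closed J -> {subset I <= J} -> {subset J <= I}.

Definition radical : set A :=
  [set x | forall I : {pred A}, maximal_ideal I -> x \in I].

Definition semisimple : Prop := radical = [set 0].

(* A maximal ideal is represented by the unital complex homomorphism of which
   it is the kernel. *)
Definition max_ideal_space : Type := {lrmorphism A -> C}.

Definition gelfand (x : A) (m : max_ideal_space) : C :=
  (m : {lrmorphism A -> C}) x.

HB.instance Definition _ := gen_eqMixin max_ideal_space.
HB.instance Definition _ := gen_choiceMixin max_ideal_space.

(* The Gelfand topology: pointwise convergence on A. *)
HB.instance Definition _ := Topological.copy max_ideal_space
  (@initial_topology max_ideal_space {ptws A -> C} (fun m x => gelfand x m)).

Definition cl : set {uniform max_ideal_space -> C} :=
  closure (range (gelfand : A -> {uniform max_ideal_space -> C})) `&`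
  [set g | continuous (g : max_ideal_space -> C)].

End BanachAlgebra.
Arguments cl {R} A.

Section ChoquetBoundary.
Variables (R : realType) (X : Type).
Local Notation C := (R[i]^o).

(* Only the restriction of L to E matters: a state is a linear functional of
   norm 1 = L 1 on E, E being normed by the supremum norm. *)
Definition state (E : set (X -> C)) (L : (X -> C) -> C) : Prop :=
  [/\ forall (a : C) (f g : X -> C), E f -> E g ->
        L (fun x => a * f x + g x) = a * L f + L g,
      forall (f : X -> C) (c : C), E f -> (forall x, `|f x| <= c) ->
        `|L f| <= c
    & L (fun=> 1) = 1].

(* The points whose evaluation functional is an extreme point of the set of
   states of E. *)
Definition Choquet_boundary (E : set (X -> C)) : set X :=
  [set x | forall (L1 L2 : (X -> C) -> C) (t : R),
     state E L1 -> state E L2 -> 0 < t < 1 ->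
     (forall f, E f -> f x = t%:C%C * L1 f + (1 - t)%:C%C * L2 f) ->
     forall f, E f -> L1 f = f x /\ L2 f = f x].

End ChoquetBoundary.

Definition Ch (R : realType) (A : comBanachAlgType R[i]) :
  set (max_ideal_space A) := Choquet_boundary (cl A).
Arguments Ch {R} A.

Definition homeomorphism (X Y : topologicalType) (phi : X -> Y) : Prop :=
  continuous phi /\
  exists2 psi : Y -> X, continuous psi & cancel phi psi /\ cancel psi phi.

(* Main.v *)
(* Up to a dilation alpha = 1. Replacing f by n f and letting n grow turns
   r (Sf Sg - 1) = r (f g - 1) into r (Sf Sg) = r (f g). A point x of the Choquet
   boundary is a limit of peaking elements u, and the points where the elements
   S u peak accumulate at a single point y such that |Sf (y)| = |f (x)| for all f;
   the converse relation has the same properties, which yields the homeomorphism.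
   Taking Sg = - s v / Sf(y), with v peaking at y and s large, shows moreover that the
   real inner product of f(x) and f'(x) is that of Sf(y) and Sf'(y), so that Sf(y)
   is either f(x) or its conjugate, up to the sign of S1(y).

   The Gelfand theory of commutative Banach algebras is obtained without complex
   analysis, from (F(z) + F(-z)) / 2 = z^2 (z^2 - x^2)^-1 for F(z) = z (z - x)^-1.
   All arguments take place in A rather than in its uniform closure: the points of
   the Choquet boundary are those at which elements of A approximately peak. *)

From HB Require Import structures.
Require Import Defs.
From mathcomp Require Import all_boot all_order all_algebra.
From mathcomp Require Import all_classical all_reals.
From mathcomp Require Import topology normedtype.
From mathcomp Require Import sequences ring lra.

Set Implicit Arguments.
Unset Strict Implicit.
Unset Printing Implicit Defensive.

Import Order.TTheory GRing.Theory Num.Theory.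
Import numFieldNormedType.Exports.

Local Open Scope classical_set_scope.
Local Open Scope ring_scope.

(** [S] lives on [A] and is not assumed continuous, so it cannot be extended to [cl A]: elements of
    [A] peak only up to an error, and passage to the limit goes through compactness of the maximal
    ideal space. The boundary itself is defined by extreme states of [cl A]; the bridge to peaking
    in [A] is Hahn-Banach on all bounded real functions, with positive functionals in place of
    measures. Moduli alone lose the phase of [Sf(y)]. The value [- s] recovers it because it is the
    point of the disc of radius [s] farthest from 1: a product whose distance to 1 is almost [1 + s]
    must be close to [- s]. Only real inner products can be expected, since conjugation also
    preserves the hypothesis for [alpha = 1]; undoing the dilation by a square root of [alpha] turns
    conjugation into the factor [alpha / |alpha|]. In the Gelfand theory, the averaging identity
    replaces the maximum principle: passing from [x] to [x ^+ 2] squares the radii of two circles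
    without increasing the oscillation of [z (z - x)^-1] between them. *)

Local Notation nc := Normc.normc.
(** * Complex numbers *)

Section Modulus.
Variable R : rcfType.
Implicit Types z w : R[i].

Lemma norm_ncE z : `|z| = (nc z)%:C%C.
Proof. by rewrite normc_def; case: z. Qed.

Lemma nc_ge0 z : 0 <= nc z.
Proof. by case: z => a b; exact: sqrtr_ge0. Qed.

Lemma sqr_nc z : nc z ^+ 2 = complex.Re z ^+ 2 + complex.Im z ^+ 2.
Proof. by case: z => a b; rewrite sqr_sqrtr// addr_ge0 ?sqr_ge0. Qed.

Lemma nc_eq0 z : (nc z == 0) = (z == 0).
Proof.
apply/eqP/eqP => [|->]; [exact: Normc.eq0_normc|exact: Normc.normc0].
Qed.

Lemma nc_gt0 z : (0 < nc z) = (z != 0).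
Proof. by rewrite lt_def nc_ge0 andbT nc_eq0. Qed.

Lemma ncN z : nc (- z) = nc z. Proof. exact: normcN. Qed.
Lemma ncD z w : nc (z + w) <= nc z + nc w. Proof. exact: le_normcD. Qed.
Lemma ncB z w : nc (z - w) <= nc z + nc w.
Proof. by rewrite -(ncN w) ncD. Qed.
Lemma ncBC z w : nc (z - w) = nc (w - z). Proof. by rewrite -ncN opprB. Qed.
Lemma nc_tri z w : nc z <= nc w + nc (z - w).
Proof. by rewrite -{1}(subrK w z) addrC ncD. Qed.
Lemma ncM z w : nc (z * w) = nc z * nc w. Proof. exact: Normc.normcM. Qed.
Lemma ncX z n : nc (z ^+ n) = nc z ^+ n.
Proof.
by elim: n => [|n ih]; rewrite ?expr0 ?Normc.normc1// !exprS ncM ih.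
Qed.
Lemma ncV z : nc z^-1 = (nc z)^-1. Proof. exact: Normc.normcV. Qed.

Lemma ncR (x : R) : nc x%:C%C = `|x|.
Proof. by rewrite /= expr0n addr0 sqrtr_sqr. Qed.

Lemma nc_i : nc 'i%C = 1 :> R.
Proof. by rewrite /= expr0n add0r expr1n sqrtr1. Qed.

Lemma nc_Re z : `|complex.Re z| <= nc z.
Proof.
by rewrite -ler_sqr ?nnegrE ?nc_ge0// sqr_nc real_normK ?num_real// lerDl sqr_ge0.
Qed.

Lemma Re_le_nc z : complex.Re z <= nc z.
Proof. exact: le_trans (ler_norm _) (nc_Re z). Qed.

Lemma nc_Im z : `|complex.Im z| <= nc z.
Proof.
by rewrite -ler_sqr ?nnegrE ?nc_ge0// sqr_nc real_normK ?num_real// lerDr sqr_ge0.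
Qed.

Lemma nc_le_ReIm z : nc z <= `|complex.Re z| + `|complex.Im z|.
Proof.
have H : 0 <= `|complex.Re z| * `|complex.Im z| by rewrite mulr_ge0.
rewrite -ler_sqr ?nnegrE ?nc_ge0 ?addr_ge0// sqr_nc sqrrD !real_normK ?num_real//.
by lra.
Qed.

Lemma cReD z w : complex.Re (z + w) = complex.Re z + complex.Re w.
Proof. by case: z; case: w. Qed.
Lemma cImD z w : complex.Im (z + w) = complex.Im z + complex.Im w.
Proof. by case: z; case: w. Qed.
Lemma cReN z : complex.Re (- z) = - complex.Re z. Proof. by case: z. Qed.
Lemma cImN z : complex.Im (- z) = - complex.Im z. Proof. by case: z. Qed.
Lemma cReM z w : complex.Re (z * w)
  = complex.Re z * complex.Re w - complex.Im z * complex.Im w.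
Proof. by case: z; case: w. Qed.
Lemma cImM z w : complex.Im (z * w)
  = complex.Re z * complex.Im w + complex.Im z * complex.Re w.
Proof. by case: z; case: w. Qed.
Definition ReImE := (cReD, cImD, cReN, cImN, cReM, cImM).

Lemma phase z : exists2 w, nc w = 1 & w * z = (nc z)%:C%C.
Proof.
have [->|z0] := eqVneq z 0.
  by exists 1; rewrite ?Normc.normc1// mulr0 Normc.normc0.
have nz : (nc z)%:C%C != 0 :> R[i].
  by rewrite (_ : 0 = 0%:C%C)// (inj_eq (@complexI _)) nc_eq0.
exists ((nc z)%:C%C / z); last by rewrite divfK.
by rewrite ncM ncV ncR ger0_norm ?nc_ge0// divff// nc_eq0.
Qed.
End Modulus.

Section RealComplex.
Variable R : rcfType.
Implicit Types a b : R.

Lemma rcV a : (a%:C%C)^-1 = (a^-1)%:C%C.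
Proof. exact: (esym (fmorphV (real_complex R) a)). Qed.
Lemma rcD a b : a%:C%C + b%:C%C = (a + b)%:C%C.
Proof. exact: (esym (rmorphD (real_complex R) a b)). Qed.
Lemma rcB a b : a%:C%C - b%:C%C = (a - b)%:C%C.
Proof. exact: (esym (rmorphB (real_complex R) a b)). Qed.
Lemma rcM a b : a%:C%C * b%:C%C = (a * b)%:C%C.
Proof. exact: (esym (rmorphM (real_complex R) a b)). Qed.
Lemma rc1 : 1 = (1 : R)%:C%C. Proof. by []. Qed.
End RealComplex.

(** * Invertibility near the unit *)

Section Norm.
Variables (R : realType) (A : comBanachAlgType R[i]).
Implicit Types (x y : A) (l : R[i]).

Definition nrm x : R := complex.Re `|x|.

Lemma nrmE x : `|x| = (nrm x)%:C%C.
Proof. by rewrite /nrm RRe_real// realE normr_ge0. Qed.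

Lemma nrm_ge0 x : 0 <= nrm x.
Proof. by have := normr_ge0 x; rewrite nrmE ler0c. Qed.

Lemma nrm_eq0 x : nrm x = 0 -> x = 0.
Proof. by move=> x0; apply/eqP; rewrite -normr_eq0 nrmE x0. Qed.

Lemma nrmD x y : nrm (x + y) <= nrm x + nrm y.
Proof. by have := ler_normD x y; rewrite !nrmE -rmorphD/= lecR. Qed.

Lemma nrmN x : nrm (- x) = nrm x. Proof. by rewrite /nrm normrN. Qed.

Lemma nrmM x y : nrm (x * y) <= nrm x * nrm y.
Proof. by have := banach_normM x y; rewrite !nrmE -rmorphM/= lecR. Qed.

Lemma nrmZ l x : nrm (l *: x) = nc l * nrm x.
Proof. by apply: complexI; rewrite -nrmE normrZ norm_ncE nrmE rmorphM. Qed.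

Lemma nrm1_gt0 : 0 < nrm 1.
Proof.
rewrite lt_def nrm_ge0 andbT; apply/eqP => /nrm_eq0 /eqP.
by rewrite oner_eq0.
Qed.

Lemma small_pow (p e : R) : 0 <= p -> p < 1 -> 0 < e -> exists n, p ^+ n < e.
Proof.
move=> p0 p1 e0; have /cvgrPdist_lt/(_ e e0)[n _ /(_ n)] :
  (fun n => p ^+ n) @ \oo --> (0 : R) by apply: cvg_expr; rewrite ger0_norm.
rewrite /= leqnn => /(_ isT) H; exists n.
by move: H; rewrite sub0r normrN ger0_norm// exprn_ge0.
Qed.

Lemma nrmX x n : nrm (x ^+ n) <= nrm x ^+ n * nrm 1.
Proof.
elim: n => [|n ih]; first by rewrite !expr0 mul1r.
by rewrite !exprS -mulrA (le_trans (nrmM _ _))// ler_wpM2l ?nrm_ge0.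
Qed.

(** The geometric series in [1 - x] converges to an inverse. The unit may have norm other than 1, so
    [nrm 1] enters every bound on powers. *)
Lemma neumann x : nrm (1 - x) < 1 -> exists y, x * y = 1.
Proof.
set c := 1 - x; set p := nrm c => p1.
have p0 : 0 <= p := nrm_ge0 _.
pose K := nrm 1 / (1 - p).
have K0 : 0 < K by rewrite divr_gt0 ?nrm1_gt0 ?subr_gt0.
have KE : K * (1 - p) = nrm 1 by rewrite divfK// gt_eqF// subr_gt0.
pose u n := \sum_(k < n) c ^+ k.
(* As [K * (1 - p) = nrm 1], the induction on [j] closes with equality. *)
have uB N j : nrm (u (N + j)%N - u N) <= K * p ^+ N * (1 - p ^+ j).
  elim: j => [|j ih].
    by rewrite addn0 subrr expr0 subrr mulr0 /nrm normr0.
  rewrite addnS /u big_ord_recr/= -/(u _) addrAC.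
  apply: le_trans (nrmD _ _) _; apply: le_trans (lerD ih (nrmX _ _)) _.
  by rewrite -/p -KE exprD exprS; rewrite le_eqVlt; apply/orP; left; apply/eqP; ring.
have smallK e : 0 < e -> exists n, K * p ^+ n < e.
  move=> e0; have [n] := small_pow p0 p1 (divr_gt0 e0 K0).
  by rewrite ltr_pdivlMr// mulrC; exists n.
have uN N n : (N <= n)%N -> nrm (u n - u N) <= K * p ^+ N.
  move=> /subnKC <-; apply: le_trans (uB _ _) _.
  by apply: ler_piMr; [by rewrite mulr_ge0 ?(ltW K0) ?exprn_ge0|by rewrite gerBl exprn_ge0].
have : cvg (u @ \oo).
  apply/cauchy_cvgP/cauchy_exP => e e0.
  have eE : e = (complex.Re e)%:C%C by rewrite RRe_real// gtr0_real.
  have /smallK[N HN] : 0 < complex.Re e by rewrite eE ltcR in e0.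
  exists (u N), N => // n /= Nn; rewrite -ball_normE /ball_ /= distrC.
  by rewrite nrmE eE ltcR (le_lt_trans (uN _ _ Nn)).
move=> /cvg_ex[y uy]; exists y.
have xu n : x * u n = 1 - c ^+ n.
  rewrite (_ : x = 1 - c) /u; last by rewrite /c; ring.
  elim: n => [|n ih]; first by rewrite big_ord0 mulr0 expr0 subrr.
  by rewrite big_ord_recr/= mulrDr ih exprS; ring.
apply/eqP; rewrite -subr_eq0; apply/eqP/nrm_eq0/eqP.
rewrite eq_le nrm_ge0 andbT leNgt; apply/negP => d0.
set d := nrm _ in d0.
pose e := d / (4 * (nrm x + 1)).
have x1 : 0 < nrm x + 1 by rewrite ltr_wpDl ?nrm_ge0.
have e0 : 0 < e by rewrite divr_gt0// mulr_gt0.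
have ec0 : 0 < e%:C%C :> R[i] by rewrite ltcR.
have /cvgrPdist_lt/(_ _ ec0)[N1 _ HN1] := uy.
have [N2 HN2] : exists n, p ^+ n * nrm 1 < d / 4.
  have : 0 < d / 4 / nrm 1 by rewrite !divr_gt0 ?nrm1_gt0.
  move=> /(small_pow p0 p1)[n]; rewrite ltr_pdivlMr ?nrm1_gt0//; by exists n.
pose n := (maxn N1 N2).
have H1 : nrm (y - u n) < e by rewrite -ltcR -nrmE; apply: HN1; exact: leq_maxl.
have H2 : nrm (c ^+ n) <= p ^+ N2 * nrm 1.
  apply: le_trans (nrmX _ _) _; rewrite ler_wpM2r ?nrm_ge0// -/p.
  by rewrite ler_wiXn2l ?(ltW p1)// leq_maxr.
have : d <= nrm x * nrm (y - u n) + nrm (c ^+ n).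
  rewrite /d (_ : x * y - 1 = x * (y - u n) - c ^+ n); last first.
    by rewrite mulrBr xu; ring.
  by apply: le_trans (nrmD _ _) _; rewrite nrmN lerD2r nrmM.
have : nrm x * nrm (y - u n) <= d / 4.
  have <- : (nrm x + 1) * e = d / 4.
    by rewrite /e; field; rewrite gt_eqF.
  by rewrite ler_pM ?nrm_ge0// ?lerDl// ltW.
by lra.
Qed.
End Norm.

(** * The Gelfand-Mazur theorem *)

Section Ultralimit.
Variables (R : realType) (T : Type) (F : set_system T).
Context {FU : UltraFilter F}.

(** A bounded function has a cluster point along the filter by compactness of the segment, and an
    ultrafilter converges to its cluster points. *)
Lemma ultralimit_real (f : T -> R) (M : R) : F [set t | `|f t| <= M] ->
  exists l, forall e, 0 < e -> F [set t | `|f t - l| < e].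
Proof.
move=> FM.
have /(segment_compact (fmap_proper_filter f _))[l [_ cl]] : (f @ F) [set` `[- M, M]].
  rewrite /fmap /=; apply: filterS FM => t /=.
  by rewrite in_itv/= ler_norml.
exists l => e e0; have [//|Fn] := in_ultra_setVsetC [set t | `|f t - l| < e] FU.
have [|r [/= r1 r2]] := cl [set r | ~ (`|r - l| < e)] (ball l e) _ (nbhsx_ballx _ _ e0).
  exact: Fn.
by case: r1; rewrite distrC.
Qed.

Lemma ultralimit (f : T -> R[i]) (M : R) : F [set t | nc (f t) <= M] ->
  exists l, forall e, 0 < e -> F [set t | nc (f t - l) < e].
Proof.
move=> FM.
have [a Ha] : exists l, forall e, 0 < e -> F [set t | `|complex.Re (f t) - l| < e].
  by apply: (ultralimit_real (M := M)); apply: filterS FM => t; apply: le_trans; exact: nc_Re.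
have [b Hb] : exists l, forall e, 0 < e -> F [set t | `|complex.Im (f t) - l| < e].
  by apply: (ultralimit_real (M := M)); apply: filterS FM => t; apply: le_trans; exact: nc_Im.
exists (Complex a b) => e e0.
have e20 : 0 < e / 2 by rewrite divr_gt0.
apply: filterS (filterI (Ha _ e20) (Hb _ e20)) => t [/= h1 h2].
apply: le_lt_trans (nc_le_ReIm _) _; rewrite !ReImE/=; lra.
Qed.
End Ultralimit.

Section GelfandMazur.
Variables (R : realType) (A : comBanachAlgType R[i]) (I : set A).
Hypotheses (I0 : I 0) (I1 : ~ I 1).
Hypothesis ID : forall a u v, I u -> I v -> I (a * u + v).
Implicit Types (a b c x y : A) (l z w : R[i]).

Lemma ideal_add u v : I u -> I v -> I (u + v).
Proof. by move=> Iu Iv; rewrite -(mul1r u); exact: ID. Qed.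
Lemma ideal_mul a u : I u -> I (a * u).
Proof. by move=> Iu; rewrite -(addr0 (a * u)); exact: ID. Qed.
Lemma ideal_opp u : I u -> I (- u).
Proof. by rewrite -mulN1r; exact: ideal_mul. Qed.
Lemma ideal_sub u v : I u -> I v -> I (u - v).
Proof. by move=> Iu Iv; apply: ideal_add => //; exact: ideal_opp. Qed.

(** The seminorm of the coset of [a]: computations in the quotient [A / I] are carried out in
    [A]. *)
Definition qnrm a : R := inf [set nrm (a + u) | u in I].

Let qlb a : has_lbound [set nrm (a + u) | u in I].
Proof. by exists 0 => _ [u _ <-]; exact: nrm_ge0. Qed.

Let qn0 a : [set nrm (a + u) | u in I] !=set0.
Proof. by exists (nrm (a + 0)), 0. Qed.

Lemma qnrm_le a u : I u -> qnrm a <= nrm (a + u).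
Proof. by move=> Iu; apply: (ge_inf (qlb a)); exists u. Qed.

Lemma qnrm_adh a e : 0 < e -> exists2 u, I u & nrm (a + u) < qnrm a + e.
Proof.
move=> e0; have [|_ [u Iu <-]] := inf_adherent e0 (E := [set nrm (a + u) | u in I]).
  by split; [exact: qn0|exact: qlb].
by exists u.
Qed.

Lemma qnrm_ge0 a : 0 <= qnrm a.
Proof. by apply: lb_le_inf (qn0 a) _ => _ [u _ <-]; exact: nrm_ge0. Qed.

Lemma qnrm_le_nrm a : qnrm a <= nrm a.
Proof. by rewrite -{2}(addr0 a) qnrm_le. Qed.

Lemma qnrm_ideal a b : I (a - b) -> qnrm a = qnrm b.
Proof.
have H a' b' : I (a' - b') -> qnrm a' <= qnrm b'.
  move=> Iab; apply/ler_addgt0Pr => e e0; have [u Iu /ltW h] := qnrm_adh b' e0.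
  apply: le_trans h; rewrite (_ : b' + u = a' + (u - (a' - b'))); last by ring.
  by apply: qnrm_le; exact: ideal_sub.
by move=> Iab; apply/eqP; rewrite eq_le !H// -opprB; exact: ideal_opp.
Qed.

Lemma qnrmD a b : qnrm (a + b) <= qnrm a + qnrm b.
Proof.
apply/ler_addgt0Pr => e e0; have e2 : 0 < e / 2 by rewrite divr_gt0.
have [u Iu hu] := qnrm_adh a e2; have [v Iv hv] := qnrm_adh b e2.
have := qnrm_le (a + b) (ideal_add Iu Iv).
have := nrmD (a + u) (b + v); rewrite (_ : a + u + (b + v) = a + b + (u + v)); last by ring.
lra.
Qed.

Lemma qnrmN a : qnrm (- a) = qnrm a.
Proof.
have H b : qnrm (- b) <= qnrm b.
  apply/ler_addgt0Pr => e e0; have [u Iu /ltW h] := qnrm_adh b e0.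
  by apply: le_trans h; rewrite -nrmN opprD; apply: qnrm_le; exact: ideal_opp.
by apply/eqP; rewrite eq_le H -{1}(opprK a) H.
Qed.

Lemma qnrmB a b : qnrm (a - b) <= qnrm a + qnrm b.
Proof. by rewrite -(qnrmN b) qnrmD. Qed.

Lemma qnrmM a b : qnrm (a * b) <= qnrm a * qnrm b.
Proof.
have qa := qnrm_ge0 a; have qb := qnrm_ge0 b.
(* With [d <= 1], [(qnrm a + d) (qnrm b + d)] exceeds the product by at most
   [d (qnrm a + qnrm b + 1) <= e]. *)
apply/ler_addgt0Pr => e e0; pose d := Num.min 1 (e / (qnrm a + qnrm b + 1)).
have d0 : 0 < d by rewrite lt_min ltr01 divr_gt0//; lra.
have d1 : d <= 1 by rewrite ge_min lexx.
have de : d * (qnrm a + qnrm b + 1) <= e.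
  by rewrite -ler_pdivlMr ?ge_min ?lexx ?orbT//; lra.
have [u Iu hu] := qnrm_adh a d0; have [v Iv hv] := qnrm_adh b d0.
have -> : qnrm (a * b) = qnrm ((a + u) * (b + v)).
  apply: qnrm_ideal.
  rewrite (_ : _ - _ = (- b - v) * u - a * v); last by ring.
  by apply: ideal_sub; exact: ideal_mul.
apply: le_trans (qnrm_le_nrm _) _; apply: le_trans (nrmM _ _) _.
have nu := nrm_ge0 (a + u); have nv := nrm_ge0 (b + v).
nra.
Qed.

Lemma qnrmZ l a : qnrm (l *: a) <= nc l * qnrm a.
Proof.
apply/ler_addgt0Pr => e e0; have nl := nc_ge0 l.
pose d := e / (nc l + 1).
have d0 : 0 < d by rewrite divr_gt0//; lra.
have dE : (nc l + 1) * d = e by rewrite /d mulrC divfK//; lra.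
have [u Iu hu] := qnrm_adh a d0.
have := qnrm_le (l *: a) (ideal_mul l%:A Iu).
rewrite mulr_algl -scalerDr nrmZ; nra.
Qed.

(** An element of [I] at distance less than 1 from the unit would be invertible, hence put 1 in
    [I]. *)
Lemma qnrm1 : 1 <= qnrm 1.
Proof.
rewrite leNgt; apply/negP => q1.
have [u Iu hu] := qnrm_adh 1 (e := 1 - qnrm 1) ltac:(by rewrite subr_gt0).
have [|y] := neumann (x := - u); first by rewrite opprK; lra.
by move=> uy; apply: I1; rewrite -uy mulrC; apply: ideal_mul; exact: ideal_opp.
Qed.

Lemma inverse_uniq c a b : I (c * a - 1) -> I (c * b - 1) -> I (a - b).
Proof.
move=> ca cb; rewrite (_ : a - b = b * (c * a - 1) - a * (c * b - 1)); last by ring.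
by apply: ideal_sub; exact: ideal_mul.
Qed.

(** Such an [r] exists when [x] has empty spectrum in [A / I], which [no_resolvent] excludes. *)
Definition resolvent x (r : R[i] -> A) := forall l, I ((l%:A - x) * r l - 1).

Lemma algM l z : (l * z)%:A = l%:A * z%:A :> A.
Proof. by rewrite mulr_algl scalerA. Qed.

Lemma algN l : (- l)%:A = - l%:A :> A. Proof. by rewrite scaleNr. Qed.

Lemma sqrt_algE z : (sqrtc z)%:A * (sqrtc z)%:A = z%:A :> A.
Proof. by rewrite -algM -expr2 sqr_sqrtc. Qed.

(** For [w ^+ 2 = z], [z - x ^+ 2 = - (w - x) (- w - x)]. *)
Lemma resolvent_sqr x r : resolvent x r ->
  resolvent (x ^+ 2) (fun z => - (r (sqrtc z) * r (- sqrtc z))).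
Proof.
move=> xr z; have h1 := xr (sqrtc z); have h2 := xr (- sqrtc z).
rewrite -sqrt_algE; move: h1 h2; rewrite algN; set w := _%:A.
set r1 := r _; set r2 := r _ => h1 h2.
rewrite (_ : _ - 1 = ((w - x) * r1) * ((- w - x) * r2 - 1) + ((w - x) * r1 - 1)); last by ring.
exact: ID.
Qed.

(** The averaging identity modulo [I]. Inverses modulo [I] are unique, so it holds for any choice
    [r2] of the resolvent of [x ^+ 2]. *)
Lemma resolvent_half x r r2 w : resolvent x r -> resolvent (x ^+ 2) r2 ->
  I ((w ^+ 2)%:A * r2 (w ^+ 2)
     - 2^-1 *: (w%:A * r w + (- w)%:A * r (- w))).
Proof.
move=> xr /(_ (w ^+ 2)) h; have h1 := xr w; have h2 := xr (- w).
have {h}h : I (r2 (w ^+ 2) - - (r w * r (- w))).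
  apply: (inverse_uniq h); rewrite expr2 algM; move: h1 h2; rewrite algN.
  set W := w%:A; set r1 := r _; set r3 := r _ => h1 h2.
  rewrite (_ : _ - 1 = ((W - x) * r1) * ((- W - x) * r3 - 1) + ((W - x) * r1 - 1)); last by ring.
  exact: ID.
have -> : 2^-1 *: (w%:A * r w + (- w)%:A * r (- w))
        = (2^-1)%:A * (w%:A * r w + (- w)%:A * r (- w)) by rewrite [RHS]mulr_algl.
have half : (2^-1)%:A + (2^-1)%:A = 1 :> A.
  by rewrite -scalerDl (_ : 2^-1 + 2^-1 = 1) ?scale1r//; field.
move: h h1 h2; rewrite expr2 algM algN.
set W := w%:A; set r1 := r w; set r3 := r (- w); set s := r2 _; set k := (2^-1)%:A in half *.
move=> h h1 h2.
have -> : W * W * s - k * (W * r1 + - W * r3) = W * W * (s - - (r1 * r3)) +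
   (k * W * r1) * ((- W - x) * r3 - 1) - (k * W * r3) * ((W - x) * r1 - 1)
   - (1 - (k + k)) * (W * W * r1 * r3) by ring.
rewrite half subrr mul0r subr0.
by apply: ideal_sub; [apply: ideal_add|]; exact: ideal_mul.
Qed.

(** By [resolvent_half], the oscillation for [x ^+ 2] is the mean of those at [w] and [- w], so the
    bound [e] survives while the ratio [t] of the radii is squared. *)
Lemma resolvent_iter x (r : R[i] -> A) (t p e : R) : 
  resolvent x r -> 0 <= p ->
  (forall z, nc z = p -> qnrm (z%:A * r z - (t%:C%C * z)%:A * r (t%:C%C * z)) <= e) ->
  forall n, exists s, resolvent (x ^+ (2 ^ n)) s /\
   forall z, nc z = p ^+ (2 ^ n) ->
   qnrm (z%:A * s z - ((t ^+ (2 ^ n))%:C%C * z)%:A * s ((t ^+ (2 ^ n))%:C%C * z)) <= e.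
Proof.
move=> xr p0 H; elim=> [|n [s [xs Hs]]]; first by exists r.
pose s2 z := - (s (sqrtc z) * s (- sqrtc z)).
have xs2 : resolvent ((x ^+ (2 ^ n)) ^+ 2) s2 by exact: resolvent_sqr.
exists s2; rewrite expnSr !exprM; split=> // z nz.
set T := t ^+ (2 ^ n) in Hs *; set w := sqrtc z.
have wz : w ^+ 2 = z by rewrite sqr_sqrtc.
have nw : nc w = p ^+ (2 ^ n).
  apply/eqP; rewrite -(@eqrXn2 _ 2)//; last 2 first.
  - exact: nc_ge0.
  - exact: exprn_ge0.
  by rewrite -ncX wz nz.
have TzE : (T ^+ 2)%:C%C * z = (T%:C%C * w) ^+ 2 by rewrite exprMn wz rmorphXn.
rewrite TzE -wz.
have h1 := resolvent_half w xs xs2.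
have h2 := resolvent_half (T%:C%C * w) xs xs2.
have := Hs w nw; have := Hs (- w); rewrite ncN mulrN => /(_ nw).
move: h1 h2; set a1 := (w ^+ 2)%:A * _; set a2 := ((_ * w) ^+ 2)%:A * _.
set b1 := w%:A * _; set b2 := (- w)%:A * _; set b3 := (T%:C%C * w)%:A * _.
set b4 := (- (T%:C%C * w))%:A * _ => h1 h2 h3 h4.
have -> : qnrm (a1 - a2) = qnrm (2^-1 *: ((b1 - b3) + (b2 - b4))).
  apply: qnrm_ideal.
  rewrite (_ : _ - _ = (a1 - 2^-1 *: (b1 + b2)) - (a2 - 2^-1 *: (b3 + b4))); last first.
    rewrite [b1 - b3 + _](_ : _ = (b1 + b2) - (b3 + b4)); last by ring.
    by rewrite scalerBr; ring.
  exact: ideal_sub.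
apply: le_trans (qnrmZ _ _) _.
have -> : nc (2^-1 : R[i]) = 2^-1.
  by rewrite ncV (_ : 2 = 2%:C%C) ?ncR ?ger0_norm// rmorph_nat.
have := qnrmD (b1 - b3) (b2 - b4); lra.
Qed.

Lemma resolvent_sub x r l m : resolvent x r ->
  I (r l - r m - (m - l)%:A * r l * r m).
Proof.
move=> xr; have := xr l; have := xr m; rewrite scalerBl.
set L := l%:A; set M := m%:A; set rl := r l; set rm := r m => hm hl.
rewrite (_ : _ - _ = rm * ((L - x) * rl - 1) - rl * ((M - x) * rm - 1)); last by ring.
by apply: ideal_sub; exact: ideal_mul.
Qed.

Lemma resolvent_mul_sub x r l m : resolvent x r ->
  I (l%:A * r l - m%:A * r m - (m - l)%:A * x * r l * r m).
Proof.
move=> xr; have := xr l; have := xr m; rewrite scalerBl.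
set L := l%:A; set M := m%:A; set rl := r l; set rm := r m => hm hl.
rewrite (_ : _ - _ = (M * rm) * ((L - x) * rl - 1) - (L * rl) * ((M - x) * rm - 1)); last by ring.
by apply: ideal_sub; exact: ideal_mul.
Qed.

Lemma qnrm_algM l a : qnrm (l%:A * a) <= nc l * qnrm a.
Proof. by rewrite mulr_algl qnrmZ. Qed.

(** Otherwise an ultrafilter along which [qnrm (r l)] tends to infinity converges to some [l0]. Near
    [l0] the term [(l0 - l) r l r l0] of the resolvent identity is at most half of [qnrm (r l)],
    which is thus at most [2 qnrm (r l0)]. *)
Lemma resolvent_bounded x r (M : R) : resolvent x r ->
  exists2 K, 0 < K & forall l, nc l <= M -> qnrm (r l) <= K.
Proof.
move=> xr; apply: contrapT => nK.
have H K : exists l, nc l <= M /\ K < qnrm (r l).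
  apply: contrapT => nl; apply: nK; exists (Num.max 1 K); first by rewrite lt_max ltr01.
  move=> l lM; rewrite leNgt; apply/negP; rewrite gt_max => /andP[_ Kl].
  by apply: nl; exists l.
pose F := [set W : set R[i] | exists K : R, forall l, nc l <= M -> K < qnrm (r l) -> W l].
have FF : ProperFilter F.
  apply: Build_ProperFilter_ex.
    by move=> W [K HK]; have [l [lM Kl]] := H K; exists l; exact: HK.
  split=> [|U V [K1 H1] [K2 H2]|U V UV [K HK]].
  - by exists 0.
  - exists (Num.max K1 K2) => l lM; rewrite gt_max => /andP[h1 h2].
    by split; [exact: H1|exact: H2].
  - by exists K => l lM Kl; exact/UV/HK.
have [G [GU FG]] := ultraFilterLemma FF.
have [|l0 Hl0] := ultralimit (F := G) (f := id) (M := M).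
  by apply: FG; exists 0.
pose c := qnrm (r l0) + 1.
have q0 := qnrm_ge0 (r l0).
have c0 : 0 < c by rewrite /c; lra.
have d0 : 0 < (2 * c)^-1 by rewrite invr_gt0; lra.
have : G [set l | nc (l - l0) < (2 * c)^-1 /\ 2 * c < qnrm (r l)].
  by apply: filterI; [exact: Hl0|apply: FG; exists (2 * c)].
move=> /filter_ex[l [/= h1 h2]].
have := qnrmD (r l - r l0) (r l0); rewrite subrK.
rewrite (qnrm_ideal (resolvent_sub l l0 xr)) -mulrA.
have := qnrm_algM (l0 - l) (r l * r l0); rewrite ncBC.
have := qnrmM (r l) (r l0); have := nc_ge0 (l - l0).
have : (2 * c)^-1 * (2 * c) = 1 by rewrite mulVf//; lra.
move: (qnrm (_%:A * _)) (qnrm (r l * _)) h1 h2 => u v.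
rewrite -/c; move: (_^-1) (nc _) (qnrm (r l)) d0 => d n q d0; rewrite /c in c0 *.
move: (qnrm (r l0)) q0 c0 => q0' q0 c0 h1 h2 h3 h4 h5 h6 h7.
have h8 : n * (q * q0') <= d * (q * q0') by rewrite ler_wpM2r ?mulr_ge0//; lra.
have h9 : n * v <= n * (q * q0') by rewrite ler_wpM2l.
have h10 : d * (q * q0') <= d * (q * (q0' + 1)) by rewrite ler_wpM2l ?(ltW d0)// ler_wpM2l; lra.
have h11 : 2 * (d * (q * (q0' + 1))) = q.
  by transitivity (q * (d * (2 * (q0' + 1)))); [ring|rewrite h3 mulr1].
lra.
Qed.

Lemma qnrmX a n : qnrm (a ^+ n) <= qnrm a ^+ n * qnrm 1.
Proof.
elim: n => [|n ih]; first by rewrite !expr0 mul1r.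
by rewrite !exprS -mulrA (le_trans (qnrmM _ _))// ler_wpM2l ?qnrm_ge0.
Qed.

Lemma idealX a n : I (a - 1) -> I (a ^+ n - 1).
Proof.
move=> Ia; elim: n => [|n ih]; first by rewrite expr0 subrr.
by rewrite exprS (_ : _ - 1 = a * (a ^+ n - 1) + (a - 1)); [exact: ID|ring].
Qed.

(* Comparing [z (z - x^(2^n))^-1] at radii just below and just above the
   spectral radius [p] of [x] modulo [I]: it is close to 1 at the second radius,
   hence at the first one by equicontinuity, so that [x^(2^n)] is small compared
   to a radius below [p]. *)
Lemma no_resolvent x r : ~ resolvent x r.
Proof.
move=> xr; have q1 := qnrm1.
pose Y := qnrm (r 0).
have Y0 : 0 <= Y := qnrm_ge0 _.
have invx : I (x * (- r 0) - 1).
  by have := xr 0; rewrite scale0r sub0r mulNr mulrN.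
(* [- r 0] inverts [x] modulo [I]; this keeps the radius [p] away from 0. *)
have xY n : 1 <= qnrm (x ^+ n) * Y ^+ n.
  have := qnrm_ideal (idealX n invx); rewrite exprMn => h.
  have := qnrmM (x ^+ n) ((- r 0) ^+ n); rewrite h => {}h.
  have h2 := qnrmX (- r 0) n; rewrite qnrmN -/Y in h2.
  have : qnrm 1 * 1 <= qnrm 1 * (qnrm (x ^+ n) * Y ^+ n).
    rewrite mulr1; apply: le_trans h _.
    by rewrite mulrCA ler_wpM2l ?qnrm_ge0// mulrC.
  by rewrite ler_pM2l//; lra.
have Yp : 0 < Y.
  rewrite lt_def Y0 andbT; apply/eqP => Ye; have := xY 1%N.
  by rewrite !expr1 Ye mulr0; lra.
(* The infimum of [Z] is the spectral radius modulo [I], computed along the exponents [2 ^ n] that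
   repeated squaring reaches. *)
pose Z := [set z : R | 0 < z /\ exists n, qnrm (x ^+ (2 ^ n)) < z ^+ (2 ^ n)].
have Zn0 : Z !=set0.
  have qx := qnrm_ge0 x.
  by exists (qnrm x + 1); split; [lra|exists 0%N; rewrite expn0 !expr1; lra].
have ZY (z : R) : Z z -> Y^-1 <= z.
  move=> [z0 [n hn]]; rewrite leNgt; apply/negP => zY.
  have := xY (2 ^ n)%N; apply/negP; rewrite -ltNge.
  have : qnrm (x ^+ (2 ^ n)) * Y ^+ (2 ^ n) < (z * Y) ^+ (2 ^ n).
    by rewrite exprMn ltr_pM2r// exprn_gt0.
  move=> /lt_le_trans; apply; apply: exprn_ile1.
    by rewrite mulr_ge0// ltW.
  by rewrite -(mulVf (lt0r_neq0 Yp)) ler_wpM2r// ltW.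
have lbZ : has_lbound Z by exists Y^-1 => z; exact: ZY.
pose p := inf Z.
have p0 : 0 < p.
  by apply: lt_le_trans (lb_le_inf Zn0 _); last exact: ZY; rewrite invr_gt0.
have Zp (z : R) : Z z -> p <= z by move=> Zz; exact: ge_inf.
have Zup (z : R) : p < z -> Z z.
  move=> pz; have [||y [y0 [n hn]] yz] := inf_adherent (E := Z) (eps := z - p).
  - by rewrite subr_gt0.
  - by split.
  move: yz; rewrite -/p addrC subrK => yz.
  split; first exact: lt_trans yz.
  exists n; apply: (lt_le_trans hn).
  by rewrite lerXn2r ?nnegrE ?ltW// (lt_trans y0).
have [K K0 HK] := resolvent_bounded (2 * p) xr.
have qx := qnrm_ge0 x.
(* [d] is small enough for the oscillation between radii [p'] and [t * p'] to be at most 1/8, and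
   [(1 + d) (1 - d / 2) > 1] places [p] strictly between these radii. *)
pose d := Num.min 2^-1 (8 * p * (qnrm x + 1) * K ^+ 2)^-1.
have den0 : 0 < 8 * p * (qnrm x + 1) * K ^+ 2.
  by rewrite !mulr_gt0 ?exprn_gt0//; lra.
have d0 : 0 < d by rewrite lt_min !invr_gt0 den0 ltr0n.
have d2 : d <= 2^-1 by rewrite ge_min lexx.
have dd : d * (8 * p * (qnrm x + 1) * K ^+ 2) <= 1.
  by rewrite -ler_pdivlMr// mul1r ge_min lexx orbT.
pose t := 1 + d; pose p' := p * (1 - d / 2).
have p'0 : 0 < p' by rewrite mulr_gt0//; lra.
have p'p : p' < p by rewrite /p' gtr_pMr//; lra.
have tp' : p < t * p'.
  rewrite /t /p' mulrCA ltr_pMr//; nra.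
have equi z : nc z = p' ->
    qnrm (z%:A * r z - (t%:C%C * z)%:A * r (t%:C%C * z)) <= 8^-1.
  move=> nz; rewrite (qnrm_ideal (resolvent_mul_sub z (t%:C%C * z) xr)).
  have -> : t%:C%C * z - z = d%:C%C * z by rewrite /t rmorphD rmorph1; ring.
  have nd : nc (d%:C%C * z) = d * p' by rewrite ncM ncR nz gtr0_norm.
  have nt : nc (t%:C%C * z) = t * p' by rewrite ncM ncR nz gtr0_norm// /t; lra.
  have h1 : qnrm (r z) <= K by apply: HK; rewrite nz; lra.
  have h2 : qnrm (r (t%:C%C * z)) <= K.
    apply: HK; rewrite nt /t; nra.
  rewrite -!mulrA; apply: le_trans (qnrm_algM _ _) _; rewrite nd.
  have h3 : qnrm (x * (r z * r (t%:C%C * z))) <= qnrm x * (K * K).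
    apply: le_trans (qnrmM _ _) _; rewrite ler_wpM2l//.
    by apply: le_trans (qnrmM _ _) _; rewrite ler_pM ?qnrm_ge0.
  have h4 : d * p' * qnrm (x * (r z * r (t%:C%C * z))) <= d * p * (qnrm x * (K * K)).
    have dp' : 0 <= d * p' by exact: mulr_ge0 (ltW d0) (ltW p'0).
    apply: ler_pM => //; first exact: qnrm_ge0.
    by rewrite ler_wpM2l ?(ltW d0)// (ltW p'p).
  apply: le_trans h4 _.
  have h5 : 0 <= d * p * (K * K) by rewrite !mulr_ge0 ?ltW.
  have : 8 * (d * p * (qnrm x * (K * K))) + 8 * (d * p * (K * K)) <= 1.
    by apply: le_trans dd; rewrite le_eqVlt; apply/orP; left; apply/eqP; ring.
  lra.
have [_ [n hn]] := Zup _ tp'.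
have tp0 : 0 < t * p' by exact: lt_trans tp'.
pose rho := qnrm (x ^+ (2 ^ n)) / (t * p') ^+ (2 ^ n).
have rho0 : 0 <= rho by rewrite divr_ge0 ?qnrm_ge0 ?exprn_ge0 ?ltW.
have rho1 : rho < 1 by rewrite ltr_pdivrMr ?mul1r ?exprn_gt0.
(* [j] more squarings turn the ratio [rho < 1] into one that is small compared with [qnrm 1]. *)
have [j hj] : exists j, rho ^+ j < (16 * qnrm 1 * qnrm 1)^-1.
  by apply: small_pow => //; rewrite invr_gt0 !mulr_gt0//; lra.
pose k := (n + j)%N.
have qX : qnrm (x ^+ (2 ^ k)) <= (16 * qnrm 1)^-1 * (t * p') ^+ (2 ^ k).
  rewrite /k expnD !exprM; apply: le_trans (qnrmX _ _) _.
  have -> : qnrm (x ^+ (2 ^ n)) = rho * (t * p') ^+ (2 ^ n).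
    by rewrite /rho divfK// expf_neq0// gt_eqF.
  rewrite exprMn mulrAC; apply: ler_wpM2r.
    by apply: exprn_ge0; apply: exprn_ge0; exact: ltW.
  rewrite -ler_pdivlMr; last by lra.
  rewrite -invfM; apply: ltW; apply: le_lt_trans hj.
  by apply: ler_wiXn2l => //; [exact: ltW|exact/ltnW/ltn_expl].
have [s [xs Hs]] := resolvent_iter xr (ltW p'0) equi k.
set X := x ^+ (2 ^ k) in qX xs; pose P := p' ^+ (2 ^ k); pose T := t ^+ (2 ^ k).
have P0 : 0 < P by rewrite exprn_gt0.
have T0 : 0 < T by rewrite exprn_gt0// /t; lra.
have nP : nc P%:C%C = P by rewrite ncR gtr0_norm.
have := Hs _ nP; rewrite -/T -rmorphM /=; set tp := T * P.
have tpE : (t * p') ^+ (2 ^ k) = tp by rewrite exprMn.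
have tpP : 0 < tp by rewrite mulr_gt0.
set Psi := P%:C%C%:A * _; set Phi := tp%:C%C%:A * _ => PP.
pose W := (tp%:C%C)^-1 *: X; pose V := (P%:C%C)^-1 *: X.
have C0 u : 0 < u -> u%:C%C != 0 :> R[i].
  by move=> u0; rewrite -nc_gt0 ncR normr_gt0 gt_eqF.
have inv u : 0 < u -> I (u%:C%C%:A * s u%:C%C - 1 -
    ((u%:C%C)^-1 *: X) * (u%:C%C%:A * s u%:C%C)).
  move=> u0; have := xs u%:C%C.
  have -> // : (u%:C%C%:A - X) * s u%:C%C - 1 = u%:C%C%:A * s u%:C%C - 1 -
      (u%:C%C)^-1 *: X * (u%:C%C%:A * s u%:C%C).
  have -> : (u%:C%C)^-1 *: X * (u%:C%C%:A * s u%:C%C) = X * s u%:C%C.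
    rewrite mulr_algl -scalerAl -scalerAr scalerA mulVf ?scale1r//; exact: C0.
  by ring.
have qW : qnrm W <= (16 * qnrm 1)^-1.
  apply: le_trans (qnrmZ _ _) _; rewrite ncV ncR gtr0_norm//.
  by rewrite mulrC ler_pdivrMr// -tpE.
(* Modulo [I], [Phi - 1 = W Phi = W (Phi - 1) + W], where [W] contributes at most 1/16. *)
have qPhi : qnrm (Phi - 1) <= 15^-1.
  have := qnrm_ideal (inv _ tpP); rewrite -/W -/Phi => h.
  have := qnrmM W Phi; rewrite -h.
  have := qnrmD (Phi - 1) 1; rewrite subrK.
  have h1 := qnrm_ge0 (Phi - 1); have h2 := qnrm_ge0 Phi.
  have h3 : qnrm W * qnrm Phi <= (16 * qnrm 1)^-1 * qnrm Phi by rewrite ler_wpM2r.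
  have [iq iqE] : {iq | iq = (16 * qnrm 1)^-1} by eexists.
  rewrite -iqE in h3.
  have iq0 : 0 < iq by rewrite iqE invr_gt0; lra.
  have iqc : iq * (16 * qnrm 1) = 1 by rewrite iqE mulVf//; lra.
  move=> h4 h5.
  have i1 : 0 <= iq * (qnrm 1 - 1) by apply: mulr_ge0; lra.
  have i2 : iq * qnrm Phi <= iq * (qnrm (Phi - 1) + qnrm 1) by apply: ler_wpM2l; lra.
  have i3 : 0 <= (16^-1 - iq) * qnrm (Phi - 1) by apply: mulr_ge0; lra.
  lra.
have qD : qnrm (Psi - 1) <= 4^-1.
  have := qnrmD (Psi - Phi) (Phi - 1); rewrite addrA subrK; lra.
(* Modulo [I], [V = (Psi - 1) - V (Psi - 1)], so [qnrm V <= (1 + qnrm V) / 4]. Then [qnrm X < P]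
   puts [p'] in [Z] although [p' < p]. *)
have qV : qnrm V <= 3^-1.
  have /qnrm_ideal : I (V - ((Psi - 1) - V * (Psi - 1))).
    have -> : V - ((Psi - 1) - V * (Psi - 1)) = - (Psi - 1 - V * Psi) by ring.
    exact: ideal_opp (inv _ P0).
  have := qnrmB (Psi - 1) (V * (Psi - 1)); have := qnrmM V (Psi - 1).
  have := qnrm_ge0 V; have := qnrm_ge0 (Psi - 1); nra.
have : p <= p'.
  apply: Zp; split=> //; exists k; rewrite -/X -/P.
  have -> : X = P%:C%C *: V by rewrite scalerA divff ?scale1r//; exact: C0.
  by apply: le_lt_trans (qnrmZ _ _) _; rewrite nP gtr_pMr//; lra.
by lra.
Qed.
End GelfandMazur.

(** * Characters and the spectral radius *)

Section Character.
Variables (R : realType) (A : comBanachAlgType R[i]).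
Implicit Types (x y : A) (m : max_ideal_space A) (l : R[i]).

Definition ev m x : R[i] := gelfand x m.
Lemma evD m x y : ev m (x + y) = ev m x + ev m y.
Proof. exact: (raddfD (m : {lrmorphism A -> R[i]^o})). Qed.
Lemma evN m x : ev m (- x) = - ev m x.
Proof. exact: (raddfN (m : {lrmorphism A -> R[i]^o})). Qed.
Lemma evM m x y : ev m (x * y) = ev m x * ev m y.
Proof. exact: (rmorphM (m : {lrmorphism A -> R[i]^o})). Qed.
Lemma evZ m l x : ev m (l *: x) = l * ev m x.
Proof. exact: (linearZZ (m : {lrmorphism A -> R[i]^o})). Qed.
Lemma ev1 m : ev m 1 = 1.
Proof. exact: (rmorph1 (m : {lrmorphism A -> R[i]^o})). Qed.
Lemma ev0 m : ev m 0 = 0.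
Proof. exact: (raddf0 (m : {lrmorphism A -> R[i]^o})). Qed.
Lemma evB m x y : ev m (x - y) = ev m x - ev m y.
Proof. by rewrite evD evN. Qed.
Lemma evC m l : ev m (l%:A) = l.
Proof. by rewrite evZ ev1 mulr1. Qed.
Lemma evX m x n : ev m (x ^+ n) = ev m x ^+ n.
Proof. by elim: n => [|n ih]; rewrite ?expr0 ?ev1// !exprS evM ih. Qed.

Lemma character_ext m m' :
  (forall f, ev m f = ev m' f) -> m = m'.
Proof.
case: m => f fc; case: m' => g gc h.
have fg : f = g by apply/funext => x; exact: h.
case: _ / fg gc h => gc _; congr GRing.LRMorphism.Pack.
case: fc gc => [[f1] [f2] [f3]] [[g1] [g2] [g3]].
by rewrite (Prop_irrelevance f1 g1) (Prop_irrelevance f2 g2) (Prop_irrelevance f3 g3).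
Qed.

Lemma make_character (f : A -> R[i]) :
  (forall l x y, f (l *: x + y) = l * f x + f y) ->
  (forall x y, f (x * y) = f x * f y) -> f 1 = 1 ->
  exists m, forall x, ev m x = f x.
Proof.
move=> lin mul f1; pose g : A -> R[i]^o := f.
have glin : linear g by move=> l x y; exact: lin.
have gmul : monoid_morphism g by split.
pose M : {lrmorphism A -> R[i]^o} := HB.pack g
  (GRing.isLinear.Build R[i] A R[i]^o *:%R g glin)
  (GRing.isMonoidMorphism.Build A R[i]^o g gmul).
by exists M.
Qed.

Definition is_ideal (I : set A) :=
  [/\ I 0, ~ I 1 & forall a u v, I u -> I v -> I (a * u + v)].

(** Maximality stated as [A / I] being a field, which is what the construction of a resolvent
    uses. *)
Definition is_maximal (I : set A) :=
  is_ideal I /\ forall z, ~ I z -> exists y, I (z * y - 1).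

(** If the ideal generated by [I] and [z] is not proper, it contains [1 = a z + u]. This serves both
    for Zorn's lemma and for [maximal_ideal]. *)
Lemma ideal_extend (I : set A) z : is_ideal I ->
  ~ is_ideal [set w | exists a u, I u /\ w = a * z + u] -> exists y, I (z * y - 1).
Proof.
move=> [I0 I1 ID]; set J := mkset _ => nJ; apply: contrapT => nz; apply: nJ; split.
- by exists 0, 0; split=> //; ring.
- move=> [a [u [Iu e]]]; apply: nz; exists a.
  by rewrite (_ : z * a - 1 = (-1) * u + 0); [exact: ID|rewrite [X in _ - X = _]e; ring].
- move=> a _ _ [b [u [Iu ->]]] [c [v [Iv ->]]].
  by exists (a * b + c), (a * u + v); split; [exact: ID|ring].
Qed.

Lemma exists_maximal x : (forall y, x * y <> 1) -> exists2 I, is_maximal I & I x.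
Proof.
move=> nx; pose P (J : set A) := J = set0 \/ is_ideal J /\ J x.
have [|I [PI Imax]] := @Zorn_bigcup _ P.
  move=> F FP Ftot.
  have [[J [FJ J0]]|nJ] := pselect (exists J, F J /\ J !=set0); last first.
    left; rewrite -subset0 => u [J FJ Ju]; apply: nJ; exists J; split=> //.
    by exists u.
  right.
  have PF K u : F K -> K u -> is_ideal K /\ K x.
    by move=> FK Ku; case: (FP _ FK) => // K0; rewrite K0 in Ku.
  case: J0 => j Jj; have [[J0 J1 JD] Jx] := PF _ _ FJ Jj.
  split; last by exists J.
  split; first by exists J.
    by move=> [K FK K1]; have [[_ /(_ K1)]] := PF _ _ FK K1.
  move=> a u v [K FK Ku] [L FL Lv].
  have [KL|LK] := Ftot _ _ FK FL.
    exists L => //; have [[_ _ LD] _] := PF _ _ FL Lv; apply: LD => //; exact: KL.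
  exists K => //; have [[_ _ KD] _] := PF _ _ FK Ku; apply: KD => //; exact: LK.
have P0 : P (range (fun y => x * y)).
  right; split; last by exists 1; rewrite ?mulr1.
  split; first by exists 0; rewrite ?mulr0.
    by move=> [y _ /nx].
  by move=> a _ _ [b _ <-] [c _ <-]; exists (a * b + c) => //; ring.
have [PI' Ix] : is_ideal I /\ I x.
  case: PI => // I0; exfalso; apply: (Imax (range (fun y => x * y))) P0.
  rewrite I0; split; first exact: sub0set.
  by move=> /(_ (x * 0)); apply; exists 0.
exists I => //; split=> // z nz; apply: ideal_extend => //.
set J := mkset _ => pJ.
have IJ : I `<=` J by move=> u Iu; exists 0, u; split=> //; ring.
apply: (Imax J); last by right; split=> //; exact: IJ.
split=> // JI; apply: nz; apply: JI; exists 1, 0; split; last by ring.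
by case: PI'.
Qed.

(** Gelfand-Mazur: were [x] congruent to no scalar, all [l - x] would be invertible modulo [I],
    giving a resolvent. The character sends [x] to that scalar. *)
Lemma maximal_character I : is_maximal I -> exists m, forall x, ev m x = 0 <-> I x.
Proof.
move=> [[I0 I1 ID] Imax].
have Isub u v : I u -> I v -> I (u - v) by exact: ideal_sub.
have Imul a u : I u -> I (a * u) by exact: ideal_mul.
have ex x : exists l, I (x - l%:A).
  apply: contrapT => nl.
  have /choice[r rP] l : exists y, I ((l%:A - x) * y - 1).
    apply: Imax => h; apply: nl; exists l.
    by rewrite -opprB -(sub0r (_ - _)); exact: Isub.
  exact: (no_resolvent I0 I1 ID rP).
have /choice[f fP] := ex.
have uniq x l : I (x - l%:A) -> f x = l.
  move=> h; apply/eqP; rewrite -subr_eq0; apply/negPn/negP => n0; apply: I1.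
  have := Isub _ _ h (fP x).
  have -> : x - l%:A - (x - (f x)%:A) = (f x - l)%:A by rewrite scalerBl; ring.
  by move=> /(Imul (f x - l)^-1%:A); rewrite mulr_algl scalerA mulVf ?scale1r.
have [|x y||m Hm] := make_character (f := f).
- move=> l x y; apply: uniq.
  rewrite (_ : _ - _ = l%:A * (x - (f x)%:A) + (y - (f y)%:A)); first exact: ID.
  by rewrite scalerDl algM -[l *: x]mulr_algl; ring.
- apply: uniq.
  rewrite (_ : _ - _ = y * (x - (f x)%:A) + (f x)%:A * (y - (f y)%:A)).
    by apply: ID => //; exact: Imul.
  by rewrite algM; ring.
- by apply: uniq; rewrite scale1r subrr.
exists m => x; rewrite Hm; split=> [fx|Ix].
  by have := fP x; rewrite fx scale0r subr0.
by apply: uniq; rewrite scale0r subr0.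
Qed.

Lemma character_invertible x : (forall m, ev m x <> 0) -> exists y, x * y = 1.
Proof.
move=> h; apply: contrapT => nx.
have [y xy|I Imax Ix] := @exists_maximal x; first by apply: nx; exists y.
by have [m Hm] := maximal_character Imax; apply: (h m); exact/Hm.
Qed.

Lemma exists_character : exists m : max_ideal_space A, True.
Proof.
apply: contrapT => nm; have [m|y] := @character_invertible 0.
  by move=> _; apply: nm; exists m.
by rewrite mul0r => /esym/eqP; rewrite oner_eq0.
Qed.

Lemma ker_maximal m : is_maximal [set x | ev m x = 0].
Proof.
split.
  split=> /=; [exact: ev0|by rewrite ev1; apply/eqP; rewrite oner_eq0|].
  by move=> a u v; rewrite evD evM => -> ->; rewrite mulr0 addr0.
move=> z /eqP z0; exists ((ev m z)^-1%:A).
by rewrite /= evB evM evC ev1 mulfV// subrr.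
Qed.

(** Kernels of characters are maximal ideals, and by [maximal_character] every maximal ideal is
    one. *)
Lemma radicalP x : radical x <-> forall m, ev m x = 0.
Proof.
split=> [xr m|h I [[I0 I1 ID] Imax]].
  have [[K0 K1 KD] Kmax] := ker_maximal m.
  have := xr [pred y | ev m y == 0]; rewrite inE => H; apply/eqP/H; split.
    split; rewrite ?inE ?ev0 ?eqxx// ?ev1 ?oner_eq0// => a u v.
    by rewrite !inE => /eqP u0 /eqP v0; apply/eqP; exact: KD.
  move=> J [J0 J1 JD] KJ z zJ; rewrite inE; apply/eqP; apply: contrapT => /Kmax[y /= hy].
  move/negP: J1; apply.
  have wJ : - (z * y - 1) \in J by apply: KJ; rewrite inE evN hy oppr0.
  by have := JD y z _ zJ wJ; rewrite (_ : y * z + _ = 1); last by ring.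
have pI : is_ideal [set z | z \in I].
  by split=> /=; [done|exact/negP|move=> a u v; exact: ID].
have [|m Hm] := @maximal_character [set z | z \in I]; last by apply/Hm/h.
split=> // z zI; apply: ideal_extend => // -[J0 J1 JD]; apply: zI => /=.
pose J := [pred w | `[< exists a u, u \in I /\ w = a * z + u >]].
have JP w : reflect (exists a u, u \in I /\ w = a * z + u) (w \in J) := asboolP _.
apply: (Imax J); last first.
- by apply/JP; exists 1, 0; split=> //; ring.
- by move=> u Iu; apply/JP; exists 0, u; split=> //; ring.
split; [exact/JP|by apply/negP => /JP|].
by move=> a u v /JP Ju /JP Jv; apply/JP; exact: JD.
Qed.

(** If [l = ev m x] were larger than the norm, [1 - l^-1 *: x] would be invertible by [neumann], yet
    it is sent to 0 by [m]. *)
Lemma nc_ev_le m x : nc (ev m x) <= nrm x.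
Proof.
rewrite leNgt; apply/negP => xl; set l := ev m x in xl.
have l0 : 0 < nc l by apply: le_lt_trans xl; exact: nrm_ge0.
have ln0 : l != 0 by rewrite -nc_gt0.
have [|y] := neumann (x := 1 - l^-1 *: x).
  by rewrite subKr nrmZ ncV mulrC ltr_pdivrMr ?mul1r.
move=> /(congr1 (ev m)); rewrite evM evB evZ ev1 -/l mulVf// subrr mul0r => /esym/eqP.
by rewrite oner_eq0.
Qed.

Lemma spectrumP x l : spectrum x l <-> exists m, ev m x = l.
Proof.
split=> [h|[m <-] [y /(congr1 (ev m))]]; last first.
  by rewrite evM evB evC subrr mul0r ev1 => /esym/eqP; rewrite oner_eq0.
apply: contrapT => nm; apply: h; apply: character_invertible => m.
by rewrite evB evC => /subr0_eq e; apply: nm; exists m.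
Qed.

Local Notation r := (@spectral_radius R A).

Let spE x : [set complex.Re `|l| | l in spectrum x] = [set nc (ev m x) | m in setT].
Proof.
apply/seteqP; split=> [_ [l /spectrumP[m <-] <-]|_ [m _ <-]].
  by exists m => //; rewrite norm_ncE.
by exists (ev m x); [apply/spectrumP; exists m|rewrite norm_ncE].
Qed.

Lemma ev_le_radius m x : nc (ev m x) <= r x.
Proof.
rewrite /spectral_radius spE; apply: ub_le_sup; last by exists m.
by exists (nrm x) => _ [m' _ <-]; exact: nc_ev_le.
Qed.

Lemma radius_le x (c : R) : (forall m, nc (ev m x) <= c) -> r x <= c.
Proof.
move=> h; rewrite /spectral_radius spE; have [m _] := exists_character.
by apply: ge_sup => [|_ [m' _ <-]//]; exists (nc (ev m x)), m.
Qed.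

Lemma radius_ge0 x : 0 <= r x.
Proof.
by have [m _] := exists_character; apply: le_trans (ev_le_radius m x); exact: nc_ge0.
Qed.

Definition approx_closed (F : set (max_ideal_space A)) :=
  forall p, (forall (s : seq A) (e : R), 0 < e ->
    exists2 m, F m & {in s, forall f, nc (ev m f - ev p f) < e}) -> F p.

(* Compactness of the maximal ideal space, for the topology of pointwise
   convergence spelled out by [approx_closed]. *)
Lemma character_fip (I : eqType) (F : I -> set (max_ideal_space A)) :
  (forall i, approx_closed (F i)) ->
  (forall s : seq I, exists m, {in s, forall i, F i m}) ->
  exists m, forall i, F i m.
Proof.
move=> Fcl fip.
pose G := [set W : set (max_ideal_space A) |
  exists s : seq I, forall m, {in s, forall i, F i m} -> W m].
have GF : ProperFilter G.
  apply: Build_ProperFilter_ex.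
    by move=> W [s sW]; have [m /sW] := fip s; exists m.
  split; first by exists [::].
    move=> U V [s sU] [t tV]; exists (s ++ t) => m h; split.
      by apply: sU => i si; apply: h; rewrite mem_cat si.
    by apply: tV => i ti; apply: h; rewrite mem_cat ti orbT.
  by move=> U V UV [s sU]; exists s => m /sU; exact: UV.
have [H [HU GH]] := ultraFilterLemma GF.
(* The ultralimit of characters, element by element; the bound by [nrm x] makes it exist, and it is
   again linear and multiplicative. *)
have /choice[p Hp] x : exists l, forall e, 0 < e -> H [set m | nc (ev m x - l) < e].
  apply: (@ultralimit _ _ H _ (fun m => ev m x) (nrm x)).
  by apply: filterS filterT => m _ /=; exact: nc_ev_le.
have lim_uniq x l : (forall e, 0 < e -> H [set m | nc (ev m x - l) < e]) -> p x = l.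
  move=> h; apply/eqP; rewrite -subr_eq0 -nc_eq0 eq_le nc_ge0 andbT leNgt.
  apply/negP => d0; have d2 : 0 < nc (p x - l) / 2 by rewrite divr_gt0.
  have [m [/= h1 h2]] := filter_ex (filterI (Hp x _ d2) (h _ d2)).
  have := ncB (ev m x - l) (ev m x - p x).
  rewrite (_ : _ - _ = p x - l); [lra|ring].
have [|x y||q Hq] := make_character (f := p).
- move=> l x y; apply: lim_uniq => e e0.
  have d0 : 0 < e / 2 / (nc l + 1) by rewrite !divr_gt0// ltr_wpDl ?nc_ge0.
  have e2 : 0 < e / 2 by rewrite divr_gt0.
  apply: filterS (filterI (Hp x _ d0) (Hp y _ e2)) => m [/= h1 h2].
  rewrite evD evZ (_ : _ - _ = l * (ev m x - p x) + (ev m y - p y)); last by ring.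
  apply: le_lt_trans (ncD _ _) _; rewrite ncM.
  have : nc l * nc (ev m x - p x) <= (nc l + 1) * (e / 2 / (nc l + 1)).
    by rewrite ler_pM ?nc_ge0 ?lerDl// ltW.
  rewrite mulrCA divff ?mulr1; first lra.
  by rewrite gt_eqF// ltr_wpDl ?nc_ge0.
- apply: lim_uniq => e e0.
  pose c := nc (p x) + nrm y + 1.
  have c0 : 0 < c by have := nc_ge0 (p x); have := nrm_ge0 y; rewrite /c; lra.
  have d0 : 0 < e / c by rewrite divr_gt0.
  apply: filterS (filterI (Hp x _ d0) (Hp y _ d0)) => m [/= h1 h2].
  rewrite evM (_ : _ - _ = (ev m x - p x) * ev m y + p x * (ev m y - p y)); last by ring.
  apply: le_lt_trans (ncD _ _) _; rewrite !ncM.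
  have : nc (ev m x - p x) * nc (ev m y) <= (e / c) * nrm y.
    by rewrite ler_pM ?nc_ge0 ?nc_ev_le// ltW.
  have : nc (p x) * nc (ev m y - p y) <= nc (p x) * (e / c) by rewrite ler_wpM2l ?nc_ge0// ltW.
  have : (e / c) * c = e by rewrite divfK// gt_eqF.
  rewrite /c; move: (e / _) d0 => d d0; lra.
- apply: lim_uniq => e e0; apply: filterS filterT => m _ /=.
  by rewrite ev1 subrr Normc.normc0.
exists q => i; apply: Fcl => s e e0.
have : H [set m | F i m /\ {in s, forall f, nc (ev m f - ev q f) < e}].
  apply: filterI; first by apply: GH; exists [:: i] => m; apply; rewrite mem_head.
  elim: s => [|f s ih]; first by apply: filterS filterT => m _ f.
  apply: filterS (filterI (Hp f _ e0) ih) => m [/= h1 h2] g.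
  by rewrite inE => /predU1P[->|/h2//]; rewrite Hq.
by move=> /filter_ex[m [? ?]]; exists m.
Qed.

Lemma approx_closed_ge f (c : R) : approx_closed [set m | c <= nc (ev m f)].
Proof.
move=> p h /=; apply/ler_addgt0Pr => e e0; have [m /= cm] := h [:: f] e e0.
move=> /(_ f (mem_head _ _)) /ltW me; have := nc_tri (ev m f) (ev p f); lra.
Qed.

Lemma approx_closed_le f (c : R) : approx_closed [set m | nc (ev m f) <= c].
Proof.
move=> p h /=; apply/ler_addgt0Pr => e e0; have [m /= cm] := h [:: f] e e0.
move=> /(_ f (mem_head _ _)); rewrite ncBC => /ltW me.
have := nc_tri (ev p f) (ev m f); lra.
Qed.

Lemma radius_attained x : exists m, nc (ev m x) = r x.
Proof.
have [|s|m Hm] := @character_fip {e : R | 0 < e}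
    (fun i => [set m | r x - sval i <= nc (ev m x)]).
- by move=> i; exact: approx_closed_ge.
- have [e e0 se] : exists2 e, 0 < e & {in s, forall i : {e : R | 0 < e}, e <= sval i}.
    elim: s => [|i s [e e0 se]]; first by exists 1.
    exists (Num.min (sval i) e); first by rewrite lt_min (svalP i).
    move=> j; rewrite inE => /predU1P[->|/se je]; first by rewrite ge_min lexx.
    by rewrite ge_min je orbT.
  apply: contrapT => nm.
  have : r x <= r x - e.
    apply: radius_le => m; rewrite leNgt; apply/negP => h; apply: nm; exists m => i /se ie /=.
    by apply: ltW; apply: le_lt_trans h; rewrite lerD2l lerN2.
  by rewrite lerBrDl gerDr leNgt e0.
exists m; apply/eqP; rewrite eq_le ev_le_radius; apply/ler_addgt0Pr => e e0.
by have /= := Hm (exist _ e e0); rewrite lerBlDr.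
Qed.

End Character.

Lemma continuous_ncP (R : realType) (X : topologicalType) (F : X -> R[i]^o) :
  continuous F <-> forall x (e : R), 0 < e -> \forall y \near x, nc (F y - F x) < e.
Proof.
split=> [Fc x e e0|h x].
  have e1 : 0 < e%:C%C :> R[i] by rewrite ltcR.
  have /cvgrPdist_lt/(_ _ e1) := Fc x; apply: filterS => y /=.
  by rewrite distrC norm_ncE ltcR.
apply/cvgrPdist_lt => e e0.
have eE : e = (complex.Re e)%:C%C by rewrite RRe_real// gtr0_real.
have e1 : 0 < complex.Re e by move: e0; rewrite eE ltcR.
by apply: filterS (h x _ e1) => y; rewrite distrC norm_ncE eE ltcR.
Qed.

(** * The Gelfand topology and uniform approximation by elements of [A] *)

Section CharacterTopology.
Variables (R : realType) (A : comBanachAlgType R[i]).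
Local Notation C := (R[i]^o).
Local Notation M := (max_ideal_space A).

Lemma ev_continuous (f : A) : continuous (fun m : M => ev m f : C).
Proof.
have h : continuous ((fun (m : M) (x : A) => gelfand x m) : M -> {ptws A -> C}).
  exact: initial_continuous.
have := proj_continuous (K := fun _ : A => C) (i := f) => h2 m.
exact: (continuous_comp (h m) (h2 _)).
Qed.

Lemma continuous_characters (X : topologicalType) (g : X -> M) :
  (forall f : A, continuous (fun x => ev (g x) f : C)) -> continuous g.
Proof.
move=> h; apply: (@continuous_comp_initial _ X {ptws A -> C} (fun (m : M) (x : A) => gelfand x m) g).
by move=> x; apply/pointwise_cvgP => f; exact: h.
Qed.

Lemma continuous_subcharacters (X : topologicalType) (D : set M) (g : X -> set_type D) :
  (forall f : A, continuous (fun x => ev (\val (g x)) f : C)) -> continuous g.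
Proof.
move=> h; apply: (@continuous_comp_initial _ X M (@set_val M D) g).
by apply: continuous_characters.
Qed.

Lemma ev_val_continuous (D : set M) (f : A) :
  continuous (fun y : set_type D => ev (\val y) f : C).
Proof.
have h : continuous (@set_val M D : set_type D -> M) by exact: initial_continuous.
by move=> y; exact: (continuous_comp (h y) (@ev_continuous f _)).
Qed.

Lemma gelfand_cl (f : A) : cl A (gelfand f).
Proof. by split; [apply: subset_closure; exists f|exact: ev_continuous]. Qed.

Lemma cl_approx F e : cl A F -> 0 < e -> exists f, forall m, nc (F m - ev m f) < e.
Proof.
move=> [Fcl _] e0.
have [|G [[f _ <-] /= h]] := Fcl [set G : {uniform M -> C} | forall m, ball (F m) e%:C%C (G m)].
  apply/uniform_nbhs; exists [set xy | ball xy.1 e%:C%C xy.2]; split=> /=.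
    by rewrite -entourage_ballE; exists e%:C%C => //=; rewrite ltcR.
  by move=> G h m; exact: h.
exists f => m; have := h m; rewrite -ball_normE /ball_ /=.
by rewrite norm_ncE ltcR.
Qed.

End CharacterTopology.

(** * The Choquet boundary *)

Section HahnBanach.
Variables (R : realType) (V : lmodType R) (D : set V).
Hypotheses (D0 : D 0) (DD : forall x y, D x -> D y -> D (x + y)).
Hypothesis DZ : forall t x, D x -> D (t *: x).
Implicit Types (p : V -> R) (x y v : V).

Definition sublinear p :=
  (forall x y, D x -> D y -> p (x + y) <= p x + p y) /\
  (forall t x, 0 <= t -> D x -> p (t *: x) <= t * p x).

Lemma sublinear0 p : sublinear p -> p 0 = 0.
Proof.
move=> [pD pZ]; apply/eqP; rewrite eq_le; apply/andP; split.
  by have := pZ 0 0 (lexx _) D0; rewrite scale0r mul0r.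
by have := pD 0 0 D0 D0; rewrite addr0; lra.
Qed.

Lemma subspaceN x : D x -> D (- x). Proof. by rewrite -scaleN1r; exact: DZ. Qed.

Lemma sublinear_ge p x : sublinear p -> D x -> - p (- x) <= p x.
Proof.
move=> sp Dx; have [pD _] := sp; have := pD _ _ Dx (subspaceN Dx).
by rewrite subrr (sublinear0 sp); lra.
Qed.

(** A sublinear minorant of [p] that is tight in the direction [v]: its value at [- v] is at most
    [- p v]. *)
Definition shift p v x := inf [set p (x + t *: v) - t * p v | t in [set t : R | 0 <= t]].

Section Shift.
Variables (p : V -> R) (v : V).
Hypotheses (sp : sublinear p) (Dv : D v).

Let lb x : D x -> has_lbound [set p (x + t *: v) - t * p v | t in [set t : R | 0 <= t]].
Proof.
move=> Dx; exists (- p (- x)) => _ [t t0 <-]; have [pD pZ] := sp.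
have := pD _ _ (DD Dx (DZ t Dv)) (subspaceN Dx); rewrite addrAC subrr add0r.
have [->|tn0] := eqVneq t 0.
  rewrite scale0r addr0 mul0r subr0 (sublinear0 sp); lra.
have ti : 0 <= t^-1 by rewrite invr_ge0.
have := pZ t^-1 _ ti (DZ t Dv); rewrite scalerA mulVf// scale1r mulrC.
by rewrite ler_pdivlMr ?lt_def ?tn0//; lra.
Qed.

Lemma shift_le x t : D x -> 0 <= t -> shift p v x <= p (x + t *: v) - t * p v.
Proof. by move=> Dx t0; apply: (ge_inf (lb Dx)); exists t. Qed.

Lemma shift_adh x e : D x -> 0 < e ->
  exists2 t, 0 <= t & p (x + t *: v) - t * p v < shift p v x + e.
Proof.
move=> Dx e0; have [|_ [t t0 <-] h] := inf_adherent e0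
    (E := [set p (x + t *: v) - t * p v | t in [set t : R | 0 <= t]]).
  split; last exact: lb.
  by exists (p (x + 0 *: v) - 0 * p v), 0 => /=.
by exists t.
Qed.

Lemma shift_le_self x : D x -> shift p v x <= p x.
Proof.
by move=> Dx; have := shift_le Dx (lexx 0); rewrite scale0r addr0 mul0r subr0.
Qed.

Lemma shift_sublinear : sublinear (shift p v).
Proof.
have [pD pZ] := sp; split=> [x y Dx Dy|t x t0 Dx].
  apply/ler_addgt0Pr => e e0; have e2 : 0 < e / 2 by rewrite divr_gt0.
  have [a a0 ha] := shift_adh Dx e2; have [b b0 hb] := shift_adh Dy e2.
  have := shift_le (DD Dx Dy) (addr_ge0 a0 b0).
  have := pD _ _ (DD Dx (DZ a Dv)) (DD Dy (DZ b Dv)).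
  by rewrite scalerDl addrACA; lra.
have [->|tn0] := eqVneq t 0.
  rewrite scale0r mul0r; apply: le_trans (shift_le_self D0) _.
  by rewrite (sublinear0 sp).
have tp : 0 < t by rewrite lt_def tn0.
apply/ler_addgt0Pr => e e0; have e2 : 0 < e / t by rewrite divr_gt0.
have [a a0 ha] := shift_adh Dx e2.
have := shift_le (DZ t Dx) (mulr_ge0 t0 a0).
rewrite -scalerA -scalerDr; have := pZ t _ t0 (DD Dx (DZ a Dv)).
have := ltW ha; rewrite -(ler_pM2l tp) mulrBr mulrDr [t * (e / t)]mulrC divfK//; lra.
Qed.

Lemma shift_le_sub x : D x -> shift p v x <= p (x + v) - p v.
Proof.
by move=> Dx; have := shift_le Dx ler01; rewrite scale1r mul1r.
Qed.
End Shift.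

(* A minimal sublinear functional is linear, because it is equal to its shifts. *)
Lemma hahn_banach (p0 : V -> R) (v0 : V) : sublinear p0 -> D v0 ->
  exists L : V -> R, [/\
    forall x y, D x -> D y -> L (x + y) = L x + L y,
    forall t x, D x -> L (t *: x) = t * L x,
    forall x, D x -> L x <= p0 x
    & L v0 = p0 v0].
Proof.
(* Minimising below [p1] instead of [p0] forces [L (- v0) <= - p0 v0], hence the equality at
   [v0]. *)
move=> sp0 Dv0; pose p1 := shift p0 v0.
have sp1 : sublinear p1 by exact: shift_sublinear.
pose T := {p : V -> R | sublinear p /\ forall x, D x -> p x <= p1 x}.
(* The order is reversed, so that Zorn's lemma yields a minimal functional. *)
pose le (p q : T) := `[< forall x, D x -> sval q x <= sval p x >].
have t0 : T by exists p1.
have [||C Ctot|[p [sp pp1]] pmin] := @ZL_preorder T t0 le.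
- by move=> t; apply/asboolP.
- move=> a b c /asboolP h1 /asboolP h2; apply/asboolP => x Dx.
  exact: le_trans (h2 _ Dx) (h1 _ Dx).
- have [[c0 Cc0]|C0] := pselect (exists c, C c); last first.
    by exists t0 => s Cs; exfalso; apply: C0; exists s.
  pose S x := [set sval c x | c in C].
  have Slb x : D x -> has_lbound (S x).
    move=> Dx; exists (- p1 (- x)) => _ [[c [sc cp]] _ <-] /=.
    apply: le_trans (sublinear_ge sc Dx); rewrite lerN2; exact/cp/subspaceN.
  have Sn0 x : S x !=set0 by exists (sval c0 x), c0.
  pose q x := inf (S x).
  have q_le c x : C c -> D x -> q x <= sval c x.
    by move=> Cc Dx; apply: (ge_inf (Slb x Dx)); exists c.
  have q_adh x e : D x -> 0 < e -> exists2 c, C c & sval c x < q x + e.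
    move=> Dx e0; have [|_ [c Cc <-] h] := inf_adherent e0 (E := S x).
      by split; [exact: Sn0|exact: Slb].
    by exists c.
  have sq : sublinear q /\ forall x, D x -> q x <= p1 x.
    split; last first.
      move=> x Dx; apply: le_trans (q_le _ _ Cc0 Dx) _.
      by case: (svalP c0) => _; apply.
    split=> [x y Dx Dy|t x t1 Dx].
      apply/ler_addgt0Pr => e e0; have e2 : 0 < e / 2 by rewrite divr_gt0.
      have [a Ca ha] := q_adh _ _ Dx e2; have [b Cb hb] := q_adh _ _ Dy e2.
      have [/asboolP ab|/asboolP ba] := Ctot _ _ Ca Cb.
        have := q_le _ _ Cb (DD Dx Dy); have := ab _ Dx.
        have [[bD _] _] := svalP b; have := bD _ _ Dx Dy; lra.
      have := q_le _ _ Ca (DD Dx Dy); have := ba _ Dy.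
      have [[aD _] _] := svalP a; have := aD _ _ Dx Dy; lra.
    have [->|tn0] := eqVneq t 0.
      rewrite scale0r mul0r; apply: le_trans (q_le _ _ Cc0 D0) _.
      by have [sc _] := svalP c0; rewrite (sublinear0 sc).
    have tp : 0 < t by rewrite lt_def tn0.
    apply/ler_addgt0Pr => e e0; have e2 : 0 < e / t by rewrite divr_gt0.
    have [a Ca ha] := q_adh _ _ Dx e2.
    have := q_le _ _ Ca (DZ t Dx).
    have [[_ aZ] _] := svalP a; have := aZ _ _ t1 Dx.
    have := ltW ha; rewrite -(ler_pM2l tp) mulrDr [t * (e / t)]mulrC divfK//; lra.
  by exists (exist _ q sq) => s Cs; apply/asboolP => x Dx; exact: q_le.
have lin x v : D x -> D v -> p (x + v) = p x + p v.
  move=> Dx Dv; have [pD _] := sp; apply/eqP; rewrite eq_le pD//=.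
  have sh : sublinear (shift p v) /\ forall x, D x -> shift p v x <= p1 x.
    split; first exact: shift_sublinear.
    by move=> y Dy; apply: le_trans (pp1 _ Dy); exact: shift_le_self.
  have /asboolP/(_ x Dx) /= := pmin (exist _ _ sh) ltac:(by apply/asboolP => y Dy; exact: shift_le_self).
  by have := shift_le_sub sp Dv Dx; lra.
have pN x : D x -> p (- x) = - p x.
  move=> Dx; have := lin x (- x) Dx (subspaceN Dx).
  by rewrite subrr (sublinear0 sp); lra.
have posZ t x : 0 <= t -> D x -> p (t *: x) = t * p x.
  move=> t1 Dx; have [_ pZ] := sp; apply/eqP; rewrite eq_le pZ//=.
  by have := pZ t _ t1 (subspaceN Dx); rewrite scalerN pN ?pN//; [lra|exact: DZ].
exists p; split=> //.
- move=> t x Dx; have [t1|t1] := leP 0 t; first exact: posZ.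
  rewrite -(opprK t) scaleNr pN; last exact: DZ.
  by rewrite posZ ?mulNr// oppr_ge0 ltW.
- by move=> x Dx; apply: le_trans (pp1 _ Dx) _; exact: shift_le_self.
apply/eqP; rewrite eq_le; apply/andP; split.
  by apply: le_trans (pp1 _ Dv0) _; exact: shift_le_self.
have := pp1 _ (subspaceN Dv0); have := shift_le_sub sp0 Dv0 (subspaceN Dv0).
by rewrite pN// addNr (sublinear0 sp0) /p1; lra.
Qed.
End HahnBanach.

(** * Peak points belong to the Choquet boundary *)

Section PeakPoints.
Variables (R : realType) (A : comBanachAlgType R[i]).
Local Notation M := (max_ideal_space A).
Local Notation r := (@spectral_radius R A).
Implicit Types (f g u v : A) (m : M).

(* Strong boundary points, with peaking elements taken in [A] instead of [cl A]. *)
Definition peak_point (x : M) := forall (s : seq A) (e : R),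
  {in s, forall f, ev x f = 0} -> 0 < e ->
  exists u, [/\ forall m, nc (ev m u) <= 1, 1 - e <= nc (ev x u)
              & {in s, forall f, forall m, nc (ev m f * ev m u) <= e}].

(* [h^-1] lies in the disc of diameter [0, 1], which touches the unit circle only
   at 1. *)
Lemma half_disc (h : R[i]) : 1 <= complex.Re h -> nc (h^-1 - 2^-1) <= 2^-1.
Proof.
move=> h1; have h0 : h != 0 by apply: contraTneq h1 => ->; rewrite -ltNge ltr01.
have n2 : nc (2 : R[i]) = 2 by rewrite (_ : 2 = 2%:C%C) ?ncR ?ger0_norm// rmorph_nat.
have h2 : (2 : R[i]) != 0 by rewrite pnatr_eq0.
have -> : h^-1 - 2^-1 = (2 - h) * (h^-1 * 2^-1) by field; rewrite h0.
rewrite !ncM !ncV n2 mulrA; apply: ler_piMl; first by rewrite invr_ge0.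
rewrite ler_pdivrMr ?nc_gt0// mul1r.
have -> : (2 : R[i]) = 2%:C%C by rewrite rmorph_nat.
rewrite -ler_sqr ?nnegrE ?nc_ge0// !sqr_nc !ReImE/=.
by lra.
Qed.

Lemma radius_bound (s : seq A) : exists2 N : R, 0 < N &
  {in s, forall f, forall m, nc (ev m f) <= N}.
Proof.
elim: s => [|f s [N N0 IH]]; first by exists 1.
exists (N + r f); first by rewrite ltr_wpDr// radius_ge0.
move=> g; rewrite inE => /predU1P[->|gs] m.
  by apply: le_trans (ev_le_radius _ _) _; rewrite lerDr ltW.
by apply: le_trans (IH _ gs m) _; rewrite lerDl radius_ge0.
Qed.

(** Composing [u], rotated to be positive at [x], with [z |-> (1 + K (1 - z))^-1] sends it into the
    disc of [half_disc] and makes it invertible. Invertibility serves [dominated_inv]; the disc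
    gives the estimate behind the phase. *)
Lemma peak_point_half_disc x (s : seq A) (e : R) : peak_point x ->
  {in s, forall f, ev x f = 0} -> 0 < e ->
  exists v, [/\ exists w, v * w = 1, forall m, nc (ev m v - 2^-1) <= 2^-1,
    nc (1 - ev x v) <= e & {in s, forall f, forall m, nc (ev m f * ev m v) <= e}].
Proof.
move=> px sx e0; have [N N0 HN] := radius_bound s.
(* Where [|u| < 1/2], the denominator exceeds [1 + K / 2], which beats the bound [N] on the elements
   of [s]; elsewhere [|f| <= 2 d]. The value at [x] needs [K d <= e]. *)
pose K := 2 * N / e.
have K0 : 0 < K by rewrite !divr_gt0 ?mulr_gt0.
have KE : K * e = 2 * N by rewrite /K divfK// gt_eqF.
pose d := e / (K + 2).
have K2 : 0 < K + 2 by rewrite addr_gt0.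
have d0 : 0 < d by rewrite divr_gt0.
have dE : d * (K + 2) = e by rewrite /d divfK// gt_eqF.
have [u [u1 ux us]] := px s d sx d0.
have [w nw wu] := phase (ev x u).
have nmu m : nc (ev m (w *: u)) = nc (ev m u) by rewrite evZ ncM nw mul1r.
pose h := 1 + K%:C%C *: (1 - w *: u).
have ReE m : complex.Re (ev m h) = 1 + K * (1 - complex.Re (ev m (w *: u))).
  by rewrite /h evD ev1 evZ evB ev1 !ReImE/=; ring.
have Re1 m : complex.Re (ev m (w *: u)) <= nc (ev m u).
  by rewrite -nmu; exact: Re_le_nc.
have Reh m : 1 <= complex.Re (ev m h).
  by rewrite ReE lerDl mulr_ge0 ?(ltW K0)// subr_ge0 (le_trans (Re1 m)).
have h0 m : ev m h != 0 by apply: contraTneq (Reh m) => ->; rewrite -ltNge ltr01.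
have [v hv] : exists v, h * v = 1 by apply: character_invertible => m; exact/eqP.
have vE m : ev m v = (ev m h)^-1.
  apply: (mulfI (h0 m)); rewrite -evM hv ev1 divff//; exact: h0.
exists v; split.
- by exists h; rewrite mulrC.
- by move=> m; rewrite vE; exact: half_disc.
- have hx : ev x h = (1 + K * (1 - nc (ev x u)))%:C%C.
    rewrite /h evD ev1 evZ evB ev1 evZ wu.
    by rewrite rc1 rcB rcM rcD.
  have a1 := Reh x; rewrite hx /= in a1; rewrite vE hx.
  move: a1; set a := 1 + K * (1 - _) => a1.
  rewrite rcV rc1 rcB ncR.
  have a0 : 0 < a by lra.
  have ad : a <= 1 + K * d.
    by rewrite lerD2l ler_wpM2l ?(ltW K0)//; lra.
  have ai : a^-1 * a = 1 by rewrite mulVf// gt_eqF.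
  have ai0 : 0 < a^-1 by rewrite invr_gt0.
  by rewrite ger0_norm; nra.
move=> f fs m; rewrite ncM vE ncV.
have nh := Re_le_nc (ev m h).
have nh0 : 0 < nc (ev m h) by have := Reh m; lra.
rewrite ler_pdivrMr//.
have [uh|uh] := leP 2^-1 (nc (ev m u)).
  have := us _ fs m; rewrite ncM => h1.
  have : nc (ev m f) * 2^-1 <= d.
    by apply: le_trans h1; rewrite ler_wpM2l// nc_ge0.
  have := Reh m; nra.
have h1 := HN _ fs m; apply: (le_trans h1).
have : 1 + K / 2 <= nc (ev m h).
  apply: le_trans nh; rewrite ReE lerD2l ler_wpM2l ?(ltW K0)//.
  by have := Re1 m; lra.
by move=> h2; nra.
Qed.

End PeakPoints.

Section PeakChoquet.
Variables (R : realType) (A : comBanachAlgType R[i]).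
Local Notation C := (R[i]^o).
Local Notation M := (max_ideal_space A).
Implicit Types (f g u v : A) (m : M).

Lemma cl_bounded F : cl A F -> exists2 K : R, 0 < K & forall m, nc (F m) <= K.
Proof.
move=> /(@cl_approx _ _ _ 1) => /(_ ltr01)[f hf].
exists (nrm f + 1); first by rewrite ltr_wpDl ?nrm_ge0.
move=> m; have := nc_ev_le m f; have := nc_tri (F m) (ev m f); have := hf m; lra.
Qed.

Lemma cl_continuous (F : M -> C) : cl A F -> continuous F. Proof. by case. Qed.

Lemma cl_of_approx (F : M -> C) : continuous F ->
  (forall e : R, 0 < e -> exists f, forall m, nc (F m - ev m f) < e) -> cl A F.
Proof.
move=> Fc h; split=> // W /uniform_nbhs[E [entE EW]].
move: entE; rewrite -entourage_ballE => -[e e0 eE].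
have eRe : e = (complex.Re e)%:C%C by rewrite RRe_real// gtr0_real.
have e1 : 0 < complex.Re e by move: e0; rewrite /= eRe ltcR.
have [f hf] := h _ e1.
exists (gelfand f); split; first by exists f.
apply: EW => m _; apply: eE => /=; rewrite -ball_normE /ball_ /=.
by rewrite norm_ncE eRe ltcR; exact: hf.
Qed.

Lemma cl_linear (a : C) (F G : M -> C) : cl A F -> cl A G ->
  cl A (fun m => a * F m + G m).
Proof.
move=> cF cG.
have small e : 0 < e -> exists2 d : R, 0 < d & forall z w, nc z < d -> nc w < d ->
    nc (a * z + w) < e.
  move=> e0; have a1 := nc_ge0 a; pose d := e / (nc a + 1).
  have d0 : 0 < d by rewrite divr_gt0//; lra.
  have dE : d * (nc a + 1) = e by rewrite /d divfK//; lra.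
  exists d => // z w zd wd; apply: le_lt_trans (ncD _ _) _; rewrite ncM; nra.
apply: cl_of_approx.
  apply/continuous_ncP => m e /small[d d0 h].
  have /continuous_ncP/(_ m d d0) hF := cl_continuous cF.
  have /continuous_ncP/(_ m d d0) hG := cl_continuous cG.
  apply: filterS (filterI hF hG) => m' [/= h1 h2].
  rewrite (_ : _ - _ = a * (F m' - F m) + (G m' - G m)); [exact: h|ring].
move=> e /small[d d0 h].
have [f hf] := cl_approx cF d0; have [g hg] := cl_approx cG d0.
exists (a *: f + g) => m; rewrite evD evZ.
by rewrite (_ : _ - _ = a * (F m - ev m f) + (G m - ev m g)); [exact: h|ring].
Qed.

Lemma cl1 : cl A (fun=> 1).
Proof.
have := gelfand_cl (1 : A); congr (cl A _).
by apply/funext => m; exact: ev1.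
Qed.

Lemma state_nc (E : set (M -> C)) L F (c : R) : state E L -> E F ->
  (forall m, nc (F m) <= c) -> nc (L F) <= c.
Proof.
move=> [_ Lb _] EF Fc; rewrite -lecR -norm_ncE; apply: Lb => // m.
by rewrite norm_ncE lecR.
Qed.

(* [s F + u] is bounded by [1 + 3 e] when [u] peaks at the zero [x] of [F] and
   [s] is small, so that [L1 F] is small for every state [L1] close to 1 on [u]. *)
Lemma peak_state x (L1 L2 : (M -> C) -> C) (t : R) : peak_point x ->
  state (cl A) L1 -> state (cl A) L2 -> 0 < t -> t < 1 ->
  (forall F, cl A F -> F x = t%:C%C * L1 F + (1 - t)%:C%C * L2 F) ->
  forall F, cl A F -> L1 F = F x.
Proof.
move=> px s1 s2 t0 t1 comb F cF.
pose F0 m := - F x * 1 + F m.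
have cF0 : cl A F0 by apply: cl_linear cF; exact: cl1.
have [l1 _ L11] := s1.
have L1F0 : L1 F0 = L1 F - F x.
  by rewrite /F0 (l1 (- F x) (fun=> 1) F cl1 cF) L11 mulr1 addrC.
apply/eqP; rewrite -subr_eq0 -L1F0 -nc_eq0 eq_le nc_ge0 andbT.
have [K K0 HK] := cl_bounded cF0.
(* [c K <= 1/2] handles the points where [|u| < 1/2]; at the others [|F0| <= 4 e] and [c <= 1/2]. *)
pose c := (2 * (K + 1))^-1.
have c0 : 0 < c by rewrite invr_gt0 mulr_gt0//; lra.
have cK : c * (2 * (K + 1)) = 1 by rewrite mulVf// gt_eqF// mulr_gt0//; lra.
have main e : 0 < e -> c * nc (L1 F0) * t <= e * (4 * t + 1).
  move=> e0; have [f hf] := cl_approx cF0 e0.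
  have fx : nc (ev x f) < e.
    by have := hf x; rewrite /F0 mulr1 addNr sub0r ncN.
  have [|u [u1 ux us]] := px [:: f - (ev x f)%:A] e _ e0.
    by move=> _ /[1!inE] /eqP ->; rewrite evB evC subrr.
  have [w nw wu] := phase (ev x u); have [z nz zL] := phase (L1 F0).
  pose G m := c%:C%C * z * F0 m + gelfand (w *: u) m.
  have cG : cl A G := cl_linear (c%:C%C * z) cF0 (gelfand_cl (w *: u)).
  have nwu m : nc (ev m (w *: u)) = nc (ev m u) by rewrite evZ ncM nw mul1r.
  have Gb m : nc (G m) <= 1 + 3 * e.
    apply: le_trans (ncD _ _) _; rewrite !ncM nz mulr1 ncR gtr0_norm//.
    rewrite -[gelfand _ m]/(ev m (w *: u)) nwu.
    have [uh|uh] := leP 2^-1 (nc (ev m u)).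
      have := us _ (mem_head _ _) m; rewrite ncM evB evC => h1.
      have h2 : nc (ev m f - ev x f) * 2^-1 <= e.
        by apply: le_trans h1; rewrite ler_wpM2l// nc_ge0.
      have h3 := nc_tri (F0 m) (ev m f); have h4 := nc_tri (ev m f) (ev x f).
      have h5 := hf m; have h6 := u1 m.
      have : c * nc (F0 m) <= 2^-1 * (4 * e); last by lra.
      apply: ler_pM; rewrite ?nc_ge0 ?(ltW c0)//; last by lra.
      by nra.
    have : c * nc (F0 m) <= c * K by rewrite ler_wpM2l ?(ltW c0).
    by nra.
  have LG : L1 G = (c * nc (L1 F0))%:C%C + L1 (gelfand (w *: u)).
    by rewrite /G (l1 _ _ _ cF0 (gelfand_cl _)) -mulrA zL rcM.
  have := state_nc s1 cG Gb; have := Re_le_nc (L1 G); rewrite LG cReD /= => h1 h2.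
  (* As [L2] is at most 1 on the rotated [u], [1 - e <= |u(x)|] forces [t] times the real part of
     [L1] to be at least [t - e] there. *)
  have := congr1 (@complex.Re R) (comb _ (gelfand_cl (w *: u))).
  rewrite -[gelfand _ x]/(ev x (w *: u)) evZ wu !ReImE/= !mul0r !subr0 => h3.
  have h4 : complex.Re (L2 (gelfand (w *: u))) <= 1.
    apply: le_trans (Re_le_nc _) _; apply: (state_nc s2); first exact: gelfand_cl.
    by move=> m; rewrite -[gelfand _ m]/(ev m (w *: u)) nwu.
  have := ler_wpM2l (ltW t0) (le_trans h1 h2); nra.
rewrite leNgt; apply/negP => n0.
have e0 : 0 < c * nc (L1 F0) * t / (2 * (4 * t + 1)).
  by rewrite divr_gt0 ?mulr_gt0//; lra.
have := main _ e0; have : 0 < c * nc (L1 F0) * t by rewrite !mulr_gt0.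
set X := c * _ * t => X0.
have : X / (2 * (4 * t + 1)) * (2 * (4 * t + 1)) = X by rewrite divfK// gt_eqF//; lra.
by lra.
Qed.

Lemma peak_Ch x : peak_point x -> Ch A x.
Proof.
move=> px L1 L2 t s1 s2 /andP[t0 t1] comb F cF; split.
  exact: (peak_state px s1 s2 t0 t1 comb).
apply: (peak_state (t := 1 - t) px s2 s1) => //; [lra|lra|].
by move=> G cG; rewrite comb// addrC opprB addrCA subrr addr0.
Qed.
End PeakChoquet.

(** * Points of the Choquet boundary are peak points *)

Section BoundedFunctions.
Variables (R : realType) (M : Type).
Local Notation V := (M -> R^o).
Implicit Types (h k : V).

Definition bounded_fun : set V := [set h | exists K : R, forall m, `|h m| <= K].

Lemma bounded0 : bounded_fun 0.
Proof. by exists 0 => m; rewrite normr0. Qed.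

Lemma boundedD h k : bounded_fun h -> bounded_fun k -> bounded_fun (h + k).
Proof.
move=> [H hH] [K hK]; exists (H + K) => m.
by apply: le_trans (ler_normD _ _) _; exact: lerD.
Qed.

Lemma boundedZ (t : R) h : bounded_fun h -> bounded_fun (t *: h).
Proof.
move=> [H hH]; exists (`|t| * H) => m.
by rewrite -[(t *: h) m]/(t * h m) normrM ler_wpM2l.
Qed.

Lemma boundedM h k : bounded_fun h -> bounded_fun k -> bounded_fun (fun m => h m * k m).
Proof.
move=> [H hH] [K hK]; exists (H * K) => m.
by rewrite normrM ler_pM.
Qed.

Lemma bounded_combo (t s : R) h k : bounded_fun h -> bounded_fun k ->
  bounded_fun (fun m => t * h m + s * k m).
Proof. by move=> Bh Bk; exact: boundedD (boundedZ t Bh) (boundedZ s Bk). Qed.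

Lemma bounded_cst (c : R) : bounded_fun (fun=> c).
Proof. by exists `|c|. Qed.
End BoundedFunctions.

Section Majorant.
Variables (R : realType) (A : comBanachAlgType R[i]) (x : max_ideal_space A).
Local Notation C := (R[i]^o).
Local Notation M := (max_ideal_space A).
Local Notation V := (M -> R^o).
Implicit Types (f g u v : A) (m : M) (h k : V).

(** The upper envelope of [h] at [x]. Linear functionals below it are positive and represent [x] on
    [A]: they play the role of representing measures. *)
Definition majorant h : R :=
  inf [set complex.Re (ev x f) | f in [set f | forall m, h m <= complex.Re (ev m f)]].

Let lb h : has_lbound [set complex.Re (ev x f) |
  f in [set f | forall m, h m <= complex.Re (ev m f)]].
Proof. by exists (h x) => _ [f hf <-]; exact: hf. Qed.

Lemma majorant_le h f : (forall m, h m <= complex.Re (ev m f)) ->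
  majorant h <= complex.Re (ev x f).
Proof. by move=> hf; apply: (ge_inf (lb h)); exists f. Qed.

Lemma majorant_adh h e : bounded_fun h -> 0 < e ->
  exists2 f, forall m, h m <= complex.Re (ev m f)
           & complex.Re (ev x f) < majorant h + e.
Proof.
move=> [K hK] e0; have [|_ [f hf <-] hfe] := inf_adherent e0 (E := [set complex.Re (ev x f) |
  f in [set f | forall m, h m <= complex.Re (ev m f)]]).
  split; last exact: lb.
  exists (complex.Re (ev x (K%:C%C%:A))), K%:C%C%:A => // m /=.
  by rewrite evC/=; exact: le_trans (ler_norm _) (hK m).
by exists f.
Qed.

Lemma majorant_sublinear : sublinear (@bounded_fun R M) majorant.
Proof.
split=> [h k Bh Bk|t h t0 Bh].
  apply/ler_addgt0Pr => e e0; have e2 : 0 < e / 2 by rewrite divr_gt0.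
  have [f hf fe] := majorant_adh Bh e2; have [g hg ge] := majorant_adh Bk e2.
  have : majorant (h + k) <= complex.Re (ev x (f + g)).
    by apply: majorant_le => m; rewrite evD cReD; exact: lerD.
  by rewrite evD cReD; lra.
apply/ler_addgt0Pr => e e0; have t1 : 0 < t + 1 by lra.
have e2 : 0 < e / (t + 1) by rewrite divr_gt0.
have [f hf fe] := majorant_adh Bh e2.
have : majorant (t *: h) <= complex.Re (ev x (t%:C%C *: f)).
  apply: majorant_le => m; rewrite evZ cReM /= mul0r subr0.
  by rewrite -[(t *: h) m]/(t * h m) ler_wpM2l.
rewrite evZ cReM /= mul0r subr0 => /le_trans; apply.
have : t * complex.Re (ev x f) <= t * (majorant h + e / (t + 1)) by rewrite ler_wpM2l// ltW.
have : e / (t + 1) * (t + 1) = e by rewrite divfK// gt_eqF.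
move: (e / _) e2 => d d0; nra.
Qed.
End Majorant.

Section Extreme.
Variables (R : realType) (A : comBanachAlgType R[i]) (x : max_ideal_space A).
Local Notation C := (R[i]^o).
Local Notation M := (max_ideal_space A).
Local Notation V := (M -> R^o).
Implicit Types (f g u v : A) (m : M) (h k : V) (F G : M -> C).
Variable L : V -> R.
Hypothesis LD : forall h k, bounded_fun h -> bounded_fun k -> L (h + k) = L h + L k.
Hypothesis LZ : forall (t : R) h, bounded_fun h -> L (t *: h) = t * L h.
Hypothesis Lle : forall h, bounded_fun h -> L h <= majorant x h.

Let reF (F : M -> C) : V := fun m => complex.Re (F m).
Let imF (F : M -> C) : V := fun m => complex.Im (F m).
Let re f : V := fun m => complex.Re (ev m f).

Lemma L_combo (t s : R) h k : bounded_fun h -> bounded_fun k ->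
  L (fun m => t * h m + s * k m) = t * L h + s * L k.
Proof.
move=> Bh Bk; rewrite -(LZ t Bh) -(LZ s Bk).
by rewrite -(LD (boundedZ t Bh) (boundedZ s Bk)).
Qed.

Lemma L_mono h k : bounded_fun h -> bounded_fun k -> (forall m, h m <= k m) -> L h <= L k.
Proof.
move=> Bh Bk hk; have := Lle (bounded_combo 1 (-1) Bh Bk); rewrite (L_combo _ _ Bh Bk).
have : majorant x (fun m => 1 * h m + (-1) * k m) <= complex.Re (ev x 0).
  by apply: majorant_le => m; rewrite ev0/=; have := hk m; lra.
rewrite ev0/=; lra.
Qed.

Lemma bounded_re f : bounded_fun (re f).
Proof. by exists (nrm f) => m; apply: le_trans (nc_Re _) (nc_ev_le _ _). Qed.

Lemma L_re f : L (re f) = complex.Re (ev x f).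
Proof.
have H g : L (re g) <= complex.Re (ev x g).
  by apply: le_trans (Lle (bounded_re g)) _; exact: majorant_le.
apply/eqP; rewrite eq_le H /=; have := H (- f).
have -> : re (- f) = -1 *: re f.
  apply/funext => m; rewrite /re evN cReN -[RHS]/(-1 * complex.Re (ev m f)).
  by rewrite mulN1r.
by rewrite (LZ _ (bounded_re f)) evN cReN; lra.
Qed.

Lemma L_cst (c : R) : L (fun=> c) = c.
Proof.
have -> : (fun=> c) = re (c%:C%C%:A) by apply/funext => m; rewrite /re evC.
by rewrite L_re evC.
Qed.

Lemma bounded_reF F : cl A F -> bounded_fun (reF F).
Proof.
move=> /cl_bounded[K _ hK]; exists K => m; exact: le_trans (nc_Re _) (hK m).
Qed.

Lemma bounded_imF F : cl A F -> bounded_fun (imF F).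
Proof.
move=> /cl_bounded[K _ hK]; exists K => m; exact: le_trans (nc_Im _) (hK m).
Qed.

Lemma L_reF F : cl A F -> L (reF F) = complex.Re (F x).
Proof.
move=> cF; apply/eqP; rewrite -subr_eq0 -normr_eq0 eq_le normr_ge0 andbT.
apply/ler_addgt0Pr => e e0; have e2 : 0 < e / 2 by rewrite divr_gt0.
have [f hf] := cl_approx cF e2.
have hm m : `|complex.Re (F m) - complex.Re (ev m f)| <= e / 2.
  by rewrite -cReN -cReD; apply: le_trans (nc_Re _) (ltW (hf m)).
have Bf := bounded_re f; have BF := bounded_reF cF.
have Be := @bounded_cst R M (e / 2).
have up : L (reF F) <= L (fun m => 1 * re f m + 1 * (e / 2)).
  apply: (L_mono BF (bounded_combo 1 1 Bf Be)) => m.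
  by have := hm m; rewrite ler_norml /reF /re; lra.
have lo : L (fun m => 1 * re f m + (-1) * (e / 2)) <= L (reF F).
  apply: (L_mono (bounded_combo 1 (-1) Bf Be) BF) => m.
  by have := hm m; rewrite ler_norml /reF /re; lra.
move: up lo; rewrite !(L_combo _ _ Bf Be) L_re L_cst.
have := hm x; rewrite !ler_norml; lra.
Qed.

Lemma cl0 : cl A (fun=> 0).
Proof.
have := gelfand_cl (0 : A); congr (cl A _).
by apply/funext => m; exact: ev0.
Qed.

Lemma cl_scale (a : C) F : cl A F -> cl A (fun m => a * F m).
Proof.
move=> cF; have := cl_linear a cF cl0; congr (cl A _).
by apply/funext => m; rewrite addr0.
Qed.

Lemma L_imF F : cl A F -> L (imF F) = complex.Im (F x).
Proof.
move=> cF; have := L_reF (cl_scale (- 'i%C) cF); rewrite !ReImE/= => h.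
transitivity (L (reF (fun m => - 'i%C * F m))).
  by congr L; apply/funext => m; rewrite /imF /reF !ReImE/=; ring.
by rewrite h; ring.
Qed.

(* The state [F |-> L (h F) / L h]: for [x] extreme and [h] and [1 - h] positive,
   it coincides with the evaluation at [x]. *)
Definition weighted h F : C :=
  (L (fun m => h m * complex.Re (F m)) / L h)%:C%C
  + 'i%C * (L (fun m => h m * complex.Im (F m)) / L h)%:C%C.

Lemma weighted_linear h (a : C) F G : bounded_fun h -> cl A F -> cl A G ->
  weighted h (fun m => a * F m + G m) = a * weighted h F + weighted h G.
Proof.
move=> Bh cF cG.
have BrF : bounded_fun (fun m => h m * complex.Re (F m)) := boundedM Bh (bounded_reF cF).
have BiF : bounded_fun (fun m => h m * complex.Im (F m)) := boundedM Bh (bounded_imF cF).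
have BrG : bounded_fun (fun m => h m * complex.Re (G m)) := boundedM Bh (bounded_reF cG).
have BiG : bounded_fun (fun m => h m * complex.Im (G m)) := boundedM Bh (bounded_imF cG).
have Bre : bounded_fun (fun m => complex.Re a * (h m * complex.Re (F m))
    + - complex.Im a * (h m * complex.Im (F m))) := bounded_combo _ _ BrF BiF.
have Bim : bounded_fun (fun m => complex.Im a * (h m * complex.Re (F m))
    + complex.Re a * (h m * complex.Im (F m))) := bounded_combo _ _ BrF BiF.
rewrite /weighted.
have -> : L (fun m => h m * complex.Re (a * F m + G m)) =
    1 * (complex.Re a * L (fun m => h m * complex.Re (F m))
    + - complex.Im a * L (fun m => h m * complex.Im (F m)))
    + 1 * L (fun m => h m * complex.Re (G m)).
  rewrite -(L_combo _ _ BrF BiF) -(L_combo 1 1 Bre BrG); congr L.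
  by apply/funext => m; rewrite cReD cReM; ring.
have -> : L (fun m => h m * complex.Im (a * F m + G m)) =
    1 * (complex.Im a * L (fun m => h m * complex.Re (F m))
    + complex.Re a * L (fun m => h m * complex.Im (F m)))
    + 1 * L (fun m => h m * complex.Im (G m)).
  rewrite -(L_combo _ _ BrF BiF) -(L_combo 1 1 Bim BiG); congr L.
  by apply/funext => m; rewrite cImD cImM; ring.
move: (L (fun m => h m * complex.Re (F m))) (L (fun m => h m * complex.Im (F m)))
  (L (fun m => h m * complex.Re (G m))) (L (fun m => h m * complex.Im (G m))) (L h) => p q r s t.
by apply/eqP; rewrite eq_complex !ReImE/=; apply/andP; split; apply/eqP; ring.
Qed.

Lemma weighted_state h : bounded_fun h -> (forall m, 0 <= h m) -> 0 < L h ->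
  state (cl A) (weighted h).
Proof.
move=> Bh h0 L0; split.
- by move=> a F G cF cG; exact: weighted_linear.
- move=> F c cF Fc.
  have cE : c = (complex.Re c)%:C%C.
    by rewrite RRe_real// ger0_real// (le_trans _ (Fc x)).
  have {}Fc m : nc (F m) <= complex.Re c by rewrite -lecR -norm_ncE -cE.
  rewrite norm_ncE cE lecR.
  have [w nw wL] := phase (weighted h F).
  have WG : weighted h (fun m => w * F m) = (nc (weighted h F))%:C%C.
    have := weighted_linear w Bh cF cl0; rewrite wL [weighted h (fun=> 0)](_ : _ = 0).
      rewrite addr0 => <-; congr (weighted h); apply/funext => m; by rewrite addr0.
    rewrite /weighted /= (_ : (fun m => h m * 0) = (fun=> 0)).
      by rewrite L_cst mul0r mulr0 addr0.
    by apply/funext => m; rewrite mulr0.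
  have := congr1 (@complex.Re R) WG.
  rewrite /weighted !ReImE/= mul0r mul1r subr0 addr0 => <-.
  rewrite ler_pdivrMr// -(LZ _ Bh).
  apply: (L_mono (boundedM Bh (bounded_reF (cl_scale w cF))) (boundedZ _ Bh)) => m.
  rewrite -[X in _ <= X]/(complex.Re c * h m) mulrC ler_wpM2r//.
  by apply: le_trans (Re_le_nc _) _; rewrite ncM nw mul1r.
rewrite /weighted /=.
rewrite (_ : (fun m => h m * 0) = (fun=> 0)); last by apply/funext => m; rewrite mulr0.
rewrite (_ : (fun m => h m * 1) = h); last by apply/funext => m; rewrite mulr1.
by rewrite L_cst mul0r mulr0 addr0 divff ?gt_eqF.
Qed.

Hypothesis Chx : Ch A x.

(** The weights [1/2 + n Re f] and [1/2 - n Re f] are positive and, as [f(x) = 0], both have mass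
    1/2. Evaluation at [x] is the midpoint of the two states; extremality gives the first one the
    value 0 at [f], and the real part of that value is a multiple of [L] of the square. *)
Lemma extreme_sqr f : ev x f = 0 -> L (fun m => complex.Re (ev m f) ^+ 2) = 0.
Proof.
move=> fx; pose N := nrm f + 1.
have N0 : 0 < N by rewrite ltr_wpDl ?nrm_ge0.
have fle m : `|complex.Re (ev m f)| <= N.
  by apply: le_trans (nc_Re _) _; apply: le_trans (nc_ev_le _ _) _; rewrite lerDl.
pose n := (4 * N)^-1.
have n0 : 0 < n by rewrite invr_gt0 mulr_gt0.
have nN : n * (4 * N) = 1 by rewrite mulVf// gt_eqF// mulr_gt0.
have nf m : `|n * complex.Re (ev m f)| <= 4^-1.
  by rewrite normrM gtr0_norm//; have := fle m; nra.
have B1 := @bounded_cst R M 1; have Bf := bounded_re f.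
pose h (b : R) : V := fun m => 2^-1 * 1 + (b * n) * re f m.
have Bh b : bounded_fun (h b) := bounded_combo _ _ B1 Bf.
have Lh b : L (h b) = 2^-1.
  by rewrite (L_combo _ _ B1 Bf) L_cst L_re fx /= mulr0 addr0 mulr1.
have h1 m : 0 <= h 1 m by rewrite /h /re; have := nf m; rewrite ler_norml; lra.
have h2 m : 0 <= h (-1) m by rewrite /h /re; have := nf m; rewrite ler_norml; lra.
have half0 : 0 < 2^-1 :> R by rewrite invr_gt0.
have s1 := weighted_state (Bh 1) h1 ltac:(by rewrite Lh).
have s2 := weighted_state (Bh (-1)) h2 ltac:(by rewrite Lh).
have comb F : cl A F ->
    F x = (2^-1)%:C%C * weighted (h 1) F + (1 - 2^-1)%:C%C * weighted (h (-1)) F.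
  move=> cF; have Bre := bounded_reF cF; have Bim := bounded_imF cF.
  have E1 b : L (fun m => h b m * complex.Re (F m)) =
      2^-1 * complex.Re (F x) + (b * n) * L (fun m => re f m * reF F m).
    rewrite -(L_reF cF) -(L_combo _ _ Bre (boundedM Bf Bre)).
    by congr L; apply/funext => m; rewrite /h /reF; ring.
  have E2 b : L (fun m => h b m * complex.Im (F m)) =
      2^-1 * complex.Im (F x) + (b * n) * L (fun m => re f m * imF F m).
    rewrite -(L_imF cF) -(L_combo _ _ Bim (boundedM Bf Bim)).
    by congr L; apply/funext => m; rewrite /h /imF; ring.
  rewrite /weighted !E1 !E2 !Lh.
  move: (L _) (L _) => p q.
  by apply/eqP; rewrite eq_complex !ReImE/=; apply/andP; split; apply/eqP; field.
have t01 : 0 < (2^-1 : R) < 1 by apply/andP; split; lra.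
have [h3 _] := @Chx _ _ _ s1 s2 t01 comb _ (gelfand_cl f).
have := congr1 (@complex.Re R) h3; rewrite -[gelfand f x]/(ev x f) fx /weighted !ReImE/= Lh.
have -> : (fun m => h 1 m * complex.Re (gelfand f m)) =
   fun m => 2^-1 * re f m + n * (re f m * re f m).
  by apply/funext => m; rewrite /h /re -[gelfand f m]/(ev m f); ring.
rewrite (L_combo _ _ Bf (boundedM Bf Bf)) L_re fx /= mulr0 add0r mul0r mul1r subr0 addr0.
rewrite invrK -mulrA => h4; suff : L (fun m => re f m * re f m) = 0 by [].
move: (L _) h4 => l h4; have : n * (4 * N) * l = 2 * N * (n * (l * 2)) by ring.
by rewrite h4 nN mul1r mulr0.
Qed.

Lemma bounded_sqr f : bounded_fun (fun m => nc (ev m f) ^+ 2 : R^o).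
Proof.
exists (nrm f ^+ 2) => m; rewrite ger0_norm ?sqr_ge0//.
by rewrite lerXn2r ?nnegrE ?nc_ge0 ?nrm_ge0 ?nc_ev_le.
Qed.

Lemma bounded_sum (s : seq A) :
  bounded_fun (fun m => \sum_(f <- s) nc (ev m f) ^+ 2 : R^o).
Proof.
elim: s => [|f s ih].
  by have := @bounded_cst R M 0; congr bounded_fun; apply/funext => m; rewrite big_nil.
have := boundedD (bounded_sqr f) ih; congr bounded_fun; apply/funext => m.
by rewrite big_cons.
Qed.

Lemma extreme_sum (s : seq A) : {in s, forall f, ev x f = 0} ->
  L (fun m => \sum_(f <- s) nc (ev m f) ^+ 2) = 0.
Proof.
elim: s => [_|f s ih sx].
  rewrite (_ : (fun _ => _) = (fun=> 0)) ?L_cst//.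
  by apply/funext => m; rewrite big_nil.
have fx : ev x f = 0 by apply: sx; rewrite mem_head.
(* The real part of [- i f] is the imaginary part of [f], so two squares make up [|f|^2]. *)
have ifx : ev x (- 'i%C *: f) = 0 by rewrite evZ fx mulr0.
have B g : bounded_fun (fun m => complex.Re (ev m g) ^+ 2 : R^o).
  exact: boundedM (bounded_re g) (bounded_re g).
have -> : (fun m => \sum_(g <- f :: s) nc (ev m g) ^+ 2) =
   ((fun m => complex.Re (ev m f) ^+ 2) + (fun m => complex.Re (ev m (- 'i%C *: f)) ^+ 2)
    : V) + (fun m => \sum_(g <- s) nc (ev m g) ^+ 2).
  apply/funext => m; rewrite big_cons sqr_nc.
  rewrite -[RHS]/(complex.Re (ev m f) ^+ 2 + complex.Re (ev m (- 'i%C *: f)) ^+ 2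
     + \sum_(g <- s) nc (ev m g) ^+ 2).
  by rewrite evZ !ReImE/=; congr (_ + _ + _); ring.
rewrite (LD (boundedD (B _) (B _)) (bounded_sum s)) (LD (B _) (B _)).
rewrite (extreme_sqr fx) (extreme_sqr ifx) ih ?addr0// => g gs.
by apply: sx; rewrite inE gs orbT.
Qed.
End Extreme.

Section ChoquetPeak.
Variables (R : realType) (A : comBanachAlgType R[i]) (x : max_ideal_space A).

(** Some representing functional attains the envelope of [G], and extremality makes it vanish on
    [G]. Hence some [g] has [Re g >= G] and [Re g(x) < e], and the inverse of [1 + g] peaks at [x]:
    [|f u| <= |f| / (1 + (|f| / e)^2) <= e]. *)
Lemma Ch_peak : Ch A x -> peak_point x.
Proof.
move=> Chx s e sx e0.
pose K := e^-1; have K0 : 0 < K by rewrite invr_gt0.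
have Ke : K * e = 1 by rewrite mulVf// gt_eqF.
pose s' := [seq K%:C%C *: f | f <- s].
have s'x : {in s', forall f, ev x f = 0}.
  by move=> _ /mapP[f fs ->]; rewrite evZ sx// mulr0.
pose G : max_ideal_space A -> R^o := fun m => \sum_(f <- s') nc (ev m f) ^+ 2.
have BG : bounded_fun G := bounded_sum s'.
have [L [LD LZ Lle LG]] := hahn_banach (@bounded0 R _) (@boundedD R _) (@boundedZ R _)
  (majorant_sublinear x) BG.
have G0 : majorant x G = 0 by rewrite -LG; exact: (extreme_sum LD LZ Lle Chx s'x).
have [g hg gx] := majorant_adh x BG e0.
rewrite G0 add0r in gx.
have sum0 t m : 0 <= \sum_(f <- t) nc (ev m (f : A)) ^+ 2.
  by elim: t => [|f t ih]; rewrite ?big_nil// big_cons addr_ge0 ?sqr_ge0.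
have Gs f m : f \in s -> K ^+ 2 * nc (ev m f) ^+ 2 <= G m.
  move=> fs; have f's : K%:C%C *: f \in s' by exact: map_f.
  have -> : K ^+ 2 * nc (ev m f) ^+ 2 = nc (ev m (K%:C%C *: f)) ^+ 2.
    by rewrite evZ ncM ncR gtr0_norm// exprMn.
  by rewrite /G (big_rem _ f's) /= lerDl.
have Gm0 m : 0 <= G m by exact: sum0.
(* Subtracting the imaginary part of [g(x)] leaves [Re h] unchanged and makes [h(x)] a real number
   below [1 + e]. *)
pose h := 1 + g - ('i%C * (complex.Im (ev x g))%:C%C)%:A.
have Reh m : complex.Re (ev m h) = 1 + complex.Re (ev m g).
  by rewrite /h evB evD ev1 evC !ReImE/=; ring.
have Reh1 m : 1 + G m <= nc (ev m h).
  by apply: le_trans (Re_le_nc _); rewrite Reh lerD2l.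
have h0 m : ev m h != 0.
  by rewrite -nc_gt0; apply: lt_le_trans (Reh1 m); have := Gm0 m; lra.
have [u hu] : exists u, h * u = 1 by apply: character_invertible => m; exact/eqP.
have uE m : ev m u = (ev m h)^-1.
  by apply: (mulfI (h0 m)); rewrite -evM hu ev1 divff// h0.
exists u; split.
- move=> m; rewrite uE ncV invf_le1 ?nc_gt0//.
  by apply: le_trans (Reh1 m); rewrite lerDl.
- have hx : ev x h = (1 + complex.Re (ev x g))%:C%C.
    apply/eqP; rewrite eq_complex Reh eqxx /=.
    by rewrite /h evB evD ev1 evC !ReImE/=; apply/eqP; ring.
  have g0 : 0 <= complex.Re (ev x g) by apply: le_trans (hg x).
  rewrite uE hx ncV ncR ger0_norm; last by lra.
  have a0 : 0 < (1 + complex.Re (ev x g))^-1 by rewrite invr_gt0; lra.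
  have : (1 + complex.Re (ev x g))^-1 * (1 + complex.Re (ev x g)) = 1.
    by rewrite mulVf// gt_eqF//; lra.
  by move: (_^-1) a0 => a a0; nra.
move=> f fs m; rewrite ncM uE ncV ler_pdivrMr ?nc_gt0//.
have : 1 + K ^+ 2 * nc (ev m f) ^+ 2 <= nc (ev m h).
  by apply: le_trans (Reh1 m); rewrite lerD2l Gs.
move=> h1; have : e * (1 + K ^+ 2 * nc (ev m f) ^+ 2) <= e * nc (ev m h).
  by rewrite ler_wpM2l// ltW.
apply: le_trans.
have -> : e * (1 + K ^+ 2 * nc (ev m f) ^+ 2) = e + (K * e) * K * nc (ev m f) ^+ 2 by ring.
have nf := nc_ge0 (ev m f); have : 0 <= K * (nc (ev m f) - e) ^+ 2.
  by rewrite mulr_ge0 ?sqr_ge0 ?ltW.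
have -> : K * (nc (ev m f) - e) ^+ 2
   = K * nc (ev m f) ^+ 2 - 2 * (K * e) * nc (ev m f) + (K * e) * e by ring.
rewrite Ke; lra.
Qed.

Lemma ChP : Ch A x <-> peak_point x.
Proof. by split; [exact: Ch_peak|exact: peak_Ch]. Qed.
End ChoquetPeak.

(** * The Choquet boundary is a boundary *)

Section Boundary.
Variables (R : realType) (A : comBanachAlgType R[i]).
Local Notation M := (max_ideal_space A).
Local Notation r := (@spectral_radius R A).
Implicit Types (f g u v : A) (m : M) (F G : set M).

Lemma approx_closedT : approx_closed [set: M].
Proof. by []. Qed.

Lemma approx_closedI F G : approx_closed F -> approx_closed G -> approx_closed (F `&` G).
Proof.
move=> cF cG p h; split.
  by apply: cF => s e e0; have [m [Fm _] hm] := h s e e0; exists m.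
by apply: cG => s e e0; have [m [_ Gm] hm] := h s e e0; exists m.
Qed.

Lemma approx_closed_eq g (c : R[i]) : approx_closed [set m | ev m g = c].
Proof.
move=> p h /=; apply/eqP; rewrite -subr_eq0 -nc_eq0 eq_le nc_ge0 andbT.
apply/ler_addgt0Pr => e e0; rewrite add0r.
have [m /= <-] := h [:: g] e e0.
by move=> /(_ g (mem_head _ _)) /ltW; rewrite ncBC.
Qed.

Lemma approx_closed_max F g : approx_closed F -> F !=set0 ->
  exists2 m, F m & forall m', F m' -> nc (ev m' g) <= nc (ev m g).
Proof.
move=> cF [m0 Fm0].
pose I := {classic {m | F m}}.
have [i|s|m Hm] := @character_fip _ _ I
    (fun i => F `&` [set m | nc (ev (sval (i : {m | F m})) g) <= nc (ev m g)]).
- by apply: approx_closedI => //; exact: approx_closed_ge.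
- have [m Fm hm] : exists2 m, F m &
      {in s, forall i : I, nc (ev (sval (i : {m | F m})) g) <= nc (ev m g)}.
    elim: s => [|i s [m Fm hm]]; first by exists m0.
    have [le|lt] := leP (nc (ev m g)) (nc (ev (sval (i : {m | F m})) g)).
      exists (sval (i : {m | F m})); first exact: (svalP (i : {m | F m})).
      by move=> j; rewrite inE => /predU1P[->//|/hm h]; exact: le_trans le.
    exists m => // j; rewrite inE => /predU1P[->|/hm//]; exact: ltW.
  by exists m => i /hm.
exists m; first by have [] := Hm (exist _ m0 Fm0 : I).
by move=> m' Fm'; have [_] := Hm (exist _ m' Fm' : I).
Qed.

Lemma chain_fip (S : set (set M)) (K : set M) :
  S !=set0 -> total_on S (fun F G => F `<=` G) ->
  (forall F, S F -> approx_closed F) -> approx_closed K ->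
  (forall F, S F -> exists2 m, F m & K m) ->
  exists2 m, (forall F, S F -> F m) & K m.
Proof.
move=> [F0 SF0] tot cl cK meet.
pose I := {classic {F | S F}}.
have [i|s|m Hm] := @character_fip _ _ I (fun i => sval (i : {F | S F}) `&` K).
- by apply: approx_closedI => //; apply: cl; exact: (svalP (i : {F | S F})).
- have [F SF hF] : exists2 F, S F & {in s, forall i : I, F `<=` sval (i : {F | S F})}.
    elim: s => [|i s [F SF hF]]; first by exists F0.
    have [iF|Fi] := tot _ _ (svalP (i : {F | S F})) SF.
      exists (sval (i : {F | S F})); first exact: (svalP (i : {F | S F})).
      by move=> j; rewrite inE => /predU1P[->//|/hF]; exact: subset_trans.
    by exists F => // j; rewrite inE => /predU1P[->//|/hF].
  by have [m Fm Km] := meet _ SF; exists m => i /hF h; split=> //; exact: h.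
exists m => [F SF|]; first by have [] := Hm (exist _ F SF : I).
by have [] := Hm (exist _ F0 SF0 : I).
Qed.

Definition below F (s : seq (A * R)) :=
  {in s, forall fc, forall m, F m -> nc (ev m fc.1) < fc.2}.

(* An approximate form of peak sets, which does not require the algebra to be
   closed for the supremum norm. *)
Definition peak_set F := [/\ approx_closed F, F !=set0 &
  forall (s : seq (A * R)) (e : R), below F s -> 0 < e ->
  exists u, {in s, forall fc, forall m, nc (ev m fc.1 * ev m u) <= fc.2} /\
    forall m, F m -> nc (ev m u - 1) <= e].

Lemma peak_setT : peak_set [set: M].
Proof.
split=> //; first by have [m _] := exists_character A; exists m.
move=> s e sb e0; exists 1; split=> [fc fs m|m _].
  by rewrite ev1 mulr1; apply: ltW; exact: sb.
by rewrite ev1 subrr Normc.normc0 ltW.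
Qed.

(** Strict convexity of the disc. *)
Lemma half_lt1 (z : R[i]) : nc z <= 1 -> z != 1 -> nc (2^-1 * (1 + z)) < 1.
Proof.
move=> z1 zn1; have e2 : (2^-1 : R[i]) = (2^-1)%:C%C by rewrite -rcV rmorph_nat.
rewrite e2 ncM ncR gtr0_norm ?invr_gt0// -ltr_pdivlMl ?invr_gt0// invrK mulr1.
rewrite -ltr_sqr ?nnegrE ?nc_ge0// sqr_nc !ReImE/=.
have h : complex.Re z ^+ 2 + complex.Im z ^+ 2 <= 1.
  by rewrite -sqr_nc exprn_ile1// nc_ge0.
have [Re1|Re1] := ltP (complex.Re z) 1; first by lra.
exfalso; move/eqP: zn1; apply.
have i0 := sqr_ge0 (complex.Im z).
have re1 : complex.Re z = 1.
  by apply/eqP; rewrite eq_le Re1 andbT; exact: le_trans (Re_le_nc _) z1.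
have im0 : complex.Im z = 0.
  by apply/eqP; rewrite -sqrf_eq0 eq_le i0 andbT; rewrite re1 in h; lra.
by apply/eqP; rewrite eq_complex re1 im0 /= !eqxx.
Qed.

Lemma half_le1 (z : R[i]) : nc z <= 1 -> nc (2^-1 * (1 + z)) <= 1.
Proof.
have [->|zn1 z1] := eqVneq z 1; last by apply: ltW; exact: half_lt1.
by rewrite mulVf ?pnatr_eq0// Normc.normc1.
Qed.

(** With [g1 = g / g(m0)], the element [q = (1 + g1) / 2] is bounded by 1 on [F] and has modulus 1
    there only where [g1 = 1]. A power [q ^+ n] peaks within [F]; off [F] it may be large, which is
    compensated by applying the property of [F] to the products [f q ^+ n]. *)
Lemma peak_set_step F g m0 : peak_set F -> F m0 ->
  (forall m, F m -> nc (ev m g) <= nc (ev m0 g)) ->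
  peak_set (F `&` [set m | ev m g = ev m0 g]).
Proof.
move=> pF Fm0 gmax; have [cF _ hF] := pF.
have [g0|g0] := eqVneq (ev m0 g) 0.
  rewrite (_ : _ `&` _ = F)//; apply/seteqP; split=> [m []//|m Fm]; split=> //=.
  apply/eqP; rewrite g0 -nc_eq0 eq_le nc_ge0 andbT.
  by apply: le_trans (gmax _ Fm) _; rewrite g0 Normc.normc0.
pose g1 := (ev m0 g)^-1 *: g.
have g1E m : ev m g1 = 1 <-> ev m g = ev m0 g.
  rewrite evZ; split=> [|->]; last by rewrite mulVf.
  by move=> /(congr1 (fun z => ev m0 g * z)); rewrite mulrA mulfV// mul1r mulr1.
have g1le m : F m -> nc (ev m g1) <= 1.
  move=> Fm; rewrite evZ ncM ncV mulrC ler_pdivrMr ?nc_gt0// mul1r; exact: gmax.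
pose q := 2^-1 *: (1 + g1).
have qE m : ev m q = 2^-1 * (1 + ev m g1) by rewrite evZ evD ev1.
have qle m : F m -> nc (ev m q) <= 1 by move=> Fm; rewrite qE half_le1// g1le.
split.
- by apply: approx_closedI => //; exact: approx_closed_eq.
- by exists m0.
move=> s e sb e0.
(* On the part of [F] where [|f| >= c], the modulus of [q] has a maximum, less than 1, so its powers
   beat the norm of [f]. *)
have qlt f (c : R) : (forall m, F m -> ev m g = ev m0 g -> nc (ev m f) < c) ->
    exists n, forall k, (n <= k)%N -> forall m, F m -> nc (ev m (f * q ^+ k)) < c.
  move=> fc; have c0 : 0 < c by apply: le_lt_trans (fc m0 Fm0 erefl); exact: nc_ge0.
  pose K := F `&` [set m | c <= nc (ev m f)].
  have cK : approx_closed K by apply: approx_closedI => //; exact: approx_closed_ge.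
  have [Kn0|K0] := pselect (K !=set0); last first.
    exists 0%N => k _ m Fm; rewrite evM ncM evX ncX.
    apply: le_lt_trans (_ : nc (ev m f) < c).
      by rewrite ler_piMr ?nc_ge0// exprn_ile1 ?nc_ge0 ?qle.
    by rewrite ltNge; apply/negP => h; apply: K0; exists m.
  have [m1 [Fm1 cm1] hm1] := approx_closed_max q cK Kn0.
  have t1 : nc (ev m1 q) < 1.
    rewrite qE; apply: half_lt1; first exact: g1le.
    by apply/eqP => /g1E /(fc _ Fm1); rewrite ltNge cm1.
  have N0 : 0 < nrm f + 1 by rewrite ltr_wpDl ?nrm_ge0.
  have [n hn] := small_pow (nc_ge0 _) t1 (divr_gt0 c0 N0).
  exists n => k nk m Fm; rewrite evM ncM evX ncX.
  have [cm|mc] := leP c (nc (ev m f)); last first.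
    by apply: le_lt_trans mc; rewrite ler_piMr ?nc_ge0// exprn_ile1 ?nc_ge0 ?qle.
  have Km : K m by [].
  rewrite ltr_pdivlMr// in hn; apply: le_lt_trans hn; rewrite mulrC.
  apply: ler_pM; rewrite ?nc_ge0 ?exprn_ge0 ?nc_ge0//.
    apply: (@le_trans _ _ (nc (ev m1 q) ^+ k)).
      by rewrite lerXn2r ?nnegrE ?nc_ge0// hm1.
    by rewrite ler_wiXn2l ?nc_ge0// ltW.
  by apply: le_trans (nc_ev_le _ _) _; rewrite lerDl.
have [n hn] : exists n, below F [seq (fc.1 * q ^+ n, fc.2) | fc <- s].
  suff [n hn] : exists n, forall k, (n <= k)%N -> below F [seq (fc.1 * q ^+ k, fc.2) | fc <- s].
    by exists n; exact: hn.
  elim: s sb => [|fc s ih] sb; first by exists 0%N => k _ fc.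
  have [|n1 h1] := ih; first by move=> d ds; apply: sb; rewrite inE ds orbT.
  have [m Fm gm|n2 h2] := qlt fc.1 fc.2.
    by apply: sb; [exact: mem_head|split].
  exists (maxn n1 n2) => k; rewrite geq_max => /andP[k1 k2] d /=.
  by rewrite inE => /predU1P[-> m Fm|ds]; [exact: h2|exact: (h1 k)].
have [u [us u1]] := hF _ e hn e0.
exists (q ^+ n * u); split=> [fc fs m|m [Fm gm]].
  have := us (fc.1 * q ^+ n, fc.2) (map_f _ fs) m.
  by rewrite /= !evM mulrA.
rewrite evM evX qE (_ : ev m g1 = 1); last exact/g1E.
by rewrite mulVf ?pnatr_eq0// expr1n mul1r u1.
Qed.

(** By compactness, a strict bound valid on the intersection is already valid on a member of the
    chain. *)
Lemma peak_set_chain (S : set (set M)) :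
  S !=set0 -> total_on S (fun F G => F `<=` G) -> (forall F, S F -> peak_set F) ->
  peak_set [set m | forall F, S F -> F m].
Proof.
move=> S0 tot pS.
have cS F : S F -> approx_closed F by case/pS.
split.
- move=> p h F SF; apply: cS => // s e e0.
  by have [m Sm hm] := h s e e0; exists m => //; exact: Sm.
- have [|m Sm _] := chain_fip S0 tot cS approx_closedT; last by exists m.
  by move=> F /pS[_ [m Fm] _]; exists m.
move=> s e sb e0.
have [F SF Fb] : exists2 F, S F & below F s.
  elim: s sb => [_|fc s ih sb]; first by have [F SF] := S0; exists F.
  have [|F SF Fb] := ih; first by move=> d ds; apply: sb; rewrite inE ds orbT.
  have [G SG Gb] : exists2 G, S G & forall m, G m -> nc (ev m fc.1) < fc.2.
    apply: contrapT => nG.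
    have [|m Sm /= mfc] := chain_fip S0 tot cS (@approx_closed_ge _ _ fc.1 fc.2).
      move=> G SG; apply: contrapT => nm; apply: nG; exists G => // m Gm.
      by rewrite ltNge; apply/negP => h; apply: nm; exists m.
    by have := sb fc (mem_head _ _) m Sm; rewrite ltNge mfc.
  have [FG|GF] := tot _ _ SF SG.
    exists F => // d; rewrite inE => /predU1P[-> m /FG/Gb//|/Fb h m Fm]; exact: h.
  exists G => // d; rewrite inE => /predU1P[-> m /Gb//|/Fb h m /GF Fm]; exact: h.
have [_ _ hF] := pS _ SF; have [u [us u1]] := hF _ e Fb e0.
by exists u; split=> // m Sm; apply: u1; exact: Sm.
Qed.

(** On a minimal peak set every [g] is constant by [peak_set_step], so elements vanishing at one of
    its points are small on all of it. *)
Lemma peak_set_point F0 : peak_set F0 -> exists2 m, F0 m & peak_point m.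
Proof.
move=> pF0; pose T := {F : set M | peak_set F /\ F `<=` F0}.
pose le (F G : T) := `[< sval G `<=` sval F >].
have t0 : T by exists F0; split.
have [||S Stot|[F [pF FF0]] Fmin] := @ZL_preorder T t0 le.
- by move=> t; apply/asboolP.
- by move=> a b c /asboolP h1 /asboolP h2; apply/asboolP; exact: subset_trans h1.
- have [[F1 SF1]|S0] := pselect (S !=set0); last first.
    by exists t0 => s Ss; exfalso; apply: S0; exists s.
  pose S' := [set sval F | F in S].
  have pS : peak_set [set m | forall F, S' F -> F m].
    apply: peak_set_chain; first by exists (sval F1), F1.
      move=> _ _ [F SF <-] [G SG <-].
      by have [/asboolP|/asboolP] := Stot _ _ SF SG; [right|left].
    by move=> _ [F _ <-]; case: (svalP F).
  have SF0 : [set m | forall F, S' F -> F m] `<=` F0.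
    move=> m Sm; have [_] := svalP F1; apply; apply: Sm; by exists F1.
  pose F2 : T := exist (fun F => peak_set F /\ F `<=` F0) _ (conj pS SF0).
  exists F2 => G SG; apply/asboolP => m; apply; by exists G.
have [cF Fn0 hF] := pF.
have cst g m1 m2 : F m1 -> F m2 -> ev m1 g = ev m2 g.
  move=> Fm1 Fm2; have [m0 Fm0 gmax] := approx_closed_max g cF Fn0.
  have pF' := peak_set_step pF Fm0 gmax.
  have F'0 : F `&` [set m | ev m g = ev m0 g] `<=` F0.
    by move=> m [Fm _]; exact: (FF0 m Fm).
  pose F2 : T := exist (fun F => peak_set F /\ F `<=` F0) _ (conj pF' F'0).
  have /asboolP FF' := Fmin F2 ltac:(by apply/asboolP => m []).
  by have [_ ->] := FF' _ Fm1; have [_ ->] := FF' _ Fm2.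
have [m0 Fm0] := Fn0; exists m0; first exact: (FF0 m0 Fm0).
(* The pair [(1, 1 + d)] bounds [|u|] by [1 + d]. Rescaling by [(1 + d)^-1] keeps
   [(1 - d) / (1 + d) >= 1 - e]. *)
move=> s e sx e0; pose d := Num.min (e / 2) 2^-1.
have d0 : 0 < d by rewrite lt_min divr_gt0// invr_gt0 ltr0n.
have de : d <= e / 2 by rewrite ge_min lexx.
have [|u [us u1]] := hF ((1, 1 + d) :: [seq (f, e) | f <- s]) d _ d0.
  move=> fc; rewrite inE => /predU1P[-> m Fm /=|/mapP[f fs ->] m Fm /=].
    by rewrite ev1 Normc.normc1; lra.
  by rewrite (cst _ _ _ Fm Fm0) sx// Normc.normc0.
pose t := (1 + d)^-1.
have t0' : 0 < t by rewrite invr_gt0; lra.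
have tE : t * (1 + d) = 1 by rewrite mulVf// gt_eqF//; lra.
have t1 : t <= 1 by nra.
have ntu m : nc (ev m (t%:C%C *: u)) = t * nc (ev m u).
  by rewrite evZ ncM ncR gtr0_norm.
exists (t%:C%C *: u); split.
- move=> m; rewrite ntu -tE ler_wpM2l ?(ltW t0')//.
  by have := us _ (mem_head _ _) m; rewrite /= ev1 mul1r.
- rewrite ntu; have := u1 _ Fm0; have := nc_tri 1 (ev m0 u).
  rewrite Normc.normc1 ncBC => h1 h2; nra.
move=> f fs m; have := us (f, e) _ m; rewrite inE (map_f (fun f => (f, e)) fs) orbT => /(_ isT) /= h.
rewrite evZ mulrCA ncM ncR gtr0_norm//.
by apply: le_trans h; rewrite ler_piMl// nc_ge0.
Qed.

(** The level set of [g] through a point of maximal modulus is a peak set. *)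
Lemma peak_boundary g : exists2 m, peak_point m & nc (ev m g) = r g.
Proof.
have [m0 m0g] := radius_attained g.
have [|m [_ /= mg] pm] := peak_set_point (peak_set_step peak_setT (I : setT m0) _ (g := g)).
  by move=> m _; rewrite m0g ev_le_radius.
by exists m => //; rewrite mg.
Qed.
End Boundary.

(** * Preserving relations *)

Section Radius.
Variables (R : realType) (A : comBanachAlgType R[i]).
Local Notation r := (@spectral_radius R A).
Implicit Types (x y : A).

Lemma radiusD x y : r (x + y) <= r x + r y.
Proof.
apply: radius_le => m; rewrite evD; apply: le_trans (ncD _ _) _.
by apply: lerD; exact: ev_le_radius.
Qed.

Lemma radiusN x : r (- x) = r x.
Proof.
have H z : r (- z) <= r z by apply: radius_le => m; rewrite evN ncN ev_le_radius.
by apply/eqP; rewrite eq_le H -{1}(opprK x) H.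
Qed.

Lemma radius1 : r 1 = 1.
Proof. by have [m <-] := radius_attained (1 : A); rewrite ev1 Normc.normc1. Qed.

Lemma radiusZ l x : r (l *: x) = nc l * r x.
Proof.
apply/eqP; rewrite eq_le; apply/andP; split.
  by apply: radius_le => m; rewrite evZ ncM ler_wpM2l ?nc_ge0 ?ev_le_radius.
by have [m <-] := radius_attained x; rewrite -ncM -evZ ev_le_radius.
Qed.

Lemma radius_eq0 x : r x = 0 -> forall m, ev m x = 0.
Proof.
by move=> x0 m; apply/eqP; rewrite -nc_eq0 eq_le nc_ge0 andbT -x0 ev_le_radius.
Qed.

Lemma radius_sub1 x : `|r (x - 1) - r x| <= 1.
Proof.
have := radiusD x (-1); have := radiusD (x - 1) 1.
by rewrite subrK radiusN radius1 ler_norml; lra.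
Qed.
End Radius.

Lemma archi_eq0 (R : realType) (x K : R) : (forall n : nat, n%:R * `|x| <= K) -> x = 0.
Proof.
move=> h; apply/eqP; rewrite -normr_eq0 eq_le normr_ge0 andbT leNgt; apply/negP => x0.
have K0 : 0 <= K by have := h 0%N; rewrite mul0r.
have := h (Num.bound (K / `|x|)); rewrite leNgt => /negP; apply.
by rewrite -ltr_pdivrMr//; apply: archi_boundP; rewrite divr_ge0.
Qed.

Lemma archi_le (R : realType) (x y K : R) : (forall s, 0 < s -> s * (x - y) <= K) -> x <= y.
Proof.
move=> h; rewrite leNgt; apply/negP => xy; have d0 : 0 < x - y by lra.
have K0 : 0 < `|K| + 1 by rewrite ltr_wpDl.
have := h _ (divr_gt0 K0 d0); rewrite divfK ?gt_eqF//.
by have := ler_norm K; lra.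
Qed.

Lemma bernoulli (R : realType) (e : R) n : 0 <= e -> e <= 1 -> 1 - n%:R * e <= (1 - e) ^+ n.
Proof.
move=> e0 e1; elim: n => [|n ih]; first by rewrite mul0r subr0 expr0.
rewrite exprS -natr1; apply: (@le_trans _ _ ((1 - e) * (1 - n%:R * e))).
  have : 0 <= n%:R * e * e by rewrite !mulr_ge0.
  by lra.
by apply: ler_wpM2l ih; lra.
Qed.

Section ApproxClosedUnion.
Variables (R : realType) (A : comBanachAlgType R[i]).
Local Notation M := (max_ideal_space A).

Lemma approx_closedU (F G : set M) :
  approx_closed F -> approx_closed G -> approx_closed (F `|` G).
Proof.
move=> cF cG p h; apply: contrapT => /not_orP[nF nG].
have [s1 [e1 [e10 n1]]] : exists (s1 : seq A) (e1 : R), 0 < e1 /\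
    forall m, F m -> ~ {in s1, forall f : A, nc (ev m f - ev p f) < e1}.
  apply: contrapT => n; apply: nF; apply: cF => s e e0; apply: contrapT => n'.
  by apply: n; exists s, e; split=> // m Fm hm; apply: n'; exists m.
have [s2 [e2 [e20 n2]]] : exists (s2 : seq A) (e2 : R), 0 < e2 /\
    forall m, G m -> ~ {in s2, forall f : A, nc (ev m f - ev p f) < e2}.
  apply: contrapT => n; apply: nG; apply: cG => s e e0; apply: contrapT => n'.
  by apply: n; exists s, e; split=> // m Gm hm; apply: n'; exists m.
have [|m FGm hm] := h (s1 ++ s2) (Num.min e1 e2); first by rewrite lt_min e10.
case: FGm => Hm; [apply: (n1 _ Hm)|apply: (n2 _ Hm)] => f fs.
  by have := hm f; rewrite mem_cat fs /= lt_min => /(_ isT)/andP[].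
by have := hm f; rewrite mem_cat fs orbT lt_min => /(_ isT)/andP[].
Qed.

Lemma approx_closed_has (s : seq A) (e : R) :
  approx_closed [set m : M | exists2 f, f \in s & e <= nc (ev m f)].
Proof.
elim: s => [|f s ih].
  rewrite (_ : mkset _ = set0); first by move=> p h; have [m] := h [::] 1 ltr01.
  by rewrite -subset0 => m [].
rewrite (_ : mkset _ = [set m | e <= nc (ev m f)] `|` [set m | exists2 f, f \in s & e <= nc (ev m f)]).
  by apply: approx_closedU => //; exact: approx_closed_ge.
apply/seteqP; split=> m /=.
  by move=> [g]; rewrite inE => /predU1P[->|gs h]; [left|right; exists g].
by move=> [h|[g gs h]]; [exists f; rewrite ?mem_head|exists g; rewrite ?inE ?gs ?orbT].
Qed.
End ApproxClosedUnion.

Section Relation.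
Variables (R : realType).
Implicit Types A B : comBanachAlgType R[i].

(** The hypothesis for [alpha = 1], as a symmetric notion on relations: [S] is not assumed
    injective, so its converse need not be a map. *)
Definition preserving A B (G : A -> B -> Prop) :=
  [/\ forall a, exists b, G a b, forall b, exists a, G a b &
   forall a b a' b', G a b -> G a' b' ->
     spectral_radius (b * b' - 1) = spectral_radius (a * a' - 1)].

Lemma preserving_sym A B (G : A -> B -> Prop) :
  preserving G -> preserving (fun b a => G a b).
Proof. by move=> [tot surj h]; split=> // b a b' a' ab ab'; rewrite (h a b a' b'). Qed.

Section Preserving.
Variables (A B : comBanachAlgType R[i]) (G : A -> B -> Prop).
Hypothesis PG : preserving G.
Let tot : forall a, exists b, G a b. Proof. by case: PG. Qed.
Let surj : forall b, exists a, G a b. Proof. by case: PG. Qed.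
Let pres a b a' b' : G a b -> G a' b' ->
  spectral_radius (b * b' - 1) = spectral_radius (a * a' - 1).
Proof. by case: PG => _ _; apply. Qed.
Local Notation r := spectral_radius.

Lemma preserving_near a b a' b' : G a b -> G a' b' -> `|r (b * b') - r (a * a')| <= 2.
Proof.
move=> ab ab'; have := radius_sub1 (b * b'); have := radius_sub1 (a * a').
by rewrite (pres ab ab') !ler_norml; lra.
Qed.

Lemma nc_nat n : nc (n%:R : R[i]) = n%:R.
Proof. by rewrite -(rmorph_nat (real_complex R)) ncR ger0_norm. Qed.

(* The products are preserved up to 2; scaling first the second factor and then
   the first one removes this error. *)
Lemma preserving_radiusM a b a' b' : G a b -> G a' b' -> r (b * b') = r (a * a').
Proof.
move=> ab ab'; apply/eqP; rewrite -subr_eq0; apply/eqP.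
apply: (@archi_eq0 _ _ 2) => n.
have [c nac] := tot ((n%:R : R[i]) *: a).
(* [c] behaves as [n b] in all products: the error [2 + 2 n] does not depend on the factor [k] put
   on [h]. *)
have cb h : r (c * h) = n%:R * r (b * h).
  apply/eqP; rewrite -subr_eq0; apply/eqP.
  apply: (@archi_eq0 _ _ (2 + n%:R * 2)) => k.
  have [g gkh] := surj ((k%:R : R[i]) *: h).
  have h1 := preserving_near nac gkh; have h2 := preserving_near ab gkh.
  rewrite -!scalerAr -?scalerAl !radiusZ !nc_nat in h1 h2.
  have h3 : n%:R * `|k%:R * r (b * h) - r (a * g)| <= n%:R * 2 by rewrite ler_wpM2l.
  rewrite -[k%:R in X in X <= _](@ger0_norm R)// -normrM.
  have -> : k%:R * (r (c * h) - n%:R * r (b * h)) =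
     (k%:R * r (c * h) - n%:R * r (a * g)) - n%:R * (k%:R * r (b * h) - r (a * g)) by ring.
  apply: le_trans (ler_normB _ _) _; apply: lerD => //.
  by rewrite normrM (@ger0_norm _ n%:R).
have := preserving_near nac ab'; rewrite cb -scalerAl radiusZ nc_nat -mulrBr normrM.
by rewrite (@ger0_norm _ n%:R).
Qed.

(** The right-hand side of the relation is the radius of 0, so [b b' - 1] vanishes on characters. *)
Lemma preserving_inv a b a' b' m : G a b -> G a' b' -> a * a' = 1 -> ev m b * ev m b' = 1.
Proof.
move=> ab ab' aa'; have := pres ab ab'; rewrite aa' subrr.
have -> : r (0 : A) = 0 by rewrite -(scale0r (0 : A)) radiusZ Normc.normc0 mul0r.
by move=> /radius_eq0/(_ m); rewrite evB evM ev1 => /eqP; rewrite subr_eq0 => /eqP.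
Qed.

(** An element related to 1 squares to 1 on characters, so multiplication by it preserves moduli. *)
Lemma preserving_radius a b : G a b -> r b = r a.
Proof.
move=> ab; have [e oe] := tot 1.
have e1 m : nc (ev m e) = 1.
  have := congr1 (@Normc.normc R) (preserving_inv m oe oe (mulr1 1)).
  rewrite ncM Normc.normc1 => /eqP; rewrite -expr2 sqrf_eq1 => /orP[/eqP//|/eqP h].
  by have := nc_ge0 (ev m e); rewrite h; lra.
have be m : nc (ev m (b * e)) = nc (ev m b) by rewrite evM ncM e1 mulr1.
rewrite -[a]mulr1 -(preserving_radiusM ab oe).
apply/eqP; rewrite eq_le; apply/andP; split; apply: radius_le => m.
  by rewrite -be ev_le_radius.
by rewrite be ev_le_radius.
Qed.

Definition dominated (x : max_ideal_space A) (y : max_ideal_space B) :=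
  forall a b, G a b -> nc (ev y b) <= nc (ev x a).

(** The slack [i.2] allows approximation on finite families. Triples that are unrelated or have no
    positive slack impose no condition, so that all triples can serve as indices. *)
Definition almost x (i : A * B * R) : set (max_ideal_space B) :=
  [set y | G i.1.1 i.1.2 -> 0 < i.2 -> nc (ev y i.1.2) <= nc (ev x i.1.1) + i.2].

Lemma almost_closed x i : approx_closed (almost x i).
Proof.
move=> p h Gi i0; apply: (approx_closed_le (c := nc (ev x i.1.1) + i.2)) => s e e0.
by have [m hm sm] := h s e e0; exists m => //; exact: hm.
Qed.

Lemma almost_dominated x y : (forall i, almost x i y) -> dominated x y.
Proof.
move=> h a b ab; apply/ler_addgt0Pr => e e0; exact: (h (a, b, e)).
Qed.

Lemma min_gap (s : seq (A * B * R)) :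
  exists2 d : R, 0 < d & {in s, forall i, 0 < i.2 -> d <= i.2}.
Proof.
elim: s => [|i s [d d0 ih]]; first by exists 1.
have [i0|i0] := leP i.2 0.
  by exists d => // j; rewrite inE => /predU1P[->|/ih//]; rewrite ltNge i0.
exists (Num.min d i.2); first by rewrite lt_min d0.
move=> j; rewrite inE => /predU1P[-> _|/ih h /h h']; first by rewrite ge_min lexx orbT.
by rewrite ge_min h'.
Qed.

Lemma max_value x (s : seq (A * B * R)) :
  exists2 C : R, 0 <= C & {in s, forall i, nc (ev x i.1.1) <= C}.
Proof.
have [N N0 hN] := radius_bound [seq i.1.1 | i <- s].
by exists N; [exact: ltW|move=> i si; apply: hN; exact: map_f].
Qed.

Definition centered x (s : seq (A * B * R)) : seq A :=
  [seq i.1.1 - (ev x i.1.1)%:A | i <- s].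

Lemma centered0 x s : {in centered x s, forall f, ev x f = 0}.
Proof. by move=> _ /mapP[i _ ->]; rewrite evB evC subrr. Qed.

Lemma centered_radius x s (u : A) (e : R) i : (forall m, nc (ev m u) <= 1) ->
  {in centered x s, forall f m, nc (ev m f * ev m u) <= e} -> i \in s ->
  r (i.1.1 * u) <= nc (ev x i.1.1) + e.
Proof.
move=> u1 us si; apply: radius_le => m.
have := us _ (map_f _ si) m; rewrite evB evC evM => h.
rewrite (_ : _ * _ = ev x i.1.1 * ev m u + (ev m i.1.1 - ev x i.1.1) * ev m u); last by ring.
apply: le_trans (ncD _ _) _; apply: lerD => //.
by rewrite ncM ler_piMr ?nc_ge0.
Qed.

(** For finitely many triples, take [u] peaking at [x] and a point [y] where its image [w] has
    maximal modulus, at least [1 - e]: then [|b(y)| (1 - e) <= r (b w) = r (a u) <= |a(x)| + e].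
    Compactness handles all triples at once. *)
Lemma exists_dominated x : peak_point x -> exists y, dominated x y.
Proof.
move=> px; have [i|s|y hy] := character_fip (F := almost x).
- exact: almost_closed.
- have [d d0 sd] := min_gap s; have [C C0 sC] := max_value x s.
  have c0 : 0 < 1 + C + d by lra.
  pose e := d / (1 + C + d).
  have e0 : 0 < e by rewrite divr_gt0.
  have eE : e * (1 + C + d) = d by rewrite /e divfK// gt_eqF.
  have [u [u1 ux us]] := px _ e (@centered0 x s) e0.
  have [w uw] := tot u.
  have [y yw] := radius_attained w.
  have rw : 1 - e <= nc (ev y w).
    by rewrite yw (preserving_radius uw); apply: le_trans ux (ev_le_radius _ _).
  exists y => i si Gi i0.
  have h1 := centered_radius u1 us si.
  have h2 := ev_le_radius y (i.1.2 * w).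
  rewrite (preserving_radiusM Gi uw) evM ncM in h2.
  have h3 := sd _ si i0; have h4 := sC _ si.
  have e1 : e < 1 by nra.
  have h5 : nc (ev y i.1.2) * (1 - e) <= nc (ev x i.1.1) + e.
    by apply: le_trans (le_trans h2 h1); rewrite ler_wpM2l ?nc_ge0.
  have h6 : nc (ev x i.1.1) + e <= (nc (ev x i.1.1) + d) * (1 - e) by nra.
  have := le_trans h5 h6; rewrite ler_pM2r; [lra|lra].
by exists y; exact: almost_dominated.
Qed.

(** Domination holds for [a] and for its inverse, and the products of the moduli on both sides are
    1. *)
Lemma dominated_inv x y a b a' : dominated x y -> G a b -> a * a' = 1 ->
  nc (ev y b) = nc (ev x a).
Proof.
move=> dom ab aa'; have [b' ab'] := tot a'.
have h1 := dom _ _ ab; have h2 := dom _ _ ab'.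
have h3 := congr1 (@Normc.normc R) (preserving_inv y ab ab' aa').
have h4 := congr1 (fun z => nc (ev x z)) aa'.
rewrite evM ev1 !ncM Normc.normc1 in h3 h4.
apply/eqP; rewrite eq_le h1 /=.
have x0 : 0 <= nc (ev x a') := nc_ge0 _; have y0 : 0 <= nc (ev y b) := nc_ge0 _.
have h5 : nc (ev y b) * nc (ev y b') <= nc (ev y b) * nc (ev x a') by rewrite ler_wpM2l.
have x1 : 0 < nc (ev x a').
  rewrite lt_def x0 andbT; apply/eqP => z0; move: h4; rewrite z0 mulr0; lra.
by rewrite -(ler_pM2r x1) h4 -h3.
Qed.

(** Invertible elements have equal moduli at [y] and [y']. For [N > r b] this applies to [b + N w]
    with [w] a fourth root of unity, and these moduli determine the value of [b]. *)
Lemma dominated_uniq x y y' : dominated x y -> dominated x y' ->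
  forall b, ev y b = ev y' b.
Proof.
move=> dy dy' b.
have eqn c : (forall m : max_ideal_space B, ev m (b + c%:A) <> 0) ->
    nc (ev y b + c) = nc (ev y' b + c).
  move=> /character_invertible[b' bb'].
  have [a ab] := surj (b + c%:A); have [a' ab'] := surj b'.
  have inv m : ev m a * ev m a' = 1.
    have := pres ab ab'; rewrite bb' subrr.
    have -> : r (0 : B) = 0 by rewrite -(scale0r (0 : B)) radiusZ Normc.normc0 mul0r.
    by move=> /esym/radius_eq0/(_ m); rewrite evB evM ev1 => /eqP; rewrite subr_eq0 => /eqP.
  have [|a'' aa''] := @character_invertible _ _ a.
    move=> m a0; have := inv m; rewrite a0 mul0r => /esym/eqP; by rewrite oner_eq0.
  have := dominated_inv dy ab aa''; have := dominated_inv dy' ab aa''.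
  by rewrite !evD !evC => -> ->.
pose N := r b + 1; have N0 : 0 < N by rewrite ltr_wpDl ?radius_ge0.
have {}eqn w : nc w = 1 -> nc (ev y b + N%:C%C * w) = nc (ev y' b + N%:C%C * w).
  move=> w1; apply: eqn => m; rewrite evD evC => /eqP; rewrite addr_eq0 => /eqP h.
  have := ev_le_radius m b; rewrite h ncN ncM w1 mulr1 ncR gtr0_norm// /N; lra.
have sq w : nc w = 1 -> nc (ev y b + N%:C%C * w) ^+ 2 = nc (ev y' b + N%:C%C * w) ^+ 2.
  by move=> /eqn ->.
have h1 := sq 1 (Normc.normc1 _).
have h2 := sq (-1) ltac:(by rewrite ncN Normc.normc1).
have h3 := sq 'i%C (nc_i _).
have h4 := sq (- 'i%C) ltac:(by rewrite ncN nc_i).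
rewrite !sqr_nc !cReD !cImD !cReM !cImM ?cReN ?cImN /= in h1 h2 h3 h4.
apply/eqP; rewrite eq_complex; apply/andP; split; apply/eqP.
  apply: (mulfI (lt0r_neq0 N0)); lra.
apply: (mulfI (lt0r_neq0 N0)); lra.
Qed.

(* Outside a neighbourhood of [y] some [b] in a finite family is larger than at [y],
   which forces the images of peaking elements at [x] to be uniformly below 1 there,
   so that their powers peak at [y]. *)
Lemma dominated_peak x y : peak_point x -> dominated x y -> peak_point y.
Proof.
move=> px dy hs e hy e0.
pose K := [set z : max_ideal_space B | exists2 h, h \in hs & e <= nc (ev z h)].
(* Otherwise compactness gives a dominated point of [K]; it agrees with [y], where the elements of
   [hs] vanish. *)
have [s hs_small] : exists s : seq (A * B * R), forall z,
    {in s, forall i, almost x i z} -> ~ K z.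
  apply: contrapT => n.
  have [i|s|z hz] := character_fip (F := fun i => almost x i `&` K).
  - by apply: approx_closedI; [exact: almost_closed|exact: approx_closed_has].
  - apply: contrapT => n'; apply: n; exists s => z hz Kz.
    by apply: n'; exists z => i /hz.
  have [_ [h hhs]] := hz (0, 0, 0).
  have dz : dominated x z by apply: almost_dominated => i; have [] := hz i.
  by rewrite (dominated_uniq dz dy) hy// Normc.normc0 leNgt e0.
have [d d0 sd] := min_gap s; have [C C0 sC] := max_value x s.
have [N N0 hN] := radius_bound hs.
(* If [|b(z)|] exceeds [|a(x)| + d], then [(|a(x)| + d) |w(z)| <= |a(x)| + d / 2], and [|a(x)| <= C]
   gives [|w(z)| <= t]. *)
pose t := (C + d / 2) / (C + d).
have Cd : 0 < C + d by lra.
have tE : t * (C + d) = C + d / 2 by rewrite /t divfK// gt_eqF.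
have t0 : 0 <= t by rewrite divr_ge0//; lra.
have t1 : t < 1 by rewrite ltr_pdivrMr//; lra.
have [n hn] := small_pow t0 t1 (divr_gt0 e0 N0).
rewrite ltr_pdivlMr// in hn.
have n1 : 0 < n%:R + 1 :> R by rewrite ltr_wpDl.
(* [n] is fixed by [t ^+ n * N < e]; then [n c <= e] and Bernoulli's inequality keep
   [(1 - c) ^+ n >= 1 - e] at [y]. *)
pose c := Num.min (Num.min (d / 2) 1) (e / (n%:R + 1)).
have c0 : 0 < c by rewrite !lt_min ltr01 !divr_gt0.
have cd : c <= d / 2 by rewrite !ge_min lexx.
have c1 : c <= 1 by rewrite !ge_min lexx orbT.
have cn : n%:R * c <= e.
  have h : c <= e / (n%:R + 1) by rewrite !ge_min lexx orbT.
  rewrite ler_pdivlMr// in h; lra.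
have [v [[v' vv'] vD vx vs]] := peak_point_half_disc px (@centered0 x s) c0.
have v1 m : nc (ev m v) <= 1.
  have := nc_tri (ev m v) 2^-1; have := vD m.
  have -> : nc (2^-1 : R[i]) = 2^-1 by rewrite ncV nc_nat.
  lra.
have [w vw] := tot v.
have w1 z : nc (ev z w) <= 1.
  apply: le_trans (ev_le_radius _ _) _; rewrite (preserving_radius vw).
  exact: radius_le.
exists (w ^+ n); split.
- by move=> z; rewrite evX ncX exprn_ile1 ?nc_ge0.
- rewrite evX ncX (dominated_inv dy vw vv').
  have h : 1 - c <= nc (ev x v).
    by have := nc_tri 1 (ev x v); rewrite Normc.normc1; lra.
  apply: le_trans (_ : (1 - c) ^+ n <= _).
    by apply: le_trans (bernoulli n (ltW c0) c1); lra.
  by rewrite lerXn2r ?nnegrE ?nc_ge0//; lra.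
move=> h hhs z; rewrite ncM evX ncX.
have [small|big] := ltP (nc (ev z h)) e.
  apply: le_trans (ltW small); rewrite ler_piMr ?nc_ge0//.
  by rewrite exprn_ile1 ?nc_ge0.
have [i [si Gi i0 zi]] : exists i, [/\ i \in s, G i.1.1 i.1.2, 0 < i.2 &
    nc (ev x i.1.1) + i.2 < nc (ev z i.1.2)].
  apply: contrapT => n'; apply: (hs_small z); last by exists h.
  move=> i si Gi i0; rewrite leNgt; apply/negP => zi; apply: n'; by exists i.
have h1 := centered_radius v1 vs si.
have h2 := ev_le_radius z (i.1.2 * w).
rewrite (preserving_radiusM Gi vw) evM ncM in h2.
have h3 := sd _ si i0; have h4 := sC _ si.
have x0 := nc_ge0 (ev x i.1.1); have z0 := nc_ge0 (ev z w).
have h5 : (nc (ev x i.1.1) + d) * nc (ev z w) <= nc (ev x i.1.1) + d / 2.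
  apply: (@le_trans _ _ (nc (ev z i.1.2) * nc (ev z w))).
    by rewrite ler_wpM2r//; lra.
  by apply: le_trans (le_trans h2 h1) _; lra.
have zt : nc (ev z w) <= t.
  have h6 : nc (ev x i.1.1) + d / 2 <= t * (nc (ev x i.1.1) + d).
    have h7 : 0 <= (1 - t) * (C - nc (ev x i.1.1)) by apply: mulr_ge0; lra.
    lra.
  have := le_trans h5 h6; rewrite mulrC ler_pM2r; lra.
apply: le_trans (ltW hn); rewrite mulrC; apply: ler_pM; rewrite ?exprn_ge0 ?nc_ge0//.
  by rewrite lerXn2r ?nnegrE.
exact: hN.
Qed.

Definition matched (x : max_ideal_space A) (y : max_ideal_space B) :=
  forall a b, G a b -> nc (ev y b) = nc (ev x a).

(** For [v] peaking at [y] and [g] related to it, [|v(y)| <= |g(x)|], so [|a(x)| (1 - e) <= r (a g)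
    = r (b v) <= |b(y)| + e]. *)
Lemma dominated_matched x y : peak_point x -> dominated x y -> matched x y.
Proof.
move=> px dy a b ab; have py := dominated_peak px dy.
apply/eqP; rewrite eq_le dy//=.
have main e : 0 < e -> nc (ev x a) * (1 - e) <= nc (ev y b) + e.
  move=> e0; have [|v [v1 vy vs]] := py [:: b - (ev y b)%:A] e _ e0.
    by move=> _ /[1!inE] /eqP ->; rewrite evB evC subrr.
  have [g gv] := surj v.
  have h1 := dy _ _ gv.
  have h2 := ev_le_radius x (a * g); rewrite -(preserving_radiusM ab gv) evM ncM in h2.
  have h3 : r (b * v) <= nc (ev y b) + e.
    apply: radius_le => m; have := vs _ (mem_head _ _) m; rewrite evB evC evM => h.
    rewrite (_ : _ * _ = ev y b * ev m v + (ev m b - ev y b) * ev m v); last by ring.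
    apply: le_trans (ncD _ _) _; apply: lerD => //.
    by rewrite ncM ler_piMr ?nc_ge0.
  apply: le_trans (le_trans h2 h3); rewrite ler_wpM2l ?nc_ge0//.
  exact: le_trans vy h1.
apply/ler_addgt0Pr => e e0.
have n1 : 0 < nc (ev x a) + 1 by rewrite ltr_wpDl ?nc_ge0.
have := main _ (divr_gt0 e0 n1).
have : e / (nc (ev x a) + 1) * (nc (ev x a) + 1) = e by rewrite divfK// gt_eqF.
lra.
Qed.

Lemma exists_matched x : peak_point x -> exists2 y, peak_point y & matched x y.
Proof.
move=> px; have [y dy] := exists_dominated px.
by exists y; [exact: dominated_peak dy|exact: dominated_matched].
Qed.

(** An image of [a - a(x)] vanishes at [y], so [a - a(x)] vanishes at [x']. *)
Lemma matched_inj x x' y : matched x y -> matched x' y -> forall a, ev x a = ev x' a.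
Proof.
move=> xy x'y a; have [b ab] := tot (a - (ev x a)%:A).
have := xy _ _ ab; rewrite (x'y _ _ ab) !evB !evC subrr Normc.normc0.
by move=> /Normc.eq0_normc/eqP; rewrite subr_eq0 => /eqP.
Qed.
End Preserving.
End Relation.

(** * The phase *)

Section Phase.
Variable R : realType.
Implicit Types (z w : R[i]).

Definition dot z w : R := complex.Re z * complex.Re w + complex.Im z * complex.Im w.

Lemma dot1 z : dot 1 z = complex.Re z.
Proof. by rewrite /dot /= mul1r mul0r addr0. Qed.

Lemma doti z : dot 'i%C z = complex.Im z.
Proof. by rewrite /dot /= mul1r mul0r add0r. Qed.

Lemma dot_le z w : `|dot z w| <= nc z * nc w.
Proof.
have -> : dot z w = complex.Re (z * conjc w).
  by rewrite cReM /dot; case: w => c d /=; ring.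
have -> : nc w = nc (conjc w) by case: w => c d; rewrite /= sqrrN.
by rewrite -ncM nc_Re.
Qed.

(** Square both sides and bound the right one by twice the sum of squares: the terms in [s ^+ 2]
    cancel because the moduli agree, and [2 s (Re z - Re w) <= 1] remains. *)
Lemma Re_le_of_asymptotic z w : nc z = nc w ->
  (forall s : R, 0 < s -> nc (1 + s%:C%C * z) <= nc (1 + (s / 2)%:C%C * w) + s / 2 * nc w) ->
  complex.Re z <= complex.Re w.
Proof.
move=> zw h; apply: (@archi_le _ _ _ 1) => s s0.
have nw := nc_ge0 w; have P0 := nc_ge0 (1 + (s / 2)%:C%C * w).
have h1 := h s s0.
have q0 : 0 <= s / 2 * nc w by rewrite mulr_ge0//; lra.
have h2 : nc (1 + s%:C%C * z) ^+ 2 <= (nc (1 + (s / 2)%:C%C * w) + s / 2 * nc w) ^+ 2.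
  by rewrite lerXn2r ?nnegrE ?nc_ge0 ?addr_ge0.
have h3 := sqr_ge0 (nc (1 + (s / 2)%:C%C * w) - s / 2 * nc w).
have e1 : nc (1 + s%:C%C * z) ^+ 2 = 1 + 2 * s * complex.Re z + s ^+ 2 * nc w ^+ 2.
  by rewrite -zw !sqr_nc !cReD !cImD !cReM !cImM /=; ring.
have e2 : nc (1 + (s / 2)%:C%C * w) ^+ 2 = 1 + s * complex.Re w + s ^+ 2 / 4 * nc w ^+ 2.
  by rewrite !sqr_nc !cReD !cImD !cReM !cImM /=; field.
move: h2 h3; rewrite e1 sqrrD sqrrB e2 exprMn; lra.
Qed.

(** A quantitative form of the fact that [- s] is the only point of the disc at distance [1 + s]
    from 1. *)
Lemma near_extremal z (s e : R) : 0 <= s -> e <= 1 + s -> nc z <= s ->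
  1 + s - e <= nc (z - 1) -> nc (z + s%:C%C) ^+ 2 <= 2 * s * (1 + s) * e.
Proof.
move=> s0 es zs h.
have z0 := nc_ge0 z.
have h2 : (1 + s - e) ^+ 2 <= nc (z - 1) ^+ 2 by rewrite lerXn2r ?nnegrE ?nc_ge0//; lra.
have h3 : nc z ^+ 2 <= s ^+ 2 by rewrite lerXn2r ?nnegrE.
have e1 : nc (z - 1) ^+ 2 = nc z ^+ 2 - 2 * complex.Re z + 1.
  by rewrite !sqr_nc !cReD !cImD !cReN !cImN /=; ring.
have e2 : nc (z + s%:C%C) ^+ 2 = nc z ^+ 2 + 2 * s * complex.Re z + s ^+ 2.
  by rewrite !sqr_nc !cReD !cImD /=; ring.
rewrite e2; rewrite e1 in h2.
have : s * ((1 + s - e) ^+ 2) <= s * (nc z ^+ 2 - 2 * complex.Re z + 1) by rewrite ler_wpM2l.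
have : s * nc z ^+ 2 <= s * s ^+ 2 by rewrite ler_wpM2l.
have : 0 <= s * e ^+ 2 by rewrite mulr_ge0 ?sqr_ge0.
lra.
Qed.
End Phase.

Section MatchedPhase.
Variables (R : realType) (A B : comBanachAlgType R[i]) (G : A -> B -> Prop).
Hypothesis PG : preserving G.
Local Notation r := spectral_radius.

(* The image of [g] is [- (s / b(y)) v] with [v] peaking at [y], so that [a g] is
   close to [- s] at some point [w]; comparing [a' g - 1] at [w] with its image
   gives the inequality. *)
Lemma matched_phase_ineq x y a b a' b' (s d : R) : peak_point y -> matched G x y ->
  G a b -> G a' b' -> ev x a != 0 -> 0 < s -> 0 < d ->
  nc (1 + s%:C%C * (ev x a' / ev x a)) <=
  nc (1 + (s / 2)%:C%C * (ev y b' / ev y b)) + s / 2 * nc (ev y b' / ev y b) + d.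
Proof.
move=> py xy ab ab'; have nab := xy _ _ ab; have nab' := xy _ _ ab'.
move: nab nab'; set a0 := ev x a; set b0 := ev y b; set a1 := ev x a'; set b1 := ev y b'.
move=> nab nab' a0n s0 d0.
have [tot surj _] := PG.
(* [k] and [k'] vanish at [y], so [v] can flatten them. Then [(a - a0) g] and [(a' - a1) g] are
   small everywhere: where [g] is large, [a] and [a'] are nearly constant. *)
have [k kP] := tot (a - a0%:A); have [k' kP'] := tot (a' - a1%:A).
have yk : ev y k = 0 by apply: Normc.eq0_normc; rewrite (xy _ _ kP) evB evC subrr Normc.normc0.
have yk' : ev y k' = 0 by apply: Normc.eq0_normc; rewrite (xy _ _ kP') evB evC subrr Normc.normc0.
have n0 : 0 < nc a0 by rewrite nc_gt0.
have b0n : b0 != 0 by rewrite -nc_gt0 nab.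
set z := a1 / a0; set z' := b1 / b0.
have nz : nc z = nc z' by rewrite !ncM !ncV nab nab'.
have zn := nc_ge0 z.
have tu : 0 < d / 2 / (nc z + 1) by rewrite !divr_gt0//; lra.
set tau := d / 2 / (nc z + 1) in tu.
have tauE : tau * (nc z + 1) = d / 2 by rewrite /tau divfK// gt_eqF//; lra.
pose i0 := (nc a0)^-1.
have i00 : 0 < i0 by rewrite invr_gt0.
pose c1 := 2 * s * i0; pose c2 := 2 * s * (1 + s) * s * (1 + i0).
have c10 : 0 < c1 by rewrite !mulr_gt0.
have c30 : 0 < 1 + i0 by lra.
have s1 : 0 < 1 + s by lra.
have c20 : 0 < c2 by rewrite /c2 !mulr_gt0.
(* The first bound pays for two errors [s i0 e], the second gives [|a0 g(w) + s| <= tau] through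
   [near_extremal], and the third is its side condition. *)
pose e := Num.min (Num.min (d / 2 / c1) (tau ^+ 2 / c2)) (1 + i0)^-1.
have e0 : 0 < e.
  have d2 : 0 < d / 2 by rewrite divr_gt0.
  by rewrite !lt_min (divr_gt0 d2 c10) (divr_gt0 _ c20) ?exprn_gt0 ?invr_gt0 ?c30.
have e1 : e * c1 <= d / 2 by rewrite -ler_pdivlMr// !ge_min lexx.
have e2 : e * c2 <= tau ^+ 2 by rewrite -ler_pdivlMr// !ge_min lexx orbT.
have e3 : e * (1 + i0) <= 1 by rewrite -ler_pdivlMr// div1r !ge_min lexx !orbT.
have [|v [_ vD vy vs]] := peak_point_half_disc py (s := [:: k; k'; b' - b1%:A]) _ e0.
  by move=> f; rewrite !inE => /or3P[] /eqP->//; rewrite evB evC subrr.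
have v1 m : nc (ev m v) <= 1.
  have := nc_tri (ev m v) 2^-1; have := vD m.
  have -> : nc (2^-1 : R[i]) = 2^-1 by rewrite ncV nc_nat.
  lra.
pose c := - (s%:C%C / b0).
have ncc : nc c = s * i0 by rewrite ncN ncM ncV ncR gtr0_norm// nab.
have [g gP] := surj (c *: v).
have rg : r g <= s * i0.
  rewrite -(preserving_radius PG gP) radiusZ ncc ler_piMr//; last exact: radius_le.
  by rewrite mulr_ge0// ltW.
have vsc f m : f \in [:: k; k'; b' - b1%:A] -> nc (ev m (f * (c *: v))) <= s * i0 * e.
  move=> fs; rewrite evM evZ mulrCA ncM ncc ler_wpM2l//; first by rewrite mulr_ge0// ltW.
  exact: vs.
have rk h (k0 : B) (h0 : R[i]) : k0 \in [:: k; k'; b' - b1%:A] -> G (h - h0%:A) k0 ->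
    forall m, nc ((ev m h - h0) * ev m g) <= s * i0 * e.
  move=> ks hk m; apply: le_trans (_ : r ((h - h0%:A) * g) <= _).
    by apply: le_trans (ev_le_radius m _); rewrite evM evB evC.
  rewrite -(preserving_radiusM PG hk gP); apply: radius_le => m'; exact: vsc.
have rka := rk a k a0 (mem_head _ _) kP.
have rka' := rk a' k' a1 ltac:(by rewrite !inE eqxx orbT) kP'.
have [_ _ pres] := PG.
have [w wE] := radius_attained (a * g - 1).
(* At [y], the image of [a g - 1] is within [s e] of [- (1 + s)]. *)
have low : 1 + s - s * e <= nc (ev w (a * g - 1)).
  rewrite wE -(pres _ _ _ _ ab gP); apply: le_trans (ev_le_radius y _).
  rewrite evB evM evZ ev1 -/b0.
  have -> : b0 * (c * ev y v) - 1 = - ((1 + s)%:C%C - s%:C%C * (1 - ev y v)).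
    by rewrite /c -rcD -rc1; field.
  rewrite ncN; have := nc_tri (1 + s)%:C%C ((1 + s)%:C%C - s%:C%C * (1 - ev y v)).
  rewrite subKr ncM !ncR (gtr0_norm s0) gtr0_norm; last by lra.
  have : s * nc (1 - ev y v) <= s * e by rewrite ler_wpM2l// ltW.
  lra.
have pE : ev w (a * g - 1) = (a0 * ev w g - 1) + (ev w a - a0) * ev w g.
  by rewrite evB evM ev1; ring.
have ps : nc (a0 * ev w g) <= s.
  rewrite ncM; apply: (@le_trans _ _ (nc a0 * (s * i0))).
    by rewrite ler_wpM2l ?nc_ge0// (le_trans (ev_le_radius w g)).
  by rewrite mulrCA /i0 mulfV ?mulr1// gt_eqF.
have p1 : 1 + s - s * (e * (1 + i0)) <= nc (a0 * ev w g - 1).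
  have := ncD (a0 * ev w g - 1) ((ev w a - a0) * ev w g); rewrite -pE.
  have := rka w; lra.
have p2 : nc (a0 * ev w g + s%:C%C) <= tau.
  rewrite -ler_sqr ?nnegrE ?nc_ge0 ?(ltW tu)//.
  apply: le_trans (near_extremal (ltW s0) _ ps p1) _; first by nra.
  by apply: le_trans e2; rewrite /c2; lra.
(* [z a0 = a1], and the last two terms are small. *)
have E1 : 1 + s%:C%C * z = - (ev w (a' * g - 1)) + (ev w a' - a1) * ev w g
    + z * (a0 * ev w g + s%:C%C).
  by rewrite evB evM ev1 /z; field.
have up : nc (ev w (a' * g - 1)) <= nc (1 + (s / 2)%:C%C * z') + s / 2 * nc z' + s * i0 * e.
  apply: le_trans (ev_le_radius w _) _; rewrite -(pres _ _ _ _ ab' gP); apply: radius_le => m.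
  (* Writing [v] as 1/2 plus a term bounded by 1/2 produces the two terms in [s / 2] of the
     statement. *)
  have -> : ev m (b' * (c *: v) - 1) = ev m ((b' - b1%:A) * (c *: v))
      - ((1 + (s / 2)%:C%C * z') + s%:C%C * z' * (ev m v - 2^-1)).
    have -> : (s / 2)%:C%C = s%:C%C * 2^-1 :> R[i].
      by rewrite -rcM -rcV (rmorph_nat (real_complex R)).
    by rewrite !evB !evM !evB !evZ ev1 mulr1 /z' /c; field.
  have h1 : nc (ev m ((b' - b1%:A) * (c *: v))) <= s * i0 * e.
    by apply: vsc; rewrite !inE eqxx !orbT.
  have h2 := ncB (ev m ((b' - b1%:A) * (c *: v)))
    ((1 + (s / 2)%:C%C * z') + s%:C%C * z' * (ev m v - 2^-1)).
  have h3 := ncD (1 + (s / 2)%:C%C * z') (s%:C%C * z' * (ev m v - 2^-1)).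
  have h4 : nc (s%:C%C * z' * (ev m v - 2^-1)) <= s / 2 * nc z'.
    rewrite !ncM ncR gtr0_norm// [s / 2 * _]mulrAC ler_wpM2l ?mulr_ge0 ?nc_ge0 ?(ltW s0)//.
  lra.
rewrite E1.
have h1 := ncD (- (ev w (a' * g - 1)) + (ev w a' - a1) * ev w g) (z * (a0 * ev w g + s%:C%C)).
have h2 := ncD (- (ev w (a' * g - 1))) ((ev w a' - a1) * ev w g).
rewrite ncN in h2; have h3 := rka' w.
have h4 : nc (z * (a0 * ev w g + s%:C%C)) <= nc z * tau by rewrite ncM ler_wpM2l.
have h5 : nc z * tau <= d / 2 by lra.
rewrite /c1 in e1; lra.
Qed.

Lemma matched_dot_le x y a b a' b' : peak_point y -> matched G x y ->
  G a b -> G a' b' -> dot (ev x a) (ev x a') <= dot (ev y b) (ev y b').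
Proof.
move=> py xy ab ab'; have nab := xy _ _ ab; have nab' := xy _ _ ab'.
have [a0|a0] := eqVneq (ev x a) 0.
  have b0 : ev y b = 0 by apply: Normc.eq0_normc; rewrite nab a0 Normc.normc0.
  by rewrite a0 b0 /dot /= !mul0r.
have b0 : ev y b != 0 by rewrite -nc_gt0 nab nc_gt0.
have : complex.Re (ev x a' / ev x a) <= complex.Re (ev y b' / ev y b).
  apply: Re_le_of_asymptotic; first by rewrite !ncM !ncV nab nab'.
  move=> s s0; apply/ler_addgt0Pr => d d0.
  exact: (matched_phase_ineq py xy ab ab' a0 s0 d0).
have dotE (z w : R[i]) : z != 0 -> dot z w = nc z ^+ 2 * complex.Re (w / z).
  move=> z0; rewrite -{1}(divfK z0 w) sqr_nc; move: (w / z) => u.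
  by rewrite /dot cReM cImM; ring.
by rewrite !dotE// nab ler_pM2l// exprn_gt0// nc_gt0.
Qed.
End MatchedPhase.

Lemma matched_dot (R : realType) (A B : comBanachAlgType R[i]) (G : A -> B -> Prop)
    x y a b a' b' : preserving G -> peak_point x -> peak_point y -> matched G x y ->
  G a b -> G a' b' -> dot (ev x a) (ev x a') = dot (ev y b) (ev y b').
Proof.
move=> PG px py xy ab ab'; apply/eqP; rewrite eq_le (matched_dot_le PG py xy)//=.
apply: (matched_dot_le (preserving_sym PG) px _ ab ab') => b1 a1 ba1.
by rewrite (xy _ _ ba1).
Qed.

(** * The form of the relation and the homeomorphism *)

Section Matching.
Variables (R : realType) (A B : comBanachAlgType R[i]) (G : A -> B -> Prop).
Hypothesis PG : preserving G.
Local Notation C := (R[i]^o).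

(** The real and imaginary parts of [a(x)] are the inner products of [b(y)] with [e(y) = 1] or [- 1]
    and with [u(y)]. As [u(y)] is a unit vector orthogonal to [e(y)], it is [i e(y)] or its
    opposite; this sign decides about conjugation. *)
Lemma matched_form x y e u : peak_point x -> peak_point y -> matched G x y ->
  G 1 e -> G 'i%C%:A u ->
  (ev y e = 1 \/ ev y e = -1) /\
  ((ev y u = 'i%C * ev y e /\ forall a b, G a b -> ev y b = ev y e * ev x a) \/
   (ev y u = - ('i%C * ev y e) /\ forall a b, G a b -> ev y b = ev y e * conjc (ev x a))).
Proof.
move=> px py xy Ge Gu.
have e2 : ev y e = 1 \/ ev y e = -1.
  have := preserving_inv PG y Ge Ge (mulr1 1) => /eqP.
  by rewrite -expr2 sqrf_eq1 => /orP[] /eqP; [left|right].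
split=> //.
have re a b : G a b -> complex.Re (ev x a) = dot (ev y e) (ev y b).
  by move=> ab; rewrite -(matched_dot PG px py xy Ge ab) ev1 dot1.
have im a b : G a b -> complex.Im (ev x a) = dot (ev y u) (ev y b).
  by move=> ab; rewrite -(matched_dot PG px py xy Gu ab) evC doti.
have u0 := re _ _ Gu; rewrite evC /= in u0.
have nu : nc (ev y u) ^+ 2 = 1 by rewrite (xy _ _ Gu) evC nc_i expr1n.
rewrite sqr_nc in nu.
have [Reu Imu] : complex.Re (ev y u) = 0 /\ (complex.Im (ev y u) = 1 \/ complex.Im (ev y u) = -1).
  have Re0 : complex.Re (ev y u) = 0.
    by case: e2 u0 => ->; rewrite /dot /=; lra.
  split=> //; move/eqP: nu; rewrite Re0 expr0n add0r sqrf_eq1.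
  by move=> /orP[] /eqP; [left|right].
have res (s t : R) : (s = 1 \/ s = -1) -> (t = 1 \/ t = -1) ->
    ev y e = s%:C%C -> complex.Im (ev y u) = s * t -> forall a b, G a b ->
    ev y b = s%:C%C * Complex (complex.Re (ev x a)) (t * complex.Im (ev x a)).
  move=> s1 t1 es us a b ab.
  have h1 := re _ _ ab; have h2 := im _ _ ab.
  rewrite es /dot /= in h1; rewrite /dot Reu us in h2.
  apply/eqP; rewrite eq_complex /=; apply/andP; split; apply/eqP;
    by case: s1 t1 h1 h2 => -> [] -> h1 h2; lra.
have uE (t : R) : complex.Im (ev y u) = t -> ev y u = 'i%C * t%:C%C.
  by move=> <-; apply/eqP; rewrite eq_complex cReM cImM Reu /=; apply/andP; split; apply/eqP; ring.
have cE a : Complex (complex.Re (ev x a)) (1 * complex.Im (ev x a)) = ev x a.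
  by rewrite mul1r; case: (ev x a).
have cN a : Complex (complex.Re (ev x a)) (-1 * complex.Im (ev x a)) = conjc (ev x a).
  by rewrite mulN1r; case: (ev x a).
have N1 : (-1 : R[i]) = (-1)%:C%C by rewrite rmorphN rmorph1.
case: e2 => e1; case: Imu => u1; [left|right|right|left].
- split; first by rewrite (uE _ u1) e1.
  by move=> a b ab; rewrite (res 1 1 _ _ _ _ a b ab) ?cE ?e1 ?mulr1//; left.
- split; first by rewrite (uE _ u1) e1 mulr1 -[RHS]mulrN1 N1.
  by move=> a b ab; rewrite (res 1 (-1) _ _ _ _ a b ab) ?cN ?e1 ?mul1r//; [left|right].
- split; first by rewrite (uE _ u1) e1 mulrN opprK.
  move=> a b ab; rewrite (res (-1) (-1) _ _ _ _ a b ab) ?cN ?e1 ?N1//; [right|right|] => //.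
  by rewrite u1 mulrNN mulr1.
- split; first by rewrite (uE _ u1) e1 N1.
  move=> a b ab; rewrite (res (-1) 1 _ _ _ _ a b ab) ?cE ?e1 ?N1//; [right|left|] => //.
  by rewrite mulr1.
Qed.

Lemma dot_near (X : topologicalType) (F H : X -> C) x (e : R) :
  continuous F -> continuous H -> 0 < e ->
  \forall y \near x, `|dot (F y) (H y) - dot (F x) (H x)| < e.
Proof.
move=> /continuous_ncP cF /continuous_ncP cH e0.
pose K := nc (F x) + nc (H x) + 1.
have K0 : 0 < K by have := nc_ge0 (F x); have := nc_ge0 (H x); rewrite /K; lra.
pose d := Num.min 1 (e / K).
have d0 : 0 < d by rewrite lt_min ltr01 divr_gt0.
have d1 : d <= 1 by rewrite ge_min lexx.
have dK : d * K <= e by rewrite -ler_pdivlMr// ge_min lexx orbT.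
apply: filterS (filterI (cF x d d0) (cH x d d0)) => y [/= h1 h2].
have -> : dot (F y) (H y) - dot (F x) (H x) =
    dot (F y - F x) (H y) + dot (F x) (H y - H x).
  by rewrite /dot !cReD !cImD !cReN !cImN; ring.
have h3 := nc_tri (H y) (H x).
have h4 := dot_le (F y - F x) (H y); have h5 := dot_le (F x) (H y - H x).
have h6 := ler_normD (dot (F y - F x) (H y)) (dot (F x) (H y - H x)).
have f0 := nc_ge0 (F x); have h0 := nc_ge0 (H x).
have h7 : nc (F x) * nc (H y - H x) <= nc (F x) * d by rewrite ler_wpM2l// ltW.
have h8 : nc (F y - F x) * nc (H y) <= nc (F y - F x) * K.
  by rewrite ler_wpM2l ?nc_ge0// /K; lra.
have h9 : nc (F y - F x) * (nc (H x) + 1) <= d * (nc (H x) + 1) - 0.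
  by rewrite subr0 ler_wpM2r//; [lra|exact: ltW].
have h10 : nc (F y - F x) * nc (H y) <= nc (F y - F x) * (nc (H x) + 1).
  by rewrite ler_wpM2l ?nc_ge0//; lra.
have h11 : nc (F y - F x) * (nc (H x) + 1) < d * (nc (H x) + 1).
  by rewrite ltr_pM2r//; lra.
rewrite /K in dK; lra.
Qed.

(** The real and imaginary parts of [f(phi y)] are inner products of fixed continuous functions of
    [y]. *)
Lemma matched_continuous (phi : set_type (Ch B) -> set_type (Ch A)) :
  (forall y, matched G (\val (phi y)) (\val y)) -> continuous phi.
Proof.
move=> h; apply: continuous_subcharacters => f; apply/continuous_ncP => y e e0.
have [tot _ _] := PG.
have [b fb] := tot f; have [o Go] := tot 1; have [u Gu] := tot ('i%C%:A).
have peak (D : comBanachAlgType R[i]) (z : set_type (Ch D)) : peak_point (\val z).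
  by apply/ChP; exact: set_valP.
have re z : complex.Re (ev (\val (phi z)) f) = dot (ev (\val z) o) (ev (\val z) b).
  by rewrite -(matched_dot PG (peak _ _) (peak _ _) (h z) Go fb) ev1 dot1.
have im z : complex.Im (ev (\val (phi z)) f) = dot (ev (\val z) u) (ev (\val z) b).
  by rewrite -(matched_dot PG (peak _ _) (peak _ _) (h z) Gu fb) evC doti.
have e2 : 0 < e / 2 by rewrite divr_gt0.
have H1 := dot_near y (@ev_val_continuous _ B (Ch B) o) (@ev_val_continuous _ B (Ch B) b) e2.
have H2 := dot_near y (@ev_val_continuous _ B (Ch B) u) (@ev_val_continuous _ B (Ch B) b) e2.
apply: filterS (filterI H1 H2) => z [/= h1 h2].
apply: le_lt_trans (nc_le_ReIm _) _.
by rewrite cReD cImD cReN cImN !re !im; lra.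
Qed.
End Matching.

Section MatchingHomeomorphism.
Variables (R : realType) (A B : comBanachAlgType R[i]) (G : A -> B -> Prop).
Hypothesis PG : preserving G.

(** Points are matched in both directions, and [matched_inj] makes the two choices mutually
    inverse. *)
Lemma exists_matching : exists2 phi : set_type (Ch B) -> set_type (Ch A),
  homeomorphism phi & forall y, matched G (\val (phi y)) (\val y).
Proof.
have peak (D : comBanachAlgType R[i]) (z : set_type (Ch D)) : peak_point (\val z).
  by apply/ChP; exact: set_valP.
have PG' := preserving_sym PG.
have /choice[psi psiP] (x : set_type (Ch A)) :
    exists y : set_type (Ch B), matched G (\val x) (\val y).
  have [y py xy] := exists_matched PG (peak _ x).
  by exists (exist _ y (mem_set ((ChP y).2 py))).
have /choice[phi phiP] (y : set_type (Ch B)) :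
    exists x : set_type (Ch A), matched G (\val x) (\val y).
  have [x px yx] := exists_matched PG' (peak _ y).
  exists (exist _ x (mem_set ((ChP x).2 px))) => a b ab.
  by rewrite /= (yx b a ab).
exists phi => //; split; first exact: matched_continuous PG _ phiP.
exists psi.
  apply: (matched_continuous PG') => x b a ba.
  by rewrite (psiP x _ _ ba).
split=> [y|x]; apply: val_inj; apply: character_ext => f.
  apply: (matched_inj (x := \val (psi (phi y))) (x' := \val y) PG' (y := \val (phi y))).
    by move=> b a ba; rewrite (psiP (phi y) _ _ ba).
  by move=> b a ba; rewrite (phiP y _ _ ba).
exact: (matched_inj PG (phiP (psi x)) (psiP x)).
Qed.
End MatchingHomeomorphism.

(** * Semisimplicity of [B] and the final formula *)

Lemma radical0 (R : realType) (A : comBanachAlgType R[i]) (x : A) :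
  semisimple A -> (forall m : max_ideal_space A, ev m x = 0) -> x = 0.
Proof.
move=> ssA x0; have : radical x by apply/radicalP.
by rewrite ssA.
Qed.

Theorem theorem7p4 (R : realType) (A B : comBanachAlgType R[i])
    (S : A -> B) (alpha : R[i]) :
  semisimple A ->
  range S = [set: B] ->
  alpha != 0 ->
  (forall f g : A,
     spectral_radius (S f * S g - alpha%:A) =
     spectral_radius (f * g - alpha%:A)) ->
  semisimple B /\
  exists (eta : B) (phi : set_type (Ch B) -> set_type (Ch A))
         (K : set (set_type (Ch B))),
    [/\ eta ^+ 2 = 1,
        homeomorphism phi,
        clopen K,
        (forall (f : A) (y : set_type (Ch B)),
           gelfand (S f) (\val y) =
           gelfand eta (\val y) *
           (if y \in K then gelfand f (\val (phi y))
            else alpha / `|alpha| * (gelfand f (\val (phi y)))^*))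
      (* For alpha < 0 the implication S 1 = 1 -> eta = 1 fails: take A = B = C,
         alpha = -1 and S the complex conjugation, which forces eta = -1. *)
      & (S 1 = 1 -> ~~ (alpha < 0) -> eta = 1) /\
        (S 1 = 1 ->
         alpha \isn't Num.real \/
           (exists2 l : R[i], l \isn't Num.real & S l%:A = l%:A) ->
         K = [set: set_type (Ch B)] /\
         forall (f : A) (y : set_type (Ch B)),
           gelfand (S f) (\val y) = gelfand f (\val (phi y)))].
Proof.
move=> ssA Ssurj a0 Sr.
have surj (b : B) : exists a, S a = b.
  have : [set: B] b by []. by rewrite -Ssurj => -[a _ <-]; exists a.
clear Ssurj.
(* Dividing both factors by [beta] reduces [alpha] to 1. *)
pose beta := sqrtc alpha.
have b2 : beta * beta = alpha by rewrite -expr2 sqr_sqrtc.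
have b0 : beta != 0 by rewrite sqrtc_eq0.
(* If [f(m)] were nonzero, the constant [- alpha / f(m)] would give [f g - alpha] the value
   [- 2 alpha] at [m], while the image has radius at most [|alpha|]. *)
have zero f : (forall m, ev m (S f) = 0) -> f = 0.
  move=> Sf0; apply: radical0 => // m; apply: contrapT => /eqP mf.
  have h1 : spectral_radius (S f * S ((- alpha / ev m f)%:A) - alpha%:A) <= nc alpha.
    by apply: radius_le => y; rewrite evB evM Sf0 mul0r sub0r evC ncN.
  have := ev_le_radius m (f * (- alpha / ev m f)%:A - alpha%:A).
  rewrite -Sr evB evM !evC mulrC divfK// -opprD ncN -mulr2n -mulr_natl ncM nc_nat => h2.
  have na : 0 < nc alpha by rewrite nc_gt0.
  by have := le_trans h2 h1; lra.
(* An element of the radical and 0 both have only 0 as preimage. *)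
have ssB : semisimple B.
  apply/seteqP; split=> [x /radicalP x0|_ ->]; last by apply/radicalP => m; exact: ev0.
  have [f fx] := surj x; have [g g0] := surj 0.
  have f0 : f = 0 by apply: zero => m; rewrite fx.
  have gE : g = 0 by apply: zero => m; rewrite g0 ev0.
  by rewrite /= -fx f0 -gE g0.
split=> //.
pose G a b := exists f, a = beta^-1 *: f /\ b = beta^-1 *: S f.
have PG : preserving G.
  split=> [a|b|a b a' b' [f [-> ->]] [f' [-> ->]]].
  - by exists (beta^-1 *: S (beta *: a)), (beta *: a); rewrite scalerA mulVf ?scale1r.
  - have [f fb] := surj (beta *: b).
    by exists (beta^-1 *: f), f; rewrite fb scalerA mulVf ?scale1r.
  have E (D : comBanachAlgType R[i]) (x y : D) :
      beta^-1 *: x * (beta^-1 *: y) - 1 = alpha^-1 *: (x * y - alpha%:A).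
    by rewrite -scalerAl -scalerAr scalerA -invfM b2 scalerBr scalerA mulVf ?scale1r.
  by rewrite !E !radiusZ Sr.
have GS f : G (beta^-1 *: f) (beta^-1 *: S f) by exists f.
have [tot _ _] := PG.
have [eta Ge] := tot 1; have [u Gu] := tot 'i%C%:A.
have [phi homphi phiP] := exists_matching PG.
have peak (D : comBanachAlgType R[i]) (z : set_type (Ch D)) : peak_point (\val z).
  by apply/ChP; exact: set_valP.
have form (y : set_type (Ch B)) := matched_form PG (peak _ (phi y)) (peak _ y) (phiP y) Ge Gu.
pose K := [set y : set_type (Ch B) | ev (\val y) u = 'i%C * ev (\val y) eta].
have ne (y : set_type (Ch B)) : nc (ev (\val y) eta) = 1 by rewrite (phiP y _ _ Ge) ev1 Normc.normc1.
have offK (y : set_type (Ch B)) : ~ K y -> ev (\val y) u = - ('i%C * ev (\val y) eta) /\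
    forall a b, G a b -> ev (\val y) b = ev (\val y) eta * conjc (ev (\val (phi y)) a).
  by move=> nK; have [_ [[h _]|//]] := form y.
have onK (y : set_type (Ch B)) : K y -> forall a b, G a b -> ev (\val y) b = ev (\val y) eta * ev (\val (phi y)) a.
  move=> Ky; have [_ [[_ //]|[h _]]] := form y.
  have : ev (\val y) u = 0.
    have : ev (\val y) u + ev (\val y) u = 0 by rewrite {1}Ky h subrr.
    by rewrite -mulr2n => /eqP; rewrite mulrn_eq0 => /eqP.
  by move=> u0; have := ne y; have := phiP y _ _ Gu; rewrite u0 evC nc_i Normc.normc0; lra.
(* [w] vanishes on [K] and has modulus 2 off [K], which makes [K] clopen. *)
pose w := u - 'i%C *: eta.
have wK (y : set_type (Ch B)) : K y -> ev (\val y) w = 0 by move=> Ky; rewrite evB evZ Ky subrr.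
have wnK (y : set_type (Ch B)) : ~ K y -> nc (ev (\val y) w) = 2.
  move=> /offK[h _]; rewrite evB evZ h.
  have -> : - ('i%C * ev (\val y) eta) - 'i%C * ev (\val y) eta =
     - (2%:R * ('i%C * ev (\val y) eta)) by ring.
  by rewrite ncN !ncM nc_nat nc_i ne !mulr1.
have /continuous_ncP wc := @ev_val_continuous _ B (Ch B) w.
have clopK : clopen K.
  split; last rewrite -openC; rewrite openE => y Ky.
    apply: filterS (wc y 1 ltr01) => z; rewrite (wK y Ky) subr0 => h.
    by apply: contrapT => /wnK h2; move: h; rewrite h2 ltNge ler1n.
  apply: filterS (wc y 1 ltr01) => z h /wK h2.
  by move: h; rewrite h2 sub0r ncN (wnK y Ky) ltNge ler1n.
(* The conjugated scalar [beta^-1] against [beta] is the origin of [alpha / |alpha|]. *)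
have bconj : beta * conjc beta^-1 = alpha / `|alpha|.
  have -> : `|alpha| = beta * conjc beta by rewrite -b2 normrM -expr2 sqr_normc.
  rewrite -b2 conjc_inv; field; rewrite conjc_eq0 b0 //.
have formula (f : A) (y : set_type (Ch B)) : gelfand (S f) (\val y) = gelfand eta (\val y) *
   (if y \in K then gelfand f (\val (phi y))
    else alpha / `|alpha| * (gelfand f (\val (phi y)))^*).
  have SE : gelfand (S f) (\val y) = beta * ev (\val y) (beta^-1 *: S f).
    by rewrite evZ mulrA mulfV// mul1r.
  rewrite SE; case: ifPn => [/set_mem Ky|/negP nK].
    by rewrite (onK y Ky _ _ (GS f)) evZ mulrCA [beta * _]mulrA mulfV// mul1r.
  have [_ h] := offK y (fun Ky => nK (mem_set Ky)).
  by rewrite (h _ _ (GS f)) evZ rmorphM mulrCA [beta * _]mulrA bconj.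
have eta2 : eta ^+ 2 = 1.
  apply/eqP; rewrite -subr_eq0; apply/eqP; apply: radical0 => // m.
  by rewrite evB ev1 expr2 evM (preserving_inv PG m Ge Ge (mulr1 1)) subrr.
have S1K (y : set_type (Ch B)) : S 1 = 1 -> y \in K -> ev (\val y) eta = 1.
  move=> S1 yK; have := formula 1 y; rewrite yK S1.
  by rewrite -[gelfand 1 _]/(ev _ 1) -[gelfand 1 (\val (phi y))]/(ev _ 1) !ev1 mulr1 => /esym.
have S1nK (y : set_type (Ch B)) : S 1 = 1 -> y \notin K -> ev (\val y) eta * (alpha / `|alpha|) = 1.
  move=> S1 yK; have := formula 1 y; rewrite (negbTE yK) S1.
  rewrite -[gelfand 1 _]/(ev _ 1) -[gelfand 1 (\val (phi y))]/(ev _ 1) !ev1.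
  by rewrite rmorph1 mulr1 => /esym.
have na0 : `|alpha| != 0 by rewrite normr_eq0.
(* Off [K], [S 1 = 1] gives [eta(y) alpha / |alpha| = 1] with [eta(y)] equal to 1 or [- 1]; so
   [alpha] is real. *)
have aE (y : set_type (Ch B)) : S 1 = 1 -> y \notin K ->
    (ev (\val y) eta = 1 /\ alpha = `|alpha|) \/ alpha = - `|alpha|.
  move=> S1 yK; have := S1nK y S1 yK; have [[e1|e1] _] := form y; rewrite e1.
    by rewrite mul1r => /(congr1 (fun z => z * `|alpha|)); rewrite divfK// mul1r; left.
  rewrite mulN1r => /(congr1 (fun z => - (z * `|alpha|))).
  by rewrite mulNr opprK divfK// mul1r; right.
exists eta, phi, K; split=> //; split=> [S1 an0|S1 H].
  apply/eqP; rewrite -subr_eq0; apply/eqP; apply: radical0 => // m.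
  suff r0 : spectral_radius (eta - 1) = 0 by have := radius_eq0 r0 m.
  (* The radius of [eta - 1] is attained on the Choquet boundary, where [eta = 1];
     [alpha = - |alpha|] is excluded off [K]. *)
  have [y py <-] := peak_boundary (eta - 1).
  pose y' : set_type (Ch B) := exist _ y (mem_set ((ChP y).2 py)).
  have -> : ev y (eta - 1) = 0; last exact: Normc.normc0.
  rewrite evB ev1; apply/eqP; rewrite subr_eq0; apply/eqP.
  have [yK|yK] := boolP (y' \in K); first exact: (S1K y').
  have [[//]|aN] := aE y' S1 yK.
  by move: an0; rewrite aN oppr_lt0 normr_gt0 a0.
(* A point off [K] makes [alpha] real, and the formula at a fixed scalar [l] reads [l = conjc l]. *)
have allK y : y \in K.
  apply: contrapT => /negP yK; case: H => [|[l ln Sl]].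
    by have [[_ ->]|->] := aE y S1 yK; rewrite ?rpredN normr_real.
  have := formula l%:A y; rewrite (negbTE yK) Sl mulrA (S1nK y S1 yK) mul1r.
  rewrite -[gelfand l%:A _]/(ev _ l%:A) -[gelfand l%:A (\val (phi y))]/(ev _ l%:A) !evC.
  by move=> /esym/CrealP; apply/negP.
split; first by apply/seteqP; split=> // y _; exact/set_mem/allK.
move=> f y; rewrite formula allK -[gelfand eta _]/(ev _ eta) S1K// ?mul1r//.
Qed.
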